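(* Let $G$ be a cubic (i.e. $3$-regular) graph on $n$ vertices that is not isomorphic to $K_4$, $K_{3,3}$, or $3K_4$. Then $G$ contains a spanning subgraph $H$ such that for every integer $k$ with $0 \le k \le 3$, $$m(H,k) \in \left\{\left\lfloor\frac{n}{4}\right\rfloor, \left\lceil\frac{n}{4}\right\rceil\right\}.$$
   Context: All graphs are finite and simple (no loops, no parallel edges); they are not assumed to be connected. A spanning subgraph of $G$ is a subgraph with the same vertex set as $G$ (and an arbitrary subset of the edges of $G$). For a graph $H$ and a nonnegative integer $k$, $m(H,k)$ denotes the number of vertices of degree $k$ in $H$. $K_4$ is the complete graph on $4$ vertices, $K_{3,3}$ the complete bipartite graph with parts of size $3$ and $3$, and $3K_4$ the disjoint union of three copies of $K_4$. *)

(* Defs.v *)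
From mathcomp Require Import all_boot.

Set Implicit Arguments.
Unset Strict Implicit.
Unset Printing Implicit Defensive.

(* A finite simple graph is given by its adjacency relation on a finType of
   vertices. *)
Definition simple_graph (V : finType) (e : rel V) : Prop :=
  symmetric e /\ irreflexive e.

Definition degree (V : finType) (e : rel V) (v : V) : nat := #|[set w | e v w]|.

Definition cubic (V : finType) (e : rel V) : Prop := forall v, degree e v = 3.

Definition isomorphic (V W : finType) (e : rel V) (f : rel W) : Prop :=
  exists2 phi : V -> W, bijective phi & {mono phi : x y / e x y >-> f x y}.

Definition spanning_subgraph (V : finType) (h e : rel V) : Prop :=
  simple_graph h /\ subrel h e.

(* The number m(H, k) of vertices of degree k. *)
Definition num_deg (V : finType) (h : rel V) (k : nat) : nat :=
  #|[set v | degree h v == k]|.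

Definition complete_graph (n : nat) : rel 'I_n := fun x y => x != y.
Arguments complete_graph : clear implicits.

Definition complete_bipartite (m n : nat) : rel ('I_m + 'I_n)%type :=
  fun x y => is_inl x != is_inl y.
Arguments complete_bipartite : clear implicits.

(* The disjoint union of c copies of e; the first component of a vertex is the
   index of its copy. *)
Definition copies (c : nat) (V : finType) (e : rel V) : rel ('I_c * V)%type :=
  fun x y => (x.1 == y.1) && e x.2 y.2.
Arguments copies c {V} e _ _.

(* The ceiling of n / d, for d > 0 (m %/ d is the floor). *)
Definition ceil_div (n d : nat) : nat := (n + d.-1) %/ d.

(* Main.v *)
Require Import Defs.
From mathcomp Require Import all_boot zify.

Set Implicit Arguments.
Unset Strict Implicit.
Unset Printing Implicit Defensive.

(** Colour the edges of H red and the remaining edges blue.  By induction on the number of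
    vertices one suppresses an edge uv (with a, b the other neighbours of u and c, d those of v,
    delete u and v and add the edges ab and cd) or a diamond (delete it and join its two outer
    neighbours), and takes a balanced colouring of the smaller graph, up to exchanging the
    colours.  If ab and cd have different colours, then colouring the paths a-u-b and c-v-d
    accordingly and uv red or blue, as parity dictates, is balanced.  If both are red, or if a
    diamond was suppressed, the natural extension is off by one in some degrees and is repaired
    by toggling a few edges; if every such repair is impossible, the neighbours of the vertices
    of each degree are so restricted that the degree counts contradict balance.

    An edge can be suppressed unless a and b are adjacent, c and d are adjacent, or
    {a, b} = {c, d}.  If this fails for every edge, then every component other than K_4 contains
    a diamond that can be suppressed.  Two K_4 components are removed together, one
    coloured with degrees 3, 3, 2, 2 and the other with degrees 1, 1, 0, 0.  When the smaller
    graph is K_4, K_{3,3} or 3K_4, an explicit colouring is given. *)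

(** Balance concerns four counts only, so a repair is judged by the degree changes of a few
    vertices. In a balanced colouring of a cubic graph both the number of vertices and the number of
    vertices of odd degree are even; with differences at most one this forces m(0) = m(2) and m(1) =
    m(3). Two additional vertices therefore keep the balance with degrees 0 and 2, or with degrees 1
    and 3, but which of the two pairs works is dictated by the smaller graph. Two restored vertices
    of degree 2 have to be corrected towards the prescribed pair, and each pair needs an analysis of
    its own. The blue edge uv is a reserve in both: making it red raises u and v from 2 to 3.

    The concluding contradictions share one mechanism: where no repair exists, degree 3 spreads from
    the restored part to its surroundings, while the vertices of degree 1 or 2 that balance then
    requires have no room.

    The vertex type V never changes; the induction runs over subsets A of it. *)

(* Pairwise differences at most one: for four numbers with sum n this says that each of them
   is the floor or the ceiling of n / 4. *)
Definition bal (a b c d : nat) : Prop :=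
  (a <= b.+1 /\ a <= c.+1 /\ a <= d.+1) /\ (b <= a.+1 /\ b <= c.+1 /\ b <= d.+1) /\
  (c <= a.+1 /\ c <= b.+1 /\ c <= d.+1) /\ (d <= a.+1 /\ d <= b.+1 /\ d <= c.+1).

(** * Colourings of a graph living on a subset of the vertex type *)

Definition sub_rel (V : finType) (e h : rel V) : Prop := symmetric h /\ subrel h e.

Definition num_on (V : finType) (A : {set V}) (h : rel V) (k : nat) : nat :=
  #|[set x in A | degree h x == k]|.

Definition balanced_on (V : finType) (A : {set V}) (h : rel V) : Prop :=
  bal (num_on A h 0) (num_on A h 1) (num_on A h 2) (num_on A h 3).

Definition solvable (V : finType) (A : {set V}) (e : rel V) : Prop :=
  exists2 h : rel V, sub_rel e h & balanced_on A h.

(** All edges stay inside [A], so a deleted vertex is isolated in [e] and in every colouring;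
    deleting vertices shrinks [A] and leaves [V] alone. *)
Definition cubic_on (V : finType) (A : {set V}) (e : rel V) : Prop :=
  [/\ symmetric e, irreflexive e, forall x y, e x y -> x \in A &
      forall x, x \in A -> degree e x = 3].

Lemma eq_degree (V : finType) (h k : rel V) x : h x =1 k x -> degree h x = degree k x.
Proof. by move=> hk; apply: eq_card => y; rewrite !inE hk. Qed.

(* Everything in sight is finite, so solvability is decidable. *)
Lemma solvable_em (V : finType) (A : {set V}) (e : rel V) : solvable A e \/ ~ solvable A e.
Proof.
pose r (S : {set V * V}) : rel V := fun x y => (x, y) \in S.
pose balb (a b c d : nat) := [&& a <= b.+1, a <= c.+1, a <= d.+1, b <= a.+1, b <= c.+1,
  b <= d.+1, c <= a.+1, c <= b.+1, c <= d.+1, d <= a.+1, d <= b.+1 & d <= c.+1].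
have balP a b c d : reflect (bal a b c d) (balb a b c d).
  apply: (iffP idP) => [|[[? [? ?]] [[? [? ?]] [[? [? ?]] [? [? ?]]]]]]; last first.
    by rewrite /balb; repeat (apply/andP; split).
  by do 11 (case/andP => ?); move=> ?; do !split.
pose ok S := [&& [forall x, forall y, r S x y == r S y x],
   [forall x, forall y, r S x y ==> e x y] &
   balb (num_on A (r S) 0) (num_on A (r S) 1) (num_on A (r S) 2) (num_on A (r S) 3)].
case: (boolP [exists S, ok S]) => [/existsP[S /and3P[/forallP s1 /forallP s2 /balP s3]]|no].
  left; exists (r S) => //; split=> x y.
    by apply/eqP; move/forallP: (s1 x).
  by apply/implyP; move/forallP: (s2 x).
right=> -[h [h1 h2] h3]; case/negP: no; apply/existsP.
exists [set p | h p.1 p.2].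
have E x : r [set p | h p.1 p.2] x =1 h x by move=> y; rewrite /r inE.
have En k : num_on A (r [set p | h p.1 p.2]) k = num_on A h k.
  by apply: eq_card => x; rewrite !inE (eq_degree (E x)).
apply/and3P; split.
- by apply/forallP=> x; apply/forallP=> y; rewrite !E h1.
- by apply/forallP=> x; apply/forallP=> y; rewrite !E; apply/implyP; apply: h2.
- by apply/balP; rewrite !En.
Qed.

(** * Toggling edges *)

Section Toggle.
Variables (V : finType) (e : rel V).

Definition toggle (h : rel V) (x y : V) : rel V :=
  fun a b => h a b (+) (((a == x) && (b == y)) || ((a == y) && (b == x))).

Lemma toggle_sub h x y : symmetric e -> e x y -> sub_rel e h -> sub_rel e (toggle h x y).
Proof.
move=> es exy [hs he]; split=> a b; rewrite /toggle.
  by rewrite hs orbC ![(_ == x) && _]andbC ![(_ == y) && _]andbC.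
case: (boolP (_ || _)) => [|_]; last by rewrite addbF; apply: he.
by case/orP=> /andP[/eqP-> /eqP->] _; rewrite // es.
Qed.

Lemma toggle_other h x y z : z != x -> z != y -> degree (toggle h x y) z = degree h z.
Proof.
by move=> zx zy; apply: eq_degree => w; rewrite /toggle (negbTE zx) (negbTE zy) addbF.
Qed.

Lemma toggle_left h x y : x != y ->
  degree (toggle h x y) x = if h x y then (degree h x).-1 else (degree h x).+1.
Proof.
move=> xy; have E w : toggle h x y x w = (if w == y then ~~ h x y else h x w).
  rewrite /toggle eqxx (negbTE xy) /= orbF; case: eqP => [->|]; rewrite ?addbF //.
  by rewrite addbT.
rewrite /degree (cardsD1 y [set w | h x w]) (cardsD1 y [set w | toggle h x y x w]).
rewrite !inE E eqxx; case hxy: (h x y); rewrite ?add0n ?add1n /=; last congr _.+1.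
  by apply: eq_card => w; rewrite !inE E; case: eqP.
by apply: eq_card => w; rewrite !inE E; case: eqP.
Qed.

Lemma toggleC h x y a b : toggle h x y a b = toggle h y x a b.
Proof. by rewrite /toggle orbC. Qed.

Lemma toggle_right h x y : symmetric h -> x != y ->
  degree (toggle h x y) y = if h x y then (degree h y).-1 else (degree h y).+1.
Proof.
move=> hs xy; rewrite (eq_degree (k := toggle h y x)); last by move=> w; exact: toggleC.
by rewrite toggle_left 1?eq_sym // hs.
Qed.

Lemma toggle_edge h x y a b :
  ((a, b) != (x, y)) -> ((a, b) != (y, x)) -> toggle h x y a b = h a b.
Proof. by rewrite /toggle !xpair_eqE => /negbTE-> /negbTE->; rewrite addbF. Qed.

End Toggle.

(* A move is a list of toggled edges (i, j, b) between the vertices s_i and s_j of a list s;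
   b tells whether the edge is added or removed. *)
Definition move := seq (nat * nat * bool).

Definition bump_at (b : bool) (d : nat) : nat := if b then d.+1 else d.-1.

Fixpoint new_degrees (L : move) (ds : seq nat) : seq nat :=
  if L is (i, j, b) :: L' then
    new_degrees L' (set_nth 0 (set_nth 0 ds i (bump_at b (nth 0 ds i))) j
                            (bump_at b (nth 0 ds j)))
  else ds.

(** No edge may be listed twice: [allowed] tests every entry against the initial colouring, which is
    correct only if the earlier toggles concern other edges. *)
Fixpoint wf_move (n : nat) (L : move) : bool :=
  if L is (i, j, _) :: L' then
    [&& i < n, j < n, i != j, all (fun p => ((p.1.1, p.1.2) != (i, j)) &&
      ((p.1.1, p.1.2) != (j, i))) L' & wf_move n L']
  else true.

(** Being an end of a toggled edge is what places each listed vertex in [A]. *)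
Definition covers (n : nat) (L : move) : bool :=
  all (fun k => has (fun p => (p.1.1 == k) || (p.1.2 == k)) L) (iota 0 n).

Section Moves.
Variables (V : finType) (A : {set V}) (e : rel V).
Hypothesis e3 : cubic_on A e.

Fixpoint allowed (h : rel V) (s : seq V) (x0 : V) (L : move) : Prop :=
  if L is (i, j, b) :: L' then
    [/\ e (nth x0 s i) (nth x0 s j) = true, h (nth x0 s i) (nth x0 s j) = ~~ b
      & allowed h s x0 L']
  else True.

Lemma move_degrees x0 (s : seq V) L h (ds : seq nat) : uniq s -> sub_rel e h ->
  map (degree h) s = ds -> wf_move (size s) L -> allowed h s x0 L ->
  exists h', [/\ sub_rel e h', map (degree h') s = new_degrees L ds &
    forall x, x \notin s -> degree h' x = degree h x].
Proof.
case: e3 => es ei _ _ us; elim: L h ds => [|[[i j] b] L IH] h ds hs hd /=.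
  by move=> _ _; exists h.
case/and5P=> li lj ij aL wL [eij hij hL].
set x := nth x0 s i in eij hij; set y := nth x0 s j in eij hij.
have xy : x != y by apply: contraTneq eij => ->; rewrite ei.
have xyE k l : k < size s -> l < size s -> (nth x0 s k == nth x0 s l) = (k == l).
  by move=> lk ll; rewrite nth_uniq.
have szd : size ds = size s by rewrite -hd size_map.
have [] := IH (toggle h x y) (set_nth 0 (set_nth 0 ds i (bump_at b (nth 0 ds i))) j
                            (bump_at b (nth 0 ds j))).
- exact: toggle_sub.
- have nd k : k < size s -> nth 0 ds k = degree h (nth x0 s k).
    by move=> lk; rewrite -hd (nth_map x0).
  apply: (@eq_from_nth _ 0) => [|k].
    by rewrite size_map !size_set_nth szd !(maxn_idPr _).
  rewrite size_map => lk; rewrite (nth_map x0) // !nth_set_nth /= !nth_set_nth /=.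
  have [->|kj] := eqVneq k j.
    rewrite (toggle_right (proj1 hs) xy) hij nd //.
    by case: (b).
  have [->|ki] := eqVneq k i; first by rewrite (toggle_left _ xy) hij nd //; case: (b).
  by rewrite toggle_other ?nd // xyE.
- exact: wL.
(* The remaining entries were tested against [h]; they still hold after toggling [x y], as they
   concern different edges. *)
- move: aL wL hL => {IH}; elim: L => [//|[[k l] c] L IH] /= /andP[/andP[k1 k2] aL].
  case/and5P=> lk ll kl _ wL [p1 p2 p3]; split=> //; last exact: IH.
  by rewrite toggle_edge // xpair_eqE !xyE // -xpair_eqE.
move=> h' [h1 h2 h3]; exists h'; split=> // z zs; rewrite h3 // toggle_other //.
  by apply: contraNneq zs => ->; apply: mem_nth.
by apply: contraNneq zs => ->; apply: mem_nth.
Qed.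

Lemma allowed_mem x0 h s L k : wf_move (size s) L -> allowed h s x0 L ->
  has (fun p => (p.1.1 == k) || (p.1.2 == k)) L -> nth x0 s k \in A.
Proof.
case: e3 => es _ eA _; elim: L => [//|[[i j] b] L IH] /= /and5P[_ _ _ _ wL] [eij _ aL].
case/orP=> [/orP[/eqP<-|/eqP<-]|]; [exact: eA eij| |exact: IH].
by apply: (eA _ (nth x0 s i)); rewrite es.
Qed.

Lemma num_on_split (h : rel V) (s : seq V) k : uniq s -> {subset s <= A} ->
  num_on A h k = #|[set x in A | (degree h x == k) && (x \notin s)]|
                 + count_mem k (map (degree h) s).
Proof.
move=> us sA; rewrite /num_on -(cardsID [set x in s] [set x in A | degree h x == k]) addnC.
congr (_ + _); first by apply: eq_card => x; rewrite !inE; case: (x \in s); rewrite ?andbF ?andbT.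
rewrite count_map -size_filter -(card_uniqP _) ?filter_uniq //; apply: eq_card => x.
by rewrite !inE mem_filter /=; case xs: (x \in s); rewrite ?andbF // sA ?andbT.
Qed.

(** The change of the counts is stated with sums on both sides, since differences would be
    truncated. *)
Lemma move_num x0 (s : seq V) (ds : seq nat) L h : uniq s -> sub_rel e h ->
  map (degree h) s = ds -> wf_move (size s) L -> covers (size s) L -> allowed h s x0 L ->
  exists2 h', sub_rel e h' & forall k,
    num_on A h' k + count_mem k ds = num_on A h k + count_mem k (new_degrees L ds).
Proof.
move=> us hs hd wL cL aL; have [h' [h1 h2 h3]] := move_degrees us hs hd wL aL.
exists h' => // k; have sA : {subset s <= A}.
  move=> x xs; rewrite -(nth_index x0 xs); apply: (allowed_mem wL aL).
  by apply: (allP cL); rewrite mem_iota add0n index_mem.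
rewrite !(num_on_split _ _ us sA) hd h2.
suff -> : [set x in A | (degree h' x == k) && (x \notin s)] =
          [set x in A | (degree h x == k) && (x \notin s)] by lia.
apply/setP=> x; rewrite !inE; case: (boolP (x \in s)) => xs; rewrite ?andbF //.
by rewrite h3.
Qed.

(** The new colouring enters the last premise only through its counts [f]; for concrete lists this
    premise is linear arithmetic in the old counts. *)
Lemma solve_by_move x0 (s : seq V) (ds : seq nat) (L : move) h : uniq s -> sub_rel e h ->
  map (degree h) s = ds -> wf_move (size s) L && covers (size s) L -> allowed h s x0 L ->
  (forall f : nat -> nat,
     (forall k, f k + count_mem k ds = num_on A h k + count_mem k (new_degrees L ds)) ->
     bal (f 0) (f 1) (f 2) (f 3)) ->
  solvable A e.
Proof.
move=> us hs hd /andP[wL cL] aL hb; have [h' h1 h2] := move_num us hs hd wL cL aL.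
by exists h' => //; apply: hb.
Qed.

Lemma num_on_ge (h : rel V) (s : seq V) k : uniq s -> {subset s <= A} ->
  all (fun x => degree h x == k) s -> size s <= num_on A h k.
Proof.
move=> us sA ha; rewrite (num_on_split _ _ us sA) count_map (eq_in_count (a2 := predT)).
  by rewrite count_predT leq_addl.
by move=> x xs /=; rewrite (allP ha).
Qed.

End Moves.

(** * Neighbours in a cubic graph *)

Section Neighbours.
Variables (V : finType) (A : {set V}) (e h : rel V).
Hypotheses (e3 : cubic_on A e) (hs : sub_rel e h).

Lemma red_mem x y : h x y = true -> x \in A.
Proof. by case: e3 hs => _ _ eA _ [_ he] /he /eA. Qed.

Lemma cubic_mem x y : e x y = true -> x \in A.
Proof. by case: e3 => _ _ eA _ /eA. Qed.

Lemma cubic_nbrs x : x \in A ->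
  exists a b c, [/\ uniq [:: a; b; c], e x a = true, e x b = true, e x c = true &
    forall t, e x t = (t \in [:: a; b; c])].
Proof.
case: e3 => _ _ _ d3 /d3; rewrite /degree cardE.
have := mem_enum (mem [set w | e x w]); have := enum_uniq (mem [set w | e x w]).
case: (enum _) => [|a [|b [|c [|]]]] //= u m _; exists a, b, c.
have E t : e x t = (t \in [:: a; b; c]) by rewrite m inE.
by split=> //; rewrite E !inE eqxx ?orbT.
Qed.

Lemma degree_nbrs x a b c : uniq [:: a; b; c] -> (forall t, e x t = (t \in [:: a; b; c])) ->
  degree h x = h x a + h x b + h x c.
Proof.
case: hs => _ he u E; rewrite /degree -[RHS]addn0 -!addnA.
have -> : h x a + (h x b + (h x c + 0)) = count (h x) [:: a; b; c] by [].
rewrite -size_filter -(card_uniqP _) ?filter_uniq //; apply: eq_card => t.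
by rewrite !inE mem_filter; case ht: (h x t) => //=; rewrite -E he.
Qed.

Lemma degree_le3 x : x \in A -> degree h x <= 3.
Proof.
by move/cubic_nbrs=> [a [b [c [u _ _ _ E]]]]; rewrite (degree_nbrs u E); case: (h x a) (h x b) (h x c) => [] [] [].
Qed.

Lemma degree_out x : x \notin A -> degree h x = 0.
Proof.
move=> xA; apply: eq_card0 => y; rewrite inE; apply: contraNF xA; exact: red_mem.
Qed.

(** Adjacency is written as an equation with [true] or [false], the form on which [sat] and
    [congruence] operate. *)
Lemma degree1_nbrs x : degree h x = 1 -> exists y z w,
  [/\ h x y = true, e x z = true /\ h x z = false, e x w = true /\ h x w = false, z <> w &
      forall t, e x t = true -> [\/ t = y, t = z | t = w]].
Proof.
move=> dx; have xA : x \in A by apply: contraT => /degree_out; rewrite dx.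
have [a [b [c [u ea eb ec E]]]] := cubic_nbrs xA.
have nE t : e x t = true -> [\/ t = a, t = b | t = c].
  rewrite E !inE => /or3P[] /eqP->; [exact: Or31|exact: Or32|exact: Or33].
move: (u) dx; rewrite (degree_nbrs u E) /= !inE negb_or andbT => /andP[/andP[/eqP ab /eqP ac] /eqP bc].
case ha: (h x a); case hb: (h x b); case hc: (h x c) => // _.
- by exists a, b, c.
- by exists b, a, c; split=> // t /nE[] ->; [exact: Or32|exact: Or31|exact: Or33].
- by exists c, a, b; split=> // t /nE[] ->; [exact: Or32|exact: Or33|exact: Or31].
Qed.

Lemma degree2_nbrs x : degree h x = 2 -> exists y z w,
  [/\ h x y = true, h x z = true, e x w = true /\ h x w = false, y <> z &
      forall t, e x t = true -> [\/ t = y, t = z | t = w]].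
Proof.
move=> dx; have xA : x \in A by apply: contraT => /degree_out; rewrite dx.
have [a [b [c [u ea eb ec E]]]] := cubic_nbrs xA.
have nE t : e x t = true -> [\/ t = a, t = b | t = c].
  rewrite E !inE => /or3P[] /eqP->; [exact: Or31|exact: Or32|exact: Or33].
move: (u) dx; rewrite (degree_nbrs u E) /= !inE negb_or andbT => /andP[/andP[/eqP ab /eqP ac] /eqP bc].
case ha: (h x a); case hb: (h x b); case hc: (h x c) => // _.
- by exists a, b, c.
- by exists a, c, b; split=> // t /nE[] ->; [exact: Or31|exact: Or33|exact: Or32].
- by exists b, c, a; split=> // t /nE[] ->; [exact: Or33|exact: Or31|exact: Or32].
Qed.

Lemma degree0_blue x y : degree h x = 0 -> h x y = false.
Proof.
move/eqP; rewrite cards_eq0 => /eqP/setP/(_ y); by rewrite !inE.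
Qed.

Lemma degree3_red x y : degree h x = 3 -> e x y = true -> h x y = true.
Proof.
move=> dx exy; have xA := cubic_mem exy; have [a [b [c [u ea eb ec E]]]] := cubic_nbrs xA.
move: dx exy; rewrite (degree_nbrs u E) E !inE.
case ha: (h x a); case hb: (h x b); case hc: (h x c) => // _.
by case/or3P=> /eqP->.
Qed.

Lemma degree1_red x y z : degree h x = 1 -> h x y = true -> h x z = true -> y = z.
Proof.
move=> dx xy xz; have [a [b [c [u ea eb ec E]]]] := cubic_nbrs (red_mem xy).
have := E y; have := E z; rewrite !(proj2 hs) //.
move: dx xy xz; rewrite (degree_nbrs u E) !inE.
by case ha: (h x a); case hb: (h x b); case hc: (h x c) => // _ hy hz
   /esym/or3P[] /eqP ? /esym/or3P[] /eqP ?; subst; congruence.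
Qed.

Lemma degree2_blue x y z : degree h x = 2 -> e x y = true -> h x y = false ->
  e x z = true -> h x z = false -> y = z.
Proof.
move=> dx ey xy ez xz; have [a [b [c [u ea eb ec E]]]] := cubic_nbrs (cubic_mem ey).
move: ey ez dx xy xz; rewrite (degree_nbrs u E) !E !inE.
by case ha: (h x a); case hb: (h x b); case hc: (h x c) =>
   /or3P[] /eqP ? /or3P[] /eqP ? // _ hy hz; subst; congruence.
Qed.

Lemma degree2_red x y z w : degree h x = 2 -> h x y = true -> h x z = true -> h x w = true ->
  [\/ y = z, y = w | z = w].
Proof.
move=> dx xy xz xw; have [a [b [c [_ _ [_ xc] _ E]]]] := degree2_nbrs dx.
have R s : h x s = true -> s = a \/ s = b.
  by move=> xs; case: (E s (proj2 hs _ _ xs)) => E1; [left|right|congruence].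
by case: (R y xy) => E1; case: (R z xz) => E2; case: (R w xw) => E3; subst;
   by [exact: Or31|exact: Or32|exact: Or33].
Qed.

Lemma cubic_four_nbrs x y z w t : uniq [:: y; z; w; t] ->
  e x y = true -> e x z = true -> e x w = true -> e x t = true -> False.
Proof.
move=> u xy xz xw xt; have [a [b [c [_ _ _ _ E]]]] := cubic_nbrs (cubic_mem xy).
have /(uniq_leq_size u) : {subset [:: y; z; w; t] <= [:: a; b; c]}.
  by move=> s; rewrite -E !inE => /or4P[] /eqP->.
by [].
Qed.

Lemma other_nbrs x u : e x u = true -> exists y z,
  [/\ y <> z, u <> y /\ u <> z, e x y = true, e x z = true &
      forall t, e x t = true -> [\/ t = u, t = y | t = z]].
Proof.
move=> xu; have [a [b [c [ua xa xb xc E]]]] := cubic_nbrs (cubic_mem xu).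
have nE t : e x t = true -> [\/ t = a, t = b | t = c].
  rewrite E !inE => /or3P[] /eqP->; [exact: Or31|exact: Or32|exact: Or33].
move: ua; rewrite /= !inE negb_or andbT => /andP[/andP[/eqP ab /eqP ac] /eqP bc].
case: (nE u xu) => ->.
- by exists b, c.
- by exists a, c; split=> //; [split=> // ?; congruence|move=> t /nE[] ->; [exact: Or32|exact: Or31|exact: Or33]].
- exists a, b; split=> //; [split=> ?; congruence|].
  by move=> t /nE[] ->; [exact: Or32|exact: Or33|exact: Or31].
Qed.

Lemma red_degree x y : h x y = true -> [\/ degree h y = 1, degree h y = 2 | degree h y = 3].
Proof.
move=> xy; have yx : h y x = true by rewrite (proj1 hs).
have : degree h y <= 3 by apply/degree_le3/(red_mem yx).
have : degree h y != 0 by apply/eqP => /(degree0_blue x); rewrite yx.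
by case: (degree h y) => [|[|[|[|]]]] // _ _; [exact: Or31|exact: Or32|exact: Or33].
Qed.

Lemma blue_degree x y : e x y = true -> h x y = false ->
  [\/ degree h y = 0, degree h y = 1 | degree h y = 2].
Proof.
case: e3 => es _ _ _ exy hxy; have eyx : e y x = true by rewrite es.
have : degree h y <= 3 by apply/degree_le3/(cubic_mem eyx).
have : degree h y != 3.
  by apply/eqP => /degree3_red/(_ eyx); rewrite (proj1 hs) hxy.
by case: (degree h y) => [|[|[|[|]]]] // _ _; [exact: Or31|exact: Or32|exact: Or33].
Qed.

Lemma num_on_total : num_on A h 0 + num_on A h 1 + num_on A h 2 + num_on A h 3 = #|A|.
Proof.
rewrite -sum1_card (partition_big (fun x => inord (degree h x) : 'I_4) predT) //=.
have E (k : 'I_4) : \sum_(i in A | inord (degree h i) == k) 1 = num_on A h k.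
  rewrite sum1_card; apply: eq_card => x; rewrite !inE unfold_in /=.
  case xA: (x \in A) => //=; rewrite -val_eqE /= inordK //; have := degree_le3 xA; lia.
by rewrite !big_ord_recl big_ord0 !E addn0 !addnA.
Qed.

Lemma num_on_ge_pos (s : seq V) k : uniq s -> 0 < k -> all (fun x => degree h x == k) s ->
  size s <= num_on A h k.
Proof.
move=> us k0 /allP ha; apply: num_on_ge => //; last exact/allP.
move=> x /ha /eqP dx; apply: contraT => /degree_out; rewrite dx => E.
by rewrite E in k0.
Qed.

Lemma num_on_new (s : seq V) k : size s < num_on A h k ->
  exists x, [/\ x \in A, x \notin s & degree h x = k].
Proof.
move=> ls; have /subsetPn[x] : ~~ ([set x in A | degree h x == k] \subset s).
  by apply: contraL ls => /subset_leq_card le; rewrite -leqNgt (leq_trans le) ?card_size.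
by rewrite !inE => /andP[xA /eqP dx] xs; exists x.
Qed.

End Neighbours.

(** * Tactics that check a single repair *)

Ltac prop_bool := unfold is_true in * |-.

(* Closes the finitely many known facts under symmetry, and red edges under being edges. *)
Ltac sat := prop_bool; repeat match goal with
  | hsy : symmetric ?r, H : ?r ?x ?y = ?b |- _ =>
      lazymatch goal with
      | _ : r y x = b |- _ => fail
      | _ => let H1 := fresh in have H1 : r y x = b by [rewrite hsy; exact: H]
      end
  | hse : subrel ?r ?s, H : ?r ?x ?y = true |- _ =>
      lazymatch goal with
      | _ : s x y = true |- _ => fail
      | _ => let H1 := fresh in have H1 : s x y = true by [exact: hse H]
      end
  | hi : irreflexive ?s, H : ?s ?x ?y = true |- _ =>
      lazymatch goal with
      | _ : s x x = false |- _ => fail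
      | _ => let H1 := fresh in have H1 := hi x
      end
  end.

(* Universally quantified facts would make congruence diverge. *)
Ltac ground := repeat match goal with
  | H : symmetric _ |- _ => clear H
  | H : irreflexive _ |- _ => clear H
  | H : subrel _ _ |- _ => clear H
  | H : cubic_on _ _ |- _ => clear H
  | H : sub_rel _ _ |- _ => clear H
  | H : bal _ _ _ _ |- _ => clear H
  | H : forall x : _, _ |- _ => clear H
  end.

Ltac cong := ground; congruence.

(** With [f] a degree, or adjacency to a fixed vertex, known data tell two vertices apart. *)
Lemma differ_by (T U : Type) (f : T -> U) x y p q : f x = p -> f y = q -> p <> q -> x <> y.
Proof. by move=> <- <- n E; rewrite E in n. Qed.

Lemma two_values (T : Type) (x a b : T) : x = a -> x = b -> a <> b -> False.
Proof. by move=> -> ->. Qed.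

Ltac clash := exfalso;
  match goal with
  | H : ?x <> ?x |- _ => exact: (H erefl)
  | H1 : ?t = _, H2 : ?t = _ |- _ => apply: (two_values H1 H2); discriminate
  end.

Ltac differ :=
  match goal with
  | H : ?x <> ?y |- ?x <> ?y => exact H
  | H : ?y <> ?x |- ?x <> ?y => exact (fun E => H (esym E))
  | H1 : ?f ?x = _, H2 : ?f ?y = _ |- ?x <> ?y => apply: (differ_by H1 H2); discriminate
  end.

Ltac neqs := rewrite /= ?inE ?negb_or ?andbT;
  sat; repeat match goal with |- is_true (_ && _) => apply/andP; split end; apply/eqP; differ.

Ltac degrees := rewrite /=;
  repeat match goal with H : degree ?h ?x = ?n |- context [degree ?h ?x] => rewrite H end;
  reflexivity.

Ltac count_up hb :=
  let f := fresh "f" in let hf := fresh "hf" in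
  move=> f hf; move: hb (hf 0) (hf 1) (hf 2) (hf 3);
  rewrite /bal /=; clear; intros; repeat split; lia.

(** A complete repair: [s] lists the vertices involved, [ds] their present degrees, [L] the toggles,
    and [hb] the counts to be reached. That [s] has no repetition is derived from known degrees and
    adjacencies. *)
Ltac play e3 hs hb s ds L :=
  match s with ?x0 :: _ =>
  apply: (@solve_by_move _ _ _ e3 x0 s ds L _ _ hs);
  [ neqs | degrees | by []
  | rewrite /=; sat; repeat (split; [assumption | assumption | idtac]); exact I
  | count_up hb ] end.

(** * Repairing a colouring after restoring an edge *)

(* The paths a-u-b and c-v-d are red and uv is blue. *)
Section SuppressedEdge.
Variables (V : finType) (A : {set V}) (e h : rel V) (u v a b c d : V).
Hypotheses (e3 : cubic_on A e) (hs : sub_rel e h) (unsolved : ~ solvable A e).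
Hypotheses (euv : e u v = true) (huv : h u v = false).
Hypotheses (du : degree h u = 2) (dv : degree h v = 2).
Hypotheses (hua : h u a = true) (hub : h u b = true).
Hypotheses (hvc : h v c = true) (hvd : h v d = true).
Hypotheses (ab : a <> b) (cd : c <> d) (ac : a <> c) (ad : a <> d) (bc : b <> c).
Hypotheses (eab : e a b = false) (ecd : e c d = false).

Let es : symmetric e. Proof. by case: e3. Qed.
Let ei : irreflexive e. Proof. by case: e3. Qed.
Let hy : symmetric h. Proof. by case: hs. Qed.
Let he : subrel h e. Proof. by case: hs. Qed.

(** [u] and [v] count as vertices of degree 3, because the edge [u v] can be made red within the
    same move. *)
Let saturated y := [\/ degree h y = 3, y = u | y = v].

(** The only blue edge at [u], and at [v], is [u v], and both its ends have degree 2. *)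
Lemma blue_not_uv x k : degree h x <> 2 -> e x k = true -> h x k = false -> k <> u /\ k <> v.
Proof.
move=> dx xk bk; have kx : e k x = true by rewrite es.
have bx : h k x = false by rewrite hy.
split=> E; subst k; apply: dx; first by rewrite (degree2_blue e3 hs du kx bx euv huv).
have evu : e v u = true by rewrite es.
have hvu : h v u = false by rewrite hy.
by rewrite (degree2_blue e3 hs dv kx bx evu hvu).
Qed.

Lemma other_red2 x y : degree h x = 2 -> h x y = true -> exists2 z, h x z = true & z <> y.
Proof.
move=> dx xy; have [a' [b' [c' [xa xb _ ne _]]]] := degree2_nbrs e3 hs dx.
have [E|/eqP n] := eqVneq a' y; last by exists a'.
by exists b' => //; cong.
Qed.

(** The neighbours of [v] are [u], [c] and [d], and [a] is none of them. *)
Lemma eav : e a v = false.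
Proof.
apply/negP => av; have va : e v a = true by rewrite es.
case hva: (h v a).
  by case: (degree2_red e3 hs dv hva hvc hvd); cong.
have evu : e v u = true by rewrite es.
have E := degree2_blue e3 hs dv va hva evu; rewrite hy in E.
by move: (he hua); rewrite E // ei.
Qed.

Lemma ecu : e c u = false.
Proof.
apply/negP => cu; have uc : e u c = true by rewrite es.
case huc: (h u c).
  by case: (degree2_red e3 hs du huc hua hub); cong.
have E := degree2_blue e3 hs du uc huc euv huv.
by move: (he hvc); rewrite E // ei.
Qed.

(** Here [x] and [x'] are the ends of one restored path. As they are not adjacent, the two further
    neighbours of [x] are different from [x'] and make four vertices of degree 3 together with the
    ends. *)
Lemma four_saturated x x' r r' : (r = u /\ r' = v) \/ (r = v /\ r' = u) ->
  e x r = true -> e x r' = false -> x <> x' -> e x x' = false ->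
  degree h x = 3 -> degree h x' = 3 ->
  (forall y, h x y = true -> y <> u -> y <> v -> degree h y = 3) ->
  exists y z, [/\ uniq [:: x; y; z; x'], degree h y = 3, degree h z = 3, h x y = true & h x z = true].
Proof.
move=> ruv xr xr' xx' exx' dx dx' sat_nbr.
have [y [z [yz [ry rz] xy xz _]]] := other_nbrs e3 xr.
have hxy := degree3_red e3 hs dx xy; have hxz := degree3_red e3 hs dx xz.
have N t : r <> t -> e x t = true -> t <> u /\ t <> v.
  by move=> rt xt; case: ruv => -[E1 E2]; subst r r'; split=> E; subst t; rewrite ?xt in xr'.
have [yu yv] := N y ry xy; have [zu zv] := N z rz xz.
exists y, z; split=> //; [neqs|exact: sat_nbr..].
Qed.

Lemma num_ge4 k x1 x2 x3 x4 : uniq [:: x1; x2; x3; x4] -> 0 < k ->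
  degree h x1 = k -> degree h x2 = k -> degree h x3 = k -> degree h x4 = k ->
  4 <= num_on A h k.
Proof.
by move=> U k0 d1 d2 d3 d4; apply: (num_on_ge_pos e3 hs U k0); rewrite /= d1 d2 d3 d4 eqxx.
Qed.

Lemma num_ge5 k x1 x2 x3 x4 x5 : uniq [:: x1; x2; x3; x4; x5] -> 0 < k ->
  degree h x1 = k -> degree h x2 = k -> degree h x3 = k -> degree h x4 = k -> degree h x5 = k ->
  5 <= num_on A h k.
Proof.
by move=> U k0 d1 d2 d3 d4 d5; apply: (num_on_ge_pos e3 hs U k0); rewrite /= d1 d2 d3 d4 d5 eqxx.
Qed.

(* Removing a red edge between vertices of degrees 1 and 2 would balance the colouring. *)
Section LoseOneTwo.
Hypothesis hb : bal (num_on A h 0).+1 (num_on A h 1) (num_on A h 2).-1 (num_on A h 3).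
Hypothesis large : 8 <= #|A|.

Lemma no_red12 x y : h x y = true -> degree h x = 1 -> degree h y = 2 -> False.
Proof.
move=> *; apply: unsolved.
play e3 hs hb [:: x; y] [:: 1; 2] [:: (0, 1, false)].
Qed.

(** Without its two red edges [x] has degree 0, and making [u v] red makes up for the vertices of
    degree 3 that are lost. *)
Lemma no_saturated_pair x y z : degree h x = 2 -> x <> u -> x <> v -> y <> z ->
  h x y = true -> h x z = true -> saturated y -> saturated z -> False.
Proof.
move=> dx xu xv yz xy xz [sy|sy|sy] [sz|sz|sz]; try subst y; try subst z; apply: unsolved; try by case: yz.
- play e3 hs hb [:: x; y; z; u; v] [:: 2; 3; 3; 2; 2] [:: (0, 1, false); (0, 2, false); (3, 4, true)].
- play e3 hs hb [:: x; y; u; v] [:: 2; 3; 2; 2] [:: (0, 1, false); (0, 2, false); (2, 3, true)].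
- play e3 hs hb [:: x; y; v; u] [:: 2; 3; 2; 2] [:: (0, 1, false); (0, 2, false); (2, 3, true)].
- play e3 hs hb [:: x; z; u; v] [:: 2; 3; 2; 2] [:: (0, 1, false); (0, 2, false); (2, 3, true)].
- play e3 hs hb [:: x; u; v] [:: 2; 2; 2] [:: (0, 1, false); (0, 2, false); (1, 2, true)].
- play e3 hs hb [:: x; z; v; u] [:: 2; 3; 2; 2] [:: (0, 1, false); (0, 2, false); (2, 3, true)].
- play e3 hs hb [:: x; u; v] [:: 2; 2; 2] [:: (0, 1, false); (0, 2, false); (1, 2, true)].
Qed.

(** Red neighbours of degree 1 are excluded by [no_red12], and the two red neighbours cannot both be
    saturated. *)
Lemma red22_old x : degree h x = 2 -> x <> u -> x <> v ->
  exists2 g, h x g = true & [/\ degree h g = 2, g <> u & g <> v].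
Proof.
move=> dx xu xv; have [y [z [w [xy xz [xw bw] yz E]]]] := degree2_nbrs e3 hs dx.
have [y1|y1] : (exists2 g, h x g = true & [/\ degree h g = 2, g <> u & g <> v]) \/ saturated y.
- case: (red_degree e3 hs xy) => dy; last by right; constructor 1.
    by case: (@no_red12 y x); rewrite ?dx // hy.
  have [->|yu] := eqVneq y u; first by right; constructor 2.
  have [->|yv] := eqVneq y v; first by right; constructor 3.
  by left; exists y; first by []; split=> //; apply/eqP.
- exact: y1.
case: (red_degree e3 hs xz) => dz; first by case: (@no_red12 z x); rewrite ?dx // hy.
  have [zu|zu] := eqVneq z u.
    by case: (no_saturated_pair dx xu xv yz xy xz y1); constructor 2.
  have [zv|zv] := eqVneq z v.
    by case: (no_saturated_pair dx xu xv yz xy xz y1); constructor 3.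
  by exists z; first by []; split=> //; apply/eqP.
by case: (no_saturated_pair dx xu xv yz xy xz y1); constructor 1.
Qed.

Lemma old2 : exists x, [/\ degree h x = 2, x <> u & x <> v].
Proof.
have l : size [:: u; v] < num_on A h 2.
  by move: hb (num_on_total e3 hs) large; rewrite /bal /=; clear; lia.
have [x [_ + dx]] := num_on_new l; rewrite !inE negb_or => /andP[/eqP xu /eqP xv].
by exists x.
Qed.

(** Otherwise [z] trades its red edge to [w] for one to [k]. This brings [w] to degree 0, and
    removing a red edge between vertices of degree 2, taken at [k] if [k] has degree 2, settles the
    rest. *)
Lemma red_pair_blue_degree0 z w : h z w = true -> degree h z = 1 -> degree h w = 1 ->
  forall k, e z k = true -> h z k = false -> degree h k = 0.
Proof.
move=> zw dz dw k zk bk; case: (blue_degree e3 hs zk bk) => // dk; case: unsolved.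
  have [g0 [d0 gu gv]] := old2; have [g gg [dg _ _]] := red22_old d0 gu gv.
  play e3 hs hb [:: z; w; k; g0; g] [:: 1; 1; 1; 2; 2] [:: (0, 1, false); (0, 2, true); (3, 4, false)].
have [ku kv] : k <> u /\ k <> v by apply: (blue_not_uv _ zk bk); rewrite dz.
have [g gg [dg _ _]] := red22_old dk ku kv.
play e3 hs hb [:: z; w; k; g] [:: 1; 1; 2; 2] [:: (0, 1, false); (0, 2, true); (2, 3, false)].
Qed.

Section Pair.
Variables x y : V.
Hypotheses (xy : h x y = true) (dx : degree h x = 1) (dy : degree h y = 1).

(** [k] trades a red edge for [k w]; dissolving the pair [x y] yields two vertices of degree 0, one
    to replace [w] and one to gain. *)
Lemma no_blue02 k w : degree h k = 2 -> degree h w = 0 -> e k w = true -> False.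
Proof.
move=> dk dw kw; have bk : h k w = false by rewrite hy (degree0_blue _ dw).
have wk : e w k = true by rewrite es.
have [ku kv] : k <> u /\ k <> v.
  by apply: (blue_not_uv _ wk); rewrite ?dw // (degree0_blue _ dw).
have [g gg [dg _ _]] := red22_old dk ku kv; case: unsolved.
play e3 hs hb [:: k; g; w; x; y] [:: 2; 2; 0; 1; 1] [:: (0, 1, false); (0, 2, true); (3, 4, false)].
Qed.

Lemma no_blue01 p w : degree h p = 1 -> p <> x -> p <> y -> degree h w = 0 -> e p w = true -> False.
Proof.
move=> dp px py dw pw; have bp : h p w = false by rewrite hy (degree0_blue _ dw).
have [g0 [d0 gu gv]] := old2; have [g gg [dg _ _]] := red22_old d0 gu gv.
case: unsolved.
play e3 hs hb [:: x; y; g0; g; p; w] [:: 1; 1; 2; 2; 1; 0] [:: (0, 1, false); (2, 3, false); (4, 5, true)].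
Qed.

End Pair.

(** If [t] had degree 1, then [p t] would be a second red pair and the blue neighbours of [p] would
    have degree 0, against [no_blue01]. *)
Lemma leaf_of_pair x y p : h x y = true -> degree h x = 1 -> degree h y = 1 ->
  degree h p = 1 -> p <> x -> p <> y -> exists2 t, h p t = true & degree h t = 3.
Proof.
move=> xy dx dy dp px py; have [t [z [w [pt [pz bz] _ _ _]]]] := degree1_nbrs e3 hs dp.
exists t => //; case: (red_degree e3 hs pt) => // dt; last by case: (no_red12 pt).
have dz := red_pair_blue_degree0 pt dp dt pz bz.
by case: (no_blue01 xy dx dy dp px py dz pz).
Qed.

(** Detaching the leaf [p] from [t] moves [p] to degree 0 and [t] to degree 2. What remains is to
    turn two vertices of degree 2 into one of degree 1 and one of degree 3; this lemma and the next
    two do so in three ways. *)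
Lemma no_swap22_leaf k g l p t : degree h k = 2 -> degree h g = 2 -> degree h l = 2 ->
  h k g = true -> e k l = true -> h k l = false ->
  h p t = true -> degree h p = 1 -> degree h t = 3 -> False.
Proof.
move=> dk dg dl kg kl bl pt dp dt; case: unsolved.
play e3 hs hb [:: k; g; l; p; t] [:: 2; 2; 2; 1; 3] [:: (0, 1, false); (0, 2, true); (3, 4, false)].
Qed.

Lemma no_leaf_blue12 p t q k g l : h p t = true -> degree h p = 1 -> degree h t = 3 ->
  degree h q = 1 -> q <> p -> degree h k = 2 -> e q k = true -> h q k = false ->
  h g l = true -> degree h g = 2 -> degree h l = 2 -> g <> k -> l <> k -> False.
Proof.
move=> pt dp dt dq qp dk qk bk gl dg dl gk lk; case: unsolved.
play e3 hs hb [:: p; t; q; k; g; l] [:: 1; 3; 1; 2; 2; 2] [:: (0, 1, false); (2, 3, true); (4, 5, false)].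
Qed.

Lemma no_leaf_red23 p t k s : h p t = true -> degree h p = 1 -> degree h t = 3 ->
  degree h k = 2 -> k <> u -> k <> v -> h k s = true -> saturated s -> s <> t -> False.
Proof.
move=> pt dp dt dk ku kv ks [ds|ds|ds] st; try subst s; case: unsolved.
- play e3 hs hb [:: p; t; k; s; u; v] [:: 1; 3; 2; 3; 2; 2] [:: (0, 1, false); (2, 3, false); (4, 5, true)].
- play e3 hs hb [:: p; t; k; u; v] [:: 1; 3; 2; 2; 2] [:: (0, 1, false); (2, 3, false); (3, 4, true)].
- play e3 hs hb [:: p; t; k; v; u] [:: 1; 3; 2; 2; 2] [:: (0, 1, false); (2, 3, false); (3, 4, true)].
Qed.

Lemma red_degree_of2 x y : degree h x = 2 -> h x y = true -> degree h y = 2 \/ degree h y = 3.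
Proof.
move=> dx xy; case: (red_degree e3 hs xy) => dy; [|by left|by right].
by case: (@no_red12 y x); rewrite // hy.
Qed.

(** Let [k] and [g] be old vertices of degree 2 joined by a red edge. Their other red edges lead to
    vertices of degree 3, and [no_leaf_red23], applied with either leaf, identifies these with [t1]
    and with [t2]. A single vertex would then be adjacent to [k], [g], [p1] and [p2]. *)
Lemma two_leaves p1 t1 p2 t2 :
  (forall k l, degree h k = 2 -> k <> u -> k <> v -> e k l = true -> h k l = false -> degree h l = 1) ->
  h p1 t1 = true -> degree h p1 = 1 -> degree h t1 = 3 ->
  h p2 t2 = true -> degree h p2 = 1 -> degree h t2 = 3 -> p1 <> p2 -> False.
Proof.
move=> blue1 pt1 dp1 dt1 pt2 dp2 dt2 p12.
(* At least one of the two leaves is not the blue neighbour [q] of [k]; that one is detached. *)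
have key k g l : degree h k = 2 -> k <> u -> k <> v -> h g l = true ->
   degree h g = 2 -> degree h l = 2 -> g <> k -> l <> k -> False.
  move=> dk ku kv gl dg dl gk lk; have [_ [_ [q [_ _ [kq bq] _ _]]]] := degree2_nbrs e3 hs dk.
  have dq := blue1 k q dk ku kv kq bq.
  have qk : e q k = true by rewrite es.
  have bk : h q k = false by rewrite hy.
  have [qp|/eqP qp] := eqVneq q p1; last exact: (no_leaf_blue12 pt1 dp1 dt1 dq qp dk qk bk gl).
  by apply: (no_leaf_blue12 pt2 dp2 dt2 dq _ dk qk bk gl); cong.
have [k [dk ku kv]] := old2; have [g kg [dg gu gv]] := red22_old dk ku kv.
have gk : h g k = true by rewrite hy.
have kk : k <> g by move=> E; move: (he kg); rewrite E ei.
have [k2 gk2 n1] := other_red2 dg gk; have [g2 kg2 n2] := other_red2 dk kg.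
have k2g : g <> k2 by move=> E; move: (he gk2); rewrite E ei.
have g2k : k <> g2 by move=> E; move: (he kg2); rewrite E ei.
case: (red_degree_of2 dg gk2) => d2; first by apply: (key k g k2 dk); cong.
case: (red_degree_of2 dk kg2) => d3; first by apply: (key g k g2 dg); cong.
have T z s : degree h z = 2 -> z <> u -> z <> v -> h z s = true -> degree h s = 3 -> s = t1 /\ s = t2.
  move=> dz zu zv zs ds; split; apply/eqP; apply: contraT => /eqP n.
    by case: (no_leaf_red23 pt1 dp1 dt1 dz zu zv zs _ n); constructor 1.
  by case: (no_leaf_red23 pt2 dp2 dt2 dz zu zv zs _ n); constructor 1.
have [E1 E2] := T _ _ dk ku kv kg2 d3; have [E3 E4] := T _ _ dg gu gv gk2 d2; subst g2 k2 t2.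
apply: (@cubic_four_nbrs _ _ _ e3 t1 k g p1 p2); [neqs|sat; assumption..].
Qed.

(** Such a pair leaves exactly one further vertex [p] of degree 1, and [p], its red neighbour [t]
    and the only two old vertices [k], [g] of degree 2 form a K_4. Away from it [a], [b] and two
    neighbours of [a] have degree 3; with [t] these are five, against three vertices of degree 1. *)
Lemma no_pair x y : h x y = true -> degree h x = 1 -> degree h y = 1 -> False.
Proof.
move=> xy dx dy; have yx : h y x = true by rewrite hy.
have exy : x <> y by move=> E; move: (he xy); rewrite E ei.
have leafP p : degree h p = 1 -> p <> x -> p <> y -> exists2 t, h p t = true & degree h t = 3.
  exact: leaf_of_pair xy dx dy.
have blue_pair k l : degree h k = 2 -> e k l = true -> h k l = false -> l <> x /\ l <> y.
  move=> dk kl bl; have lk : e l k = true by rewrite es.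
  have blk : h l k = false by rewrite hy.
  split=> E; subst l; first by rewrite (red_pair_blue_degree0 xy dx dy lk blk) in dk.
  by rewrite (red_pair_blue_degree0 yx dy dx lk blk) in dk.
have [k [dk ku kv]] := old2; have [g kg [dg gu gv]] := red22_old dk ku kv.
have kkg : k <> g by move=> E; move: (he kg); rewrite E ei.
have [_ [_ [l [_ _ [kl bl] _ _]]]] := degree2_nbrs e3 hs dk.
have [lx ly] := blue_pair _ _ dk kl bl.
have [p [dp px py]] : exists p, [/\ degree h p = 1, p <> x & p <> y].
  case: (blue_degree e3 hs kl bl) => dl; first by case: (no_blue02 xy dx dy dk dl kl).
    by exists l.
  (* If [l] has degree 2 and only [x] and [y] have degree 1, then [k], [l], [g], [u], [v] are more
     vertices of degree 2 than balance admits. *)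
  have [ub1|ub1] := leqP 3 (num_on A h 1).
    have [p [_ + dp]] := num_on_new (s := [:: x; y]) ub1.
    by rewrite !inE negb_or => /andP[/eqP px /eqP py]; exists p.
  have lk : e l k = true by rewrite es.
  have [lu lv] : l <> u /\ l <> v.
    split=> E; subst l.
      have bk : h u k = false by rewrite hy.
      by case: kv; rewrite (degree2_blue e3 hs du lk bk euv huv).
    have bk : h v k = false by rewrite hy.
    have evu : e v u = true by rewrite es.
    have hvu : h v u = false by rewrite hy.
    by case: ku; rewrite (degree2_blue e3 hs dv lk bk evu hvu).
  suff : 5 <= num_on A h 2 by move: hb ub1; rewrite /bal; clear; lia.
  by apply: (@num_ge5 2 k l g u v) => //; neqs.
have [t pt dt] := leafP p dp px py.
have blue1 k' l' : degree h k' = 2 -> k' <> u -> k' <> v -> e k' l' = true -> h k' l' = false ->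
    degree h l' = 1.
  move=> dk' ku' kv' kl' bl'; case: (blue_degree e3 hs kl' bl') => // dl'.
    by case: (no_blue02 xy dx dy dk' dl' kl').
  have [g' kg' [dg' _ _]] := red22_old dk' ku' kv'.
  by case: (no_swap22_leaf dk' dg' dl' kg' kl' bl' pt dp dt).
have only1 q : degree h q = 1 -> [\/ q = x, q = y | q = p].
  move=> dq; have [->|/eqP qx] := eqVneq q x; first by constructor 1.
  have [->|/eqP qy] := eqVneq q y; first by constructor 2.
  have [->|/eqP qp] := eqVneq q p; first by constructor 3.
  have [s qs ds] := leafP q dq qx qy.
  by case: (two_leaves blue1 pt dp dt qs dq ds); apply: nesym.
have blue_p k' : degree h k' = 2 -> k' <> u -> k' <> v -> e p k' = true /\ h p k' = false.
  move=> dk' ku' kv'; have [_ [_ [l' [_ _ [kl' bl'] _ _]]]] := degree2_nbrs e3 hs dk'.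
  have [l'x l'y] := blue_pair _ _ dk' kl' bl'.
  by case: (only1 l' (blue1 _ _ dk' ku' kv' kl' bl')) => E //; subst l'; rewrite es hy.
have [epk bpk] := blue_p _ dk ku kv; have [epg bpg] := blue_p _ dg gu gv.
have ept := he pt.
have p_nbr k' : degree h k' = 2 -> k' <> u -> k' <> v -> k' = k \/ k' = g.
  move=> dk' ku' kv'; have [epk' bpk'] := blue_p _ dk' ku' kv'.
  have [->|/eqP kk'] := eqVneq k' k; first by left.
  have [->|/eqP gk'] := eqVneq k' g; first by right.
  by case: (@cubic_four_nbrs _ _ _ e3 p t k g k'); [neqs|sat; assumption..].
have third z z' : degree h z = 2 -> z <> u -> z <> v -> h z z' = true -> z' <> k -> z' <> g -> z' = t.
  move=> dz zu zv zz' z'k z'g; apply/eqP; apply: contraT => /eqP z't.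
  case: (no_leaf_red23 pt dp dt dz zu zv zz' _ z't).
  have [->|/eqP z'u] := eqVneq z' u; first by constructor 2.
  have [->|/eqP z'v] := eqVneq z' v; first by constructor 3.
  case: (red_degree_of2 dz zz') => dz'; last by constructor 1.
  by case: (p_nbr z' dz' z'u z'v).
have gk : h g k = true by rewrite hy.
have [k2 kk2 n2] := other_red2 dk kg; have [g2 gg2 m2] := other_red2 dg gk.
have kt : h k t = true.
  rewrite -(third _ _ dk ku kv kk2) // => E; move: (he kk2); by rewrite E ei.
have gt : h g t = true.
  rewrite -(third _ _ dg gu gv gg2) // => E; move: (he gg2); by rewrite E ei.
(* Now [p], [t], [k], [g] are pairwise adjacent and have no other neighbours. *)
have t_nbr s : e t s = true -> [\/ s = p, s = k | s = g].
  move=> ts; have [->|/eqP sp] := eqVneq s p; first by constructor 1.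
  have [->|/eqP sk] := eqVneq s k; first by constructor 2.
  have [->|/eqP sg] := eqVneq s g; first by constructor 3.
  by case: (@cubic_four_nbrs _ _ _ e3 t p k g s); [neqs|sat; assumption..].
have k_nbr s : e k s = true -> [\/ s = p, s = t | s = g].
  move=> ks; have [->|/eqP sp] := eqVneq s p; first by constructor 1.
  have [->|/eqP sk] := eqVneq s t; first by constructor 2.
  have [->|/eqP sg] := eqVneq s g; first by constructor 3.
  by case: (@cubic_four_nbrs _ _ _ e3 k p t g s); [neqs|sat; assumption..].
have g_nbr s : e g s = true -> [\/ s = p, s = t | s = k].
  move=> ks; have [->|/eqP sp] := eqVneq s p; first by constructor 1.
  have [->|/eqP sk] := eqVneq s t; first by constructor 2.
  have [->|/eqP sg] := eqVneq s k; first by constructor 3.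
  by case: (@cubic_four_nbrs _ _ _ e3 g p t k s); [neqs|sat; assumption..].
have far x' : h u x' = true -> [/\ degree h x' = 3, x' <> t, x' <> k & x' <> g].
  move=> ux'; have x'u : e x' u = true by rewrite es; apply: he.
  have x't : x' <> t.
    by move=> E; subst x'; case: (t_nbr u x'u) => E; subst u; congruence.
  have x'k : x' <> k.
    by move=> E; subst x'; case: (k_nbr u x'u) => E; subst u; congruence.
  have x'g : x' <> g.
    by move=> E; subst x'; case: (g_nbr u x'u) => E; subst u; congruence.
  split=> //; case: (red_degree_of2 du ux') => // dx'.
  have x'u' : x' <> u by move=> E; move: x'u; rewrite E ei.
  have x'v' : x' <> v by move=> E; subst x'; rewrite huv in ux'.
  by case: (p_nbr x' dx' x'u' x'v').
have [da at_ ak ag] := far a hua; have [db bt bk bg] := far b hub.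
have eau : e a u = true by rewrite es; apply: he.
have nbr3 z : h a z = true -> z <> u -> z <> v -> degree h z = 3.
  move=> az zu zv; case: (red_degree e3 hs az) => // dz.
    have za : h z a = true by rewrite hy.
    case: (only1 z dz) => E; subst z.
    - by have E := degree1_red e3 hs dx xy za; move: da; rewrite -E dy.
    - by have E := degree1_red e3 hs dy yx za; move: da; rewrite -E dx.
    - by have E := degree1_red e3 hs dp pt za; case: at_.
  case: (p_nbr z dz zu zv) => E; subst z.
    have ka : e k a = true by rewrite es; apply: he.
    by case: (k_nbr a ka) => E; [subst a; congruence|case: at_|case: ag].
  have ga : e g a = true by rewrite es; apply: he.
  by case: (g_nbr a ga) => E; [subst a; congruence|case: at_|case: ak].
have uv : (u = u /\ v = v) \/ (u = v /\ v = u) by left.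
have [a1 [a2 [U da1 da2 aa1 aa2]]] := four_saturated uv eau eav ab eab da db nbr3.
suff : 5 <= num_on A h 3.
  suff : num_on A h 1 <= 3 by move: hb; rewrite /bal; clear; lia.
  rewrite leqNgt; apply/negP => /(num_on_new (s := [:: x; y; p])) [q [_ + dq]].
  by rewrite !inE; case: (only1 q dq) => ->; rewrite eqxx ?orbT.
apply: (@num_ge5 3 a a1 a2 b t) => //.
have T z : h a z = true -> z <> t.
  move=> az E; subst z; have ta : e t a = true by rewrite es; apply: he.
  by case: (t_nbr a ta) => E; [subst a; congruence|case: ak|case: ag].
move: U (T _ aa1) (T _ aa2); rewrite /= !inE !negb_or !andbT => U1 /eqP T1 /eqP T2.
by move/eqP: at_ => at_; move/eqP: bt => bt; rewrite at_ T1 T2 bt !andbT.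
Qed.

(** All vertices of degree 1 hang at the same vertex [t1] of degree 3. One of [a], [c] is not [t1],
    and its surroundings contain four vertices of degree 3, which requires three leaves. These are
    all the neighbours of [t1]; so [t1] is a fifth vertex of degree 3, and there is no fourth
    leaf. *)
Lemma lose_one_two : False.
Proof.
have leafP p : degree h p = 1 -> exists2 t, h p t = true & degree h t = 3.
  move=> dp; have [t [_ [_ [pt _ _ _ _]]]] := degree1_nbrs e3 hs dp; exists t => //.
  by case: (red_degree e3 hs pt) => // dt; [case: (no_pair pt)|case: (no_red12 pt)].
have [p1 [_ _ dp1]] : exists x, [/\ x \in A, x \notin [::] & degree h x = 1].
  by apply: num_on_new; move: hb (num_on_total e3 hs) large; rewrite /bal /=; clear; lia.
have [p2 [_ + dp2]] : exists x, [/\ x \in A, x \notin [:: p1] & degree h x = 1].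
  by apply: num_on_new; move: hb (num_on_total e3 hs) large; rewrite /bal /=; clear; lia.
rewrite inE => /eqP p21; have [t1 pt1 dt1] := leafP p1 dp1; have [t2 pt2 dt2] := leafP p2 dp2.
have end3 x : h u x = true \/ h v x = true -> degree h x = 3.
  have evu : e v u = true by rewrite es.
  have hvu : h v u = false by rewrite hy.
  case=> ux; [case: (red_degree_of2 du ux)|case: (red_degree_of2 dv ux)] => // dx.
    by case: (no_swap22_leaf du dx dv ux euv huv pt1 dp1 dt1).
  by case: (no_swap22_leaf dv dx du ux evu hvu pt1 dp1 dt1).
have da := end3 a (or_introl hua); have db := end3 b (or_introl hub).
have dc := end3 c (or_intror hvc); have dd := end3 d (or_intror hvd).
have uniq_t p t q s : h p t = true -> degree h p = 1 -> degree h t = 3 ->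
    h q s = true -> degree h q = 1 -> degree h s = 3 -> s = t.
  move=> pt dp dt qs dq ds; apply/eqP; apply: contraT => /eqP st; exfalso.
  have qp : p <> q by move=> E; subst q; case: st; exact: (degree1_red e3 hs dp qs pt).
  apply: (two_leaves _ pt dp dt qs dq ds qp) => k l dk ku kv kl bl.
  have [g kg [dg gu gv]] := red22_old dk ku kv.
  case: (blue_degree e3 hs kl bl) => // dl; last first.
    by case: (no_swap22_leaf dk dg dl kg kl bl pt dp dt).
  (* [l] has degree 0, so both leaves are detached, one of them to take its place. *)
  case: unsolved.
  play e3 hs hb [:: k; g; l; p; t; q; s; u; v] [:: 2; 2; 0; 1; 3; 1; 3; 2; 2]
    [:: (0, 1, false); (0, 2, true); (3, 4, false); (5, 6, false); (7, 8, true)].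
have leaf_t q s : h q s = true -> degree h q = 1 -> degree h s = 3 -> s = t1.
  by move=> qs dq ds; apply: (uniq_t p1 t1 q s).
have E2 := leaf_t _ _ pt2 dp2 dt2; subst t2.
have ncu := ecu; have nav := eav.
have red_a : e a u = true by rewrite es; apply: he.
have red_c : e c v = true by rewrite es; apply: he.
have core x x' r r' : (r = u /\ r' = v) \/ (r = v /\ r' = u) -> h r x' = true ->
    e x r = true -> e x r' = false -> x <> x' -> e x x' = false ->
    degree h x = 3 -> degree h x' = 3 -> x <> t1 -> False.
  move=> ruv rx' xr xr' xx' exx' dx dx' xt.
  have nbr3 y : h x y = true -> y <> u -> y <> v -> degree h y = 3.
    move=> xy yu yv; have yx : h y x = true by rewrite hy.
    case: (red_degree e3 hs xy) => // dy; first by case: xt; exact: (leaf_t _ _ yx dy dx).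
    by case: (no_leaf_red23 pt1 dp1 dt1 dy yu yv yx _ xt); constructor 1.
  have [y [z [U dy dz xy xz]]] := four_saturated ruv xr xr' xx' exx' dx dx' nbr3.
  have four := @num_ge4 3 _ _ _ _ U isT dx dy dz dx'.
  have [p3 [_ + dp3]] : exists q, [/\ q \in A, q \notin [:: p1; p2] & degree h q = 1].
    by apply: num_on_new; move: hb four; rewrite /bal /=; clear; lia.
  rewrite !inE negb_or => /andP[/eqP p31 /eqP p32]; have [t3 pt3 dt3] := leafP p3 dp3.
  have E3 := leaf_t _ _ pt3 dp3 dt3; subst t3.
  have t_nbr s : e t1 s = true -> degree h s = 1.
    move=> ts; apply/eqP; apply: contraT => /eqP ds1.
    have [sp1 sp2 sp3] : [/\ s <> p1, s <> p2 & s <> p3] by split=> E; subst s.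
    by case: (@cubic_four_nbrs _ _ _ e3 t1 p1 p2 p3 s); [neqs|sat; assumption..].
  suff : 5 <= num_on A h 3.
    suff : num_on A h 1 <= 3 by move: hb; rewrite /bal; clear; lia.
    rewrite leqNgt; apply/negP => /(num_on_new (s := [:: p1; p2; p3])) [q [_ + dq]].
    rewrite !inE !negb_or => /and3P[/eqP q1 /eqP q2 /eqP q3].
    have [s qs ds] := leafP q dq; have E := leaf_t _ _ qs dq ds; subst s.
    by case: (@cubic_four_nbrs _ _ _ e3 t1 p1 p2 p3 q); [neqs|sat; assumption..].
  apply: (@num_ge5 3 x y z x' t1) => //.
  have T s : h x s = true -> s <> t1.
    by move=> xs E; subst s; move: (t_nbr x); rewrite dx es => H; have := H (he xs).
  have T' : x' <> t1.
    move=> E; subst x'; have tr : e t1 r = true by rewrite es; apply: he.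
    by have := t_nbr r tr; case: ruv => -[-> _]; rewrite ?du ?dv.
  move: U (T _ xy) (T _ xz); rewrite /= !inE !negb_or !andbT => U1 /eqP T1 /eqP T2.
  by move/eqP: xt => ->; move/eqP: T' => ->; rewrite T1 T2 !andbT.
have [E|/eqP at1] := eqVneq a t1.
  have ct1 : c <> t1 by congruence.
  by apply: (core c d v u) => //; right.
by apply: (core a b u v) => //; left.
Qed.

End LoseOneTwo.

(* Moving one end of a red edge from a vertex of degree 2 to another one would balance the
   colouring. *)
Section GainOneThree.
Hypothesis hb : bal (num_on A h 0) (num_on A h 1).+1 (num_on A h 2).-2 (num_on A h 3).+1.
Hypothesis large : 8 <= #|A|.

Lemma no_red2_saturated x y : degree h x = 2 -> x <> u -> x <> v -> h x y = true ->
  saturated y -> False.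
Proof.
move=> dx xu xv xy [dy|dy|dy]; try subst y; apply: unsolved.
- play e3 hs hb [:: x; y; u; v] [:: 2; 3; 2; 2] [:: (0, 1, false); (2, 3, true)].
- play e3 hs hb [:: x; u; v] [:: 2; 2; 2] [:: (0, 1, false); (1, 2, true)].
- play e3 hs hb [:: x; v; u] [:: 2; 2; 2] [:: (0, 1, false); (1, 2, true)].
Qed.

Lemma no_swap22 k g l : degree h k = 2 -> degree h g = 2 -> degree h l = 2 ->
  h k g = true -> e k l = true -> h k l = false -> False.
Proof.
move=> dk dg dl kg kl bl; apply: unsolved.
play e3 hs hb [:: k; g; l] [:: 2; 2; 2] [:: (0, 1, false); (0, 2, true)].
Qed.

Lemma no_red22_blue12 y z x p : h y z = true -> degree h y = 2 -> degree h z = 2 ->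
  degree h x = 2 -> degree h p = 1 -> e x p = true -> h x p = false -> y <> x -> z <> x -> False.
Proof.
move=> yz dy dz dx dp xp bp yx zx; apply: unsolved.
play e3 hs hb [:: y; z; x; p] [:: 2; 2; 2; 1] [:: (0, 1, false); (2, 3, true)].
Qed.

Lemma no_red12_blue02 g p x w : h g p = true -> degree h g = 2 -> degree h p = 1 ->
  degree h x = 2 -> degree h w = 0 -> e x w = true -> x <> g -> False.
Proof.
move=> gp dg dp dx dw xw xg; have bw : h x w = false by rewrite hy (degree0_blue _ dw).
apply: unsolved.
play e3 hs hb [:: g; p; x; w] [:: 2; 1; 2; 0] [:: (0, 1, false); (2, 3, true)].
Qed.

Lemma old_red x y : degree h x = 2 -> x <> u -> x <> v -> h x y = true ->
  degree h y = 1 \/ [/\ degree h y = 2, y <> u & y <> v].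
Proof.
move=> dx xu xv xy; have no := no_red2_saturated dx xu xv xy.
case: (red_degree e3 hs xy) => dy; [by left|right|by case: no; constructor 1].
by split=> // E; case: no; [constructor 2|constructor 3].
Qed.

Lemma num2_ge4 : 4 <= num_on A h 2.
Proof. by move: hb (num_on_total e3 hs) large; rewrite /bal; clear; lia. Qed.

Lemma old2_new s : s <> u -> s <> v -> exists x, [/\ degree h x = 2, x <> u, x <> v & x <> s].
Proof.
move=> su sv; have [x [_ + dx]] := num_on_new (s := [:: u; v; s]) num2_ge4.
by rewrite !inE !negb_or => /and3P[/eqP xu /eqP xv /eqP xs]; exists x.
Qed.

(** A red neighbour of a saturated vertex has not degree 1 by assumption, and is not an old vertex
    of degree 2 by [no_red2_saturated]. So degree 3 spreads from [u] to [a] and [b], and from [a] to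
    its other neighbours. *)
Lemma four_of_closed : (forall q t, h q t = true -> degree h q = 1 -> saturated t -> False) ->
  4 <= num_on A h 3.
Proof.
move=> noleaf.
have end3 r x : r = u \/ r = v -> h r x = true -> degree h x = 3.
  move=> ru rx; have xr : h x r = true by rewrite hy.
  have sr : saturated r by case: ru => ->; [constructor 2|constructor 3].
  have evu : e v u = true by rewrite es.
  have xu : x <> u.
    by move=> E; subst x; case: ru => E; subst r; [move: (he rx); rewrite ei|rewrite hy huv in rx].
  have xv : x <> v.
    by move=> E; subst x; case: ru => E; subst r; [rewrite huv in rx|move: (he rx); rewrite ei].
  case: (red_degree e3 hs rx) => // dx; first by case: (noleaf x r).
  by case: (no_red2_saturated dx xu xv xr sr).
have da := end3 u a (or_introl erefl) hua; have db := end3 u b (or_introl erefl) hub.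
have eau : e a u = true by rewrite es; apply: he.
have nbr3 y : h a y = true -> y <> u -> y <> v -> degree h y = 3.
  move=> ay yu yv; have ya : h y a = true by rewrite hy.
  have sa : saturated a by constructor 1.
  case: (red_degree e3 hs ay) => // dy; first by case: (noleaf y a).
  by case: (no_red2_saturated dy yu yv ya sa).
have uv : (u = u /\ v = v) \/ (u = v /\ v = u) by left.
have [y [z [U dy dz _ _]]] := four_saturated uv eau eav ab eab da db nbr3.
exact: (@num_ge4 3 _ _ _ _ U).
Qed.

(** * Case 1: no red edge joins degree 1 to an old vertex of degree 2 *)

Section NoRed12.
Hypothesis no12 : forall x y, h x y = true -> degree h x = 1 -> degree h y = 2 -> y = u \/ y = v.

Lemma no_leaf_b02 k g w q t : degree h k = 2 -> k <> u -> k <> v -> h k g = true -> degree h g = 2 ->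
  g <> u -> g <> v -> degree h w = 0 -> e k w = true -> h q t = true -> degree h q = 1 ->
  saturated t -> False.
Proof.
move=> dk ku kv kg dg gu gv dw kw qt dq st.
have bw : h k w = false by rewrite hy (degree0_blue _ dw).
case: st => dt; try subst t; apply: unsolved.
- play e3 hs hb [:: k; g; w; q; t; u; v] [:: 2; 2; 0; 1; 3; 2; 2]
    [:: (0, 1, false); (0, 2, true); (3, 4, false); (5, 6, true)].
- play e3 hs hb [:: k; g; w; q; u; v] [:: 2; 2; 0; 1; 2; 2]
    [:: (0, 1, false); (0, 2, true); (3, 4, false); (4, 5, true)].
- play e3 hs hb [:: k; g; w; q; v; u] [:: 2; 2; 0; 1; 2; 2]
    [:: (0, 1, false); (0, 2, true); (3, 4, false); (4, 5, true)].
Qed.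

(** Old vertices of degree 2 now lie on red cycles among themselves, and their blue neighbours have
    degree 0. Vertices of degree 1 come in red pairs, at least two pairs since there are four
    vertices of degree 3. The blue neighbours of [p] have degree 0 as well, and one of them is not
    [w], which gives a repair. *)
Lemma no_red12_false : False.
Proof.
have old_red2 x y : degree h x = 2 -> x <> u -> x <> v -> h x y = true ->
    [/\ degree h y = 2, y <> u & y <> v].
  move=> dx xu xv xy; case: (old_red dx xu xv xy) => // dy.
  have yx : h y x = true by rewrite hy.
  by case: (no12 yx dy dx).
have blue0 x w : degree h x = 2 -> x <> u -> x <> v -> e x w = true -> h x w = false -> degree h w = 0.
  move=> dx xu xv xw bw; have [g [_ [_ [xg _ _ _ _]]]] := degree2_nbrs e3 hs dx.
  have [dg gu gv] := old_red2 _ _ dx xu xv xg.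
  case: (blue_degree e3 hs xw bw) => // dw; last by case: (no_swap22 dx dg dw xg xw bw).
  have gx : h g x = true by rewrite hy.
  have [z gz zx] := other_red2 dg gx; have [dz _ _] := old_red2 _ _ dg gu gv gz.
  have gx' : g <> x by move=> E; move: (he xg); rewrite E ei.
  by case: (no_red22_blue12 gz dg dz dx dw xw bw).
have l : size [:: u; v] < num_on A h 2 := ltnW num2_ge4.
have [k [_ + dk]] := num_on_new l; rewrite !inE negb_or => /andP[/eqP ku /eqP kv].
have [g [_ [w [kg _ [kw bw] _ _]]]] := degree2_nbrs e3 hs dk.
have [dg gu gv] := old_red2 _ _ dk ku kv kg; have dw := blue0 _ _ dk ku kv kw bw.
have gk : h g k = true by rewrite hy.
have kg' : g <> k by move=> E; move: (he kg); rewrite E ei.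
have [z gz zk] := other_red2 dg gk; have [dz zu zv] := old_red2 _ _ dg gu gv gz.
have noleaf q t : h q t = true -> degree h q = 1 -> saturated t -> False.
  by move=> qt dq st; apply: (no_leaf_b02 dk ku kv kg dg gu gv dw kw qt dq st).
have four := four_of_closed noleaf.
have partner q t : h q t = true -> degree h q = 1 -> degree h t = 1.
  move=> qt dq; have no := noleaf _ _ qt dq; case: (red_degree e3 hs qt) => // dt.
    by case: (no12 qt dq dt) => E; case: no; [constructor 2|constructor 3].
  by case: no; constructor 1.
have [p [_ _ dp]] : exists x, [/\ x \in A, x \notin [::] & degree h x = 1].
  by apply: num_on_new; move: hb four; rewrite /bal /=; clear; lia.
have [q [x1 [x2 [pq [px1 bx1] [px2 bx2] x12 _]]]] := degree1_nbrs e3 hs dp.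
have dq := partner _ _ pq dp; have qp : h q p = true by rewrite hy.
have [p' [_ + dp']] : exists x, [/\ x \in A, x \notin [:: p; q] & degree h x = 1].
  by apply: num_on_new; move: hb four; rewrite /bal /=; clear; lia.
rewrite !inE negb_or => /andP[/eqP p'p /eqP p'q].
have [q' [_ [_ [p'q' _ _ _ _]]]] := degree1_nbrs e3 hs dp'.
have dq' := partner _ _ p'q' dp'; have q'p' : h q' p' = true by rewrite hy.
have q'p : q' <> p by move=> E; subst q'; case: p'q; apply: (degree1_red e3 hs dp q'p' pq).
have blue_p x : e p x = true -> h p x = false -> degree h x = 0.
  move=> px bx; have xp : e x p = true by rewrite es.
  have bp : h x p = false by rewrite hy.
  case: (blue_degree e3 hs px bx) => // dx.
    case: unsolved.
    play e3 hs hb [:: p; q; x; g; z; k; w] [:: 1; 1; 1; 2; 2; 2; 0]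
      [:: (0, 1, false); (0, 2, true); (3, 4, false); (5, 6, true)].
  have [xu xv] : x <> u /\ x <> v by apply: (blue_not_uv _ px bx); rewrite dp.
  by rewrite (blue0 _ _ dx xu xv xp bp) in dp.
have done x : e p x = true -> h p x = false -> x <> w -> False.
  move=> px bx xw; have dx := blue_p x px bx; apply: unsolved.
  play e3 hs hb [:: p; x; p'; q'; g; z; k; w] [:: 1; 0; 1; 1; 2; 2; 2; 0]
      [:: (0, 1, true); (2, 3, false); (4, 5, false); (6, 7, true)].
have [E|/eqP x1w] := eqVneq x1 w; last exact: (done x1).
by apply: (done x2) => // E2; case: x12; rewrite E E2.
Qed.
End NoRed12.

(** * Case 2: a red edge from degree 1 to an old vertex of degree 2 *)

Section Red12.
Variables g p : V.
Hypotheses (gp : h g p = true) (dg : degree h g = 2) (dp : degree h p = 1).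
Hypotheses (gu : g <> u) (gv : g <> v).

(** By [no_red12_blue02] only [x] can have degree 2 and a red neighbour of degree 1, so [x] is [g].
    For another old vertex [y] of degree 2 each possible degree of the blue neighbour then allows a
    repair. *)
Lemma red12_blue02_false x w : degree h x = 2 -> degree h w = 0 -> e x w = true -> False.
Proof.
move=> dx dw xw.
have only q s : h q s = true -> degree h q = 2 -> degree h s = 1 -> q = x.
  move=> qs dq ds; apply/eqP; apply: contraT => /eqP qx; exfalso.
  by apply: (no_red12_blue02 qs dq ds dx dw xw); apply: nesym.
have E := only _ _ gp dg dp; subst x.
have [y [dy yu yv yg]] := old2_new gu gv.
have red2 s z : degree h s = 2 -> s <> u -> s <> v -> s <> g -> h s z = true ->
    [/\ degree h z = 2, z <> u & z <> v].
  by move=> ds su sv sg sz; case: (old_red ds su sv sz) => // dz; case: sg; apply: (only s z).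
have [y1 [y2 [l [yy1 yy2 [yl bl] y12 _]]]] := degree2_nbrs e3 hs dy.
have [dy1 y1u y1v] := red2 _ _ dy yu yv yg yy1; have [dy2 y2u y2v] := red2 _ _ dy yu yv yg yy2.
case: (blue_degree e3 hs yl bl) => dl.
- exact: (no_red12_blue02 gp dg dp dy dl yl).
- have off z : h y z = true -> degree h z = 2 -> z <> u -> z <> v -> z <> g -> False.
    move=> yz dz zu zv zg; have zy : h z y = true by rewrite hy.
    have zy' : z <> y by move=> E; move: (he yz); rewrite E ei.
    have [t zt ty] := other_red2 dz zy; have [dt _ _] := red2 _ _ dz zu zv zg zt.
    exact: (no_red22_blue12 zt dz dt dy dl yl bl).
  have [E|/eqP y1g] := eqVneq y1 g; last exact: (off y1).
  by apply: (off y2) => // E2; case: y12; rewrite E E2.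
- exact: (no_swap22 dy dy1 dl yy1 yl bl).
Qed.

Hypothesis no02 : forall x w, degree h x = 2 -> degree h w = 0 -> e x w = true -> False.

(** [q] trades its red edge to [t] for a blue edge [q w], while [u v] becomes red. The degree of [w]
    decides which red edge is removed besides: [g p], [y z], or one at [w]. If [w] has degree 2 but
    is not on [y z], adding [q w] and removing [y z] is enough. *)
Lemma no_leaf y z q t : h y z = true -> degree h y = 2 -> degree h z = 2 ->
  y <> u -> y <> v -> z <> u -> z <> v ->
  h q t = true -> degree h q = 1 -> saturated t -> False.
Proof.
move=> yz dy dz yu yv zu zv qt dq st; have zy : h z y = true by rewrite hy.
have [t' [w [_ [qt' [qw bw] _ _ _]]]] := degree1_nbrs e3 hs dq.
have {t' qt'} tg : t <> g by case: st => dt E; subst t; congruence.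
have pq : p <> q.
  move=> E; subst q; have pg : h p g = true by rewrite hy.
  by case: tg; apply: (degree1_red e3 hs dp qt pg).
have tq : h t q = true by rewrite hy.
case: (blue_degree e3 hs qw bw) => dw.
- case: st => dt; try subst t; apply: unsolved.
  + play e3 hs hb [:: t; q; w; g; p; u; v] [:: 3; 1; 0; 2; 1; 2; 2]
      [:: (0, 1, false); (1, 2, true); (3, 4, false); (5, 6, true)].
  + play e3 hs hb [:: u; q; w; g; p; v] [:: 2; 1; 0; 2; 1; 2]
      [:: (0, 1, false); (1, 2, true); (3, 4, false); (0, 5, true)].
  + play e3 hs hb [:: v; q; w; g; p; u] [:: 2; 1; 0; 2; 1; 2]
      [:: (0, 1, false); (1, 2, true); (3, 4, false); (0, 5, true)].
- case: st => dt; try subst t; apply: unsolved.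
  + play e3 hs hb [:: t; q; w; y; z; u; v] [:: 3; 1; 1; 2; 2; 2; 2]
      [:: (0, 1, false); (1, 2, true); (3, 4, false); (5, 6, true)].
  + play e3 hs hb [:: u; q; w; y; z; v] [:: 2; 1; 1; 2; 2; 2]
      [:: (0, 1, false); (1, 2, true); (3, 4, false); (0, 5, true)].
  + play e3 hs hb [:: v; q; w; y; z; u] [:: 2; 1; 1; 2; 2; 2]
      [:: (0, 1, false); (1, 2, true); (3, 4, false); (0, 5, true)].
have [wu wv] : w <> u /\ w <> v by apply: (blue_not_uv _ qw bw); rewrite dq.
have trail s : h w s = true -> degree h s = 2 -> s <> u -> s <> v -> False.
  move=> ws ds su sv; case: st => dt; try subst t; apply: unsolved.
  + play e3 hs hb [:: t; q; w; s; u; v] [:: 3; 1; 2; 2; 2; 2]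
      [:: (0, 1, false); (1, 2, true); (2, 3, false); (4, 5, true)].
  + play e3 hs hb [:: u; q; w; s; v] [:: 2; 1; 2; 2; 2]
      [:: (0, 1, false); (1, 2, true); (2, 3, false); (0, 4, true)].
  + play e3 hs hb [:: v; q; w; s; u] [:: 2; 1; 2; 2; 2]
      [:: (0, 1, false); (1, 2, true); (2, 3, false); (0, 4, true)].
have wq : e w q = true by rewrite es.
have bq : h w q = false by rewrite hy.
apply: (no_red22_blue12 yz dy dz dw dq wq bq) => E; subst w; [exact: (trail z)|exact: (trail y)].
Qed.

(** For counting the red edges between old vertices of degree 2 and vertices of degree 1 from both
    sides. *)
Let old := [set x in A | (degree h x == 2) && (x \notin [:: u; v])].
Let ones x := #|[set q | h x q && (degree h q == 1)]|.

Lemma card_old : #|old| = (num_on A h 2).-2.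
Proof.
have U : uniq [:: u; v] by rewrite /= inE andbT; apply/eqP => E; move: euv; rewrite E ei.
have S : {subset [:: u; v] <= A}.
  by move=> x; rewrite !inE => /orP[] /eqP->; [exact: (red_mem e3 hs hua)|exact: (red_mem e3 hs hvc)].
by rewrite (num_on_split h 2 U S) /= du dv addn2.
Qed.

Lemma sum_eq_le1 (B : {set V}) t : \sum_(x in B) (x == t) <= 1.
Proof.
have [tB|tB] := boolP (t \in B).
  by rewrite (bigD1 t) //= eqxx big1 // => x /andP[_ /negbTE->].
by rewrite big1 // => x xB; case: eqP => // E; rewrite -E xB in tB.
Qed.

(** A vertex of degree 1 has a single red edge and is counted at most once. *)
Lemma sum_ones : \sum_(x in old) ones x <= num_on A h 1.
Proof.
have -> : \sum_(x in old) ones x = \sum_(x in old) \sum_(q | degree h q == 1) h x q.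
  apply: eq_bigr => x _; rewrite /ones -sum1_card big_mkcond [RHS]big_mkcond /=.
  by apply: eq_bigr => q _; rewrite inE; case: (h x q); case: (_ == 1).
rewrite exchange_big /= /num_on -sum1_card.
rewrite [X in _ <= X](eq_bigl (fun q => degree h q == 1)); last first.
  move=> q; rewrite inE; case: eqP => dq; rewrite ?andbF // andbT.
  by apply: contraT => /(degree_out e3 hs); rewrite dq.
apply: leq_sum => q /eqP dq; have [t [_ [_ [qt _ _ _ _]]]] := degree1_nbrs e3 hs dq.
apply: leq_trans (sum_eq_le1 old t); apply: leq_sum => x _; case xq : (h x q) => //.
by rewrite (degree1_red e3 hs dq (_ : h q x = true) qt) ?eqxx // hy.
Qed.

Lemma ones_ge1 x y : h x y = true -> degree h y = 1 -> 1 <= ones x.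
Proof. by move=> xy dy; apply/card_gt0P; exists y; rewrite inE xy dy. Qed.

Lemma ones_ge2 x : degree h x = 2 -> (forall y, h x y = true -> degree h y = 1) -> 2 <= ones x.
Proof.
move=> dx xy; rewrite -dx; apply/subset_leq_card/subsetP=> y; rewrite !inE => hxy.
by rewrite hxy (xy y hxy).
Qed.

(** Each old vertex of degree 2 sends two red edges to vertices of degree 1, except that one red
    edge [y z] inside [old] may cost two of them. Balance allows at most as many vertices of degree
    1 as [old] has elements. Without [y z] this is absurd at once; with it [old] has at most two
    elements, whereas the four vertices of degree 3 require four. *)
Lemma red12_false : False.
Proof.
have oldP x : reflect [/\ degree h x = 2, x <> u & x <> v] (x \in old).
  rewrite !inE negb_or; apply: (iffP idP) => [/and4P[_ /eqP dx /eqP xu /eqP xv]//|[dx xu xv]].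
  rewrite dx (introN eqP xu) (introN eqP xv) !andbT.
  by apply: contraT => /(degree_out e3 hs); rewrite dx.
have n12 : num_on A h 1 <= (num_on A h 2).-2 by move: hb; rewrite /bal; clear; lia.
have n4 := num2_ge4.
have [/existsP[y /existsP[z /and3P[yo zo yz]]]|no22] :=
  boolP [exists y, exists z, [&& y \in old, z \in old & h y z]]; last first.
  suff : \sum_(x in old) 2 <= \sum_(x in old) ones x.
    by move: sum_ones n12 n4; rewrite sum_nat_const card_old; clear; lia.
  apply: leq_sum => x xo; have [dx xu xv] := oldP _ xo; apply: ones_ge2 => // y xy.
  case: (old_red dx xu xv xy) => // /oldP yo.
  by case/negP: no22; apply/existsP; exists x; apply/existsP; exists y; rewrite xo yo.
have [dy yu yv] := oldP _ yo; have [dz zu zv] := oldP _ zo.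
have zy : h z y = true by rewrite hy.
have four := four_of_closed (fun q t => @no_leaf y z q t yz dy dz yu yv zu zv).
have lonely x s : x \in old -> x <> y -> x <> z -> h x s = true -> degree h s = 1.
  move=> /oldP[dx xu xv] xy xz xs; case: (old_red dx xu xv xs) => // -[ds su sv].
  have [_ [_ [l [_ _ [xl bl] _ _]]]] := degree2_nbrs e3 hs dx.
  case: (blue_degree e3 hs xl bl) => dl; first by case: (no02 dx dl xl).
    by case: (no_red22_blue12 yz dy dz dx dl xl bl); apply: nesym.
  by case: (no_swap22 dx ds dl xs xl bl).
have one s s' : h s s' = true -> degree h s = 2 -> s <> u -> s <> v ->
    s = y /\ s' = z \/ s = z /\ s' = y -> 1 <= ones s.
  move=> ss' ds su sv E; have [r sr rs'] := other_red2 ds ss'.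
  case: (old_red ds su sv sr) => [dr|[dr ru rv]]; first exact: ones_ge1 sr dr.
  have rs : h r s = true by rewrite hy.
  have ro : r \in old by apply/oldP.
  have nrs : r <> s by move=> E'; move: (he sr); rewrite E' ei.
  suff : degree h s = 1 by rewrite ds.
  by apply: (lonely r) => //; case: E => -[E1 E2]; subst.
have oy := one y z yz dy yu yv (or_introl (conj erefl erefl)).
have oz := one z y zy dz zu zv (or_intror (conj erefl erefl)).
have S : \sum_(x in old) 2 <= \sum_(x in old) (ones x + (x == y) + (x == z)).
  apply: leq_sum => x xo; have [->|/eqP xy] := eqVneq x y; first by rewrite -addnA; apply: (@leq_add 1 1).
  have [->|/eqP xz] := eqVneq x z.
    by apply: (@leq_add 1 1) => //; apply: leq_trans oz (leq_addr _ _).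
  rewrite !addn0; apply: ones_ge2; first by case/oldP: xo.
  by move=> s; apply: lonely.
move: S; rewrite sum_nat_const card_old !big_split /=.
move: (sum_eq_le1 old y) (sum_eq_le1 old z) sum_ones n12 n4 hb four; rewrite /bal; clear; lia.
Qed.

End Red12.

Lemma gain_one_three : False.
Proof.
have [/existsP[g /existsP[p /and5P[gp /eqP dg /eqP dp /eqP gu /eqP gv]]]|no] :=
  boolP [exists g, exists p, [&& h g p, degree h g == 2, degree h p == 1, g != u & g != v]].
  apply: (red12_false gp dg dp gu gv) => x w dx dw xw.
  exact: (red12_blue02_false gp dg dp gu gv dx dw xw).
apply: no_red12_false => x y xy dx dy.
have [->|yu] := eqVneq y u; first by left.
have [->|yv] := eqVneq y v; first by right.
by case/negP: no; apply/existsP; exists y; apply/existsP; exists x; rewrite hy xy dx dy yu yv.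
Qed.

End GainOneThree.

End SuppressedEdge.

(** * Repairing a colouring after restoring a diamond *)

(* Of the edges at the diamond, exactly the path b-w-v-w'-b' is red. *)
Section SuppressedDiamond.
Variables (V : finType) (A : {set V}) (e h : rel V) (z v w w' b b' : V).
Hypotheses (e3 : cubic_on A e) (hs : sub_rel e h) (unsolved : ~ solvable A e).
Hypotheses (ezv : e z v = true) (ezw : e z w = true) (ezw' : e z w' = true).
Hypotheses (hvw : h v w = true) (hvw' : h v w' = true).
Hypotheses (hwb : h w b = true) (hwb' : h w' b' = true).
Hypotheses (dz : degree h z = 0) (dv : degree h v = 2).
Hypotheses (dw : degree h w = 2) (dw' : degree h w' = 2).
Hypotheses (ww' : w <> w') (bb' : b <> b') (bv : b <> v) (bv' : b' <> v).
Hypotheses (eww' : e w w' = false) (ebb' : e b b' = false).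
Hypothesis hb : bal (num_on A h 0) (num_on A h 1).+1 (num_on A h 2).-2 (num_on A h 3).+1.
Hypotheses (large : 8 <= #|A|) (even_card : ~~ odd #|A|).

Let es : symmetric e. Proof. by case: e3. Qed.
Let ei : irreflexive e. Proof. by case: e3. Qed.
Let hy : symmetric h. Proof. by case: hs. Qed.
Let he : subrel h e. Proof. by case: hs. Qed.

Let old x := [/\ x <> v, x <> w & x <> w'].

Let hz x : h z x = false. Proof. exact: (degree0_blue _ dz). Qed.

Lemma z_nbr x : e x z = true -> [\/ x = v, x = w | x = w'].
Proof.
move=> xz; have [->|/eqP xv] := eqVneq x v; first by constructor 1.
have [->|/eqP xw] := eqVneq x w; first by constructor 2.
have [->|/eqP xw'] := eqVneq x w'; first by constructor 3.
by case: (@cubic_four_nbrs _ _ _ e3 z v w w' x); [neqs|sat; assumption..].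
Qed.

Lemma v_nbr x : e x v = true -> [\/ x = z, x = w | x = w'].
Proof.
move=> xz; have [->|/eqP xv] := eqVneq x z; first by constructor 1.
have [->|/eqP xw] := eqVneq x w; first by constructor 2.
have [->|/eqP xw'] := eqVneq x w'; first by constructor 3.
by case: (@cubic_four_nbrs _ _ _ e3 v z w w' x); [neqs|sat; assumption..].
Qed.

Let hzv : h z v = false. Proof. exact: hz. Qed.
Let hzw : h z w = false. Proof. exact: hz. Qed.
Let hzw' : h z w' = false. Proof. exact: hz. Qed.
Let hzb : h z b = false. Proof. exact: hz. Qed.
Let hzb' : h z b' = false. Proof. exact: hz. Qed.

Lemma w_nbr x : e x w = true -> [\/ x = z, x = v | x = b].
Proof.
move=> xz; have [->|/eqP xv] := eqVneq x z; first by constructor 1.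
have [->|/eqP xw] := eqVneq x v; first by constructor 2.
have [->|/eqP xw'] := eqVneq x b; first by constructor 3.
have zb : z <> b by move=> E; move: hwb; rewrite -E hy hz.
by case: (@cubic_four_nbrs _ _ _ e3 w z v b x); [neqs|sat; assumption..].
Qed.

Lemma w_nbr' x : e x w' = true -> [\/ x = z, x = v | x = b'].
Proof.
move=> xz; have [->|/eqP xv] := eqVneq x z; first by constructor 1.
have [->|/eqP xw] := eqVneq x v; first by constructor 2.
have [->|/eqP xw'] := eqVneq x b'; first by constructor 3.
have zb : z <> b' by move=> E; move: hwb'; rewrite -E hy hz.
by case: (@cubic_four_nbrs _ _ _ e3 w' z v b' x); [neqs|sat; assumption..].
Qed.

(** Making [z v] red gives [z] and [v] the degrees 1 and 3; [x] replaces [z] in degree 0, and [y]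
    replaces [x] in degree 1. *)
Lemma diamond_no_red12 x y : h x y = true -> degree h x = 1 -> degree h y = 2 -> False.
Proof.
move=> xy dx dy; have yv : y <> v.
  by move=> E; subst y; case: (v_nbr (he xy)) => E; subst x; clash.
apply: unsolved; play e3 hs hb [:: z; v; x; y] [:: 0; 2; 1; 2] [:: (0, 1, true); (2, 3, false)].
Qed.

(** [z] is joined to [v] and to whichever of [w], [w'] is not [g]. *)
Lemma diamond_no_red13_22 p t k g : h p t = true -> degree h p = 1 -> degree h t = 3 ->
  h k g = true -> degree h k = 2 -> degree h g = 2 -> old k -> g <> v -> False.
Proof.
move=> pt dp dt kg dk dg [kv kw kw'] gv.
have [E|/eqP gw] := eqVneq g w; last first.
  apply: unsolved; play e3 hs hb [:: z; v; w; p; t; k; g] [:: 0; 2; 2; 1; 3; 2; 2]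
    [:: (0, 1, true); (0, 2, true); (3, 4, false); (5, 6, false)].
have gw' : g <> w' by rewrite E.
apply: unsolved; play e3 hs hb [:: z; v; w'; p; t; k; g] [:: 0; 2; 2; 1; 3; 2; 2]
    [:: (0, 1, true); (0, 2, true); (3, 4, false); (5, 6, false)].
Qed.

(** [k] can trade [g] for its blue neighbour [l]. If [l] has degree 2 this suffices; if it has
    degree 0 or 1, the red edge at a vertex of degree 1 is removed too, whence the cases for its
    other end [q]. *)
Lemma diamond_no_red22 k g : h k g = true -> degree h k = 2 -> degree h g = 2 -> old k -> False.
Proof.
move=> kg dk dg ok; have [kv kw kw'] := ok.
have kz : k <> z by move=> E; move: dk; rewrite E dz.
have gv : g <> v.
  by move=> E; subst g; case: (v_nbr (he kg)).
have [_ [_ [l [_ _ [kl bl] _ _]]]] := degree2_nbrs e3 hs dk.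
have lz : l <> z by move=> E; subst l; case: (z_nbr kl).
case: (blue_degree e3 hs kl bl) => dl.
- have [p [_ _ dp]] : exists x, [/\ x \in A, x \notin [::] & degree h x = 1].
    apply: num_on_new; move: hb (num_on_total e3 hs) large; rewrite /bal /=; clear; lia.
  have [q [_ [_ [pq _ _ _ _]]]] := degree1_nbrs e3 hs dp.
  case: (red_degree e3 hs pq) => dq.
  + apply: unsolved; play e3 hs hb [:: z; v; k; g; l; p; q] [:: 0; 2; 2; 2; 0; 1; 1]
      [:: (0, 1, true); (2, 3, false); (2, 4, true); (5, 6, false)].
  + exact: (diamond_no_red12 pq dp dq).
  + exact: (diamond_no_red13_22 pq dp dq kg dk dg ok gv).
- have [q [_ [_ [lq _ _ _ _]]]] := degree1_nbrs e3 hs dl.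
  case: (red_degree e3 hs lq) => dq.
  + apply: unsolved; play e3 hs hb [:: z; v; q; l; k; g] [:: 0; 2; 1; 1; 2; 2]
      [:: (0, 1, true); (2, 3, false); (3, 4, true); (4, 5, false)].
  + exact: (diamond_no_red12 lq dl dq).
  + exact: (diamond_no_red13_22 lq dl dq kg dk dg ok gv).
- apply: unsolved; play e3 hs hb [:: k; g; l] [:: 2; 2; 2] [:: (0, 1, false); (0, 2, true)].
Qed.

Lemma old_red3 k s : degree h k = 2 -> old k -> h k s = true -> degree h s = 3.
Proof.
move=> dk ok ks; case: (red_degree e3 hs ks) => // ds.
  by case: (@diamond_no_red12 s k); rewrite // hy.
by case: (diamond_no_red22 ks dk ds ok).
Qed.

Let wb_neq : b <> w. Proof. by move=> E; move: (he hwb); rewrite E ei. Qed.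
Let wb_neq' : b' <> w'. Proof. by move=> E; move: (he hwb'); rewrite E ei. Qed.

Lemma db : degree h b = 3.
Proof.
have hbw : h b w = true by rewrite hy.
case: (red_degree e3 hs hwb) => // d1; first by case: (diamond_no_red12 hbw d1 dw).
by case: (diamond_no_red22 hbw d1 dw); split=> // E; move: eww'; rewrite -E (he hwb).
Qed.

Lemma db' : degree h b' = 3.
Proof.
have hbw : h b' w' = true by rewrite hy.
case: (red_degree e3 hs hwb') => // d1; first by case: (diamond_no_red12 hbw d1 dw').
by case: (diamond_no_red22 hbw d1 dw'); split=> // E; move: eww'; rewrite es -E (he hwb').
Qed.

(* All of z, v, w, w' get degree 3, and two vertices of degree 2 lose three red edges. *)
Lemma same_red_nbrs x s s' x' r : degree h x = 2 -> old x -> h x s = true -> h x s' = true -> s <> s' ->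
  degree h x' = 2 -> old x' -> x <> x' -> h x' r = true -> r = s \/ r = s'.
Proof.
move=> dx ox xs xs' ss' dx' ox' xx' xr.
have [->|/eqP rs] := eqVneq r s; first by left.
have [->|/eqP rs'] := eqVneq r s'; first by right.
have ds := old_red3 dx ox xs; have ds' := old_red3 dx ox xs'; have dr := old_red3 dx' ox' xr.
case: ox ox' => xv xw xw' [x'v x'w x'w']; case: unsolved.
play e3 hs hb [:: z; v; w; w'; x; s; s'; x'; r] [:: 0; 2; 2; 2; 2; 3; 3; 2; 3]
  [:: (0, 1, true); (0, 2, true); (0, 3, true); (4, 5, false); (4, 6, false); (7, 8, false)].
Qed.

Lemma no_leaf_two_red23 p t x s x' s' : h p t = true -> degree h p = 1 -> degree h t = 3 ->
  degree h x = 2 -> old x -> h x s = true -> degree h x' = 2 -> old x' -> h x' s' = true ->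
  x <> x' -> s <> s' -> t <> s -> t <> s' -> False.
Proof.
move=> pt dp dt dx ox xs dx' ox' xs' xx' ss' ts ts'.
have ds := old_red3 dx ox xs; have ds' := old_red3 dx' ox' xs'.
case: ox ox' => xv xw xw' [x'v x'w x'w']; case: unsolved.
play e3 hs hb [:: z; v; w; w'; p; t; x; s; x'; s'] [:: 0; 2; 2; 2; 1; 3; 2; 3; 2; 3]
  [:: (0, 1, true); (0, 2, true); (0, 3, true); (4, 5, false); (6, 7, false); (8, 9, false)].
Qed.

Lemma diamond_no_blue22 k l : degree h k = 2 -> degree h l = 2 -> old k -> old l ->
  e k l = true -> h k l = false -> False.
Proof.
move=> dk dl [kv kw kw'] [lv lw lw'] kl bl; have dB := db; case: unsolved.
play e3 hs hb [:: w; b; k; l] [:: 2; 3; 2; 2] [:: (0, 1, false); (2, 3, true)].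
Qed.

Lemma old_new (s : seq V) : size s + 3 < num_on A h 2 ->
  exists x, [/\ degree h x = 2, old x & x \notin s].
Proof.
move=> l; have l' : size [:: v, w, w' & s] < num_on A h 2 by rewrite /= -addn3.
have [x [_ + dx]] := num_on_new l'; rewrite !inE !negb_or.
by case/and4P=> /eqP xv /eqP xw /eqP xw' xs; exists x.
Qed.

Lemma num2_ge4' : 4 <= num_on A h 2.
Proof. by move: hb (num_on_total e3 hs) large; rewrite /bal; clear; lia. Qed.

(** A vertex [y] of degree 1 would be a leaf for [no_leaf_two_red23]; one of degree 2 has only [s]
    and [s'] as red neighbours, and [t] is neither. *)
Lemma saturated_nbr t y x s s' x' : degree h t = 3 -> t <> s -> t <> s' -> s <> s' -> x <> x' ->
  degree h x = 2 -> old x -> h x s = true -> h x s' = true ->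
  degree h x' = 2 -> old x' -> h x' s' = true -> e t y = true -> old y -> degree h y = 3.
Proof.
move=> dt ts ts' ss' xx' dx ox xs xs' dx' ox' xs'' ty oy.
have hty := degree3_red e3 hs dt ty; have hyt : h y t = true by rewrite hy.
case: (red_degree e3 hs hty) => // dy.
  by case: (no_leaf_two_red23 hyt dy dt dx ox xs dx' ox' xs'').
have [E|/eqP xy] := eqVneq x y.
  by subst y; case: (degree2_red e3 hs dx xs xs' hyt) => E; [case: ss'|case: ts|case: ts'].
by case: (same_red_nbrs dx ox xs xs' ss' dy oy xy hyt).
Qed.

(** There is one old vertex [x] of degree 2, and balance leaves no vertices of degree 3 but [b] and
    [b']. Their third neighbours [p], [p'] are the only vertices of degree 1 among ten vertices
    altogether. So few are left that [x] would have to be adjacent to [b], [b'], [p] and [p']. *)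
Lemma small_diamond : num_on A h 2 <= 4 -> False.
Proof.
move=> n2; have dB := db; have dB' := db'.
have [x [dx ox _]] := old_new (s := [::]) num2_ge4'; have [xv xw xw'] := ox.
have only2 y : degree h y = 2 -> old y -> y = x.
  move=> dy [yv yw yw']; apply/eqP; apply: contraT => /eqP yx.
  have U : uniq [:: v; w; w'; x; y] by neqs.
  suff : 5 <= num_on A h 2 by rewrite leqNgt ltnS n2.
  by apply: (num_on_ge_pos e3 hs U); rewrite //= dv dw dw' dx dy.
have only3 y : degree h y = 3 -> y = b \/ y = b'.
  move=> dy; have [->|/eqP yb] := eqVneq y b; first by left.
  have [->|/eqP yb'] := eqVneq y b'; first by right.
  have U : uniq [:: b; b'; y] by neqs.
  suff : 3 <= num_on A h 3 by move: hb n2; rewrite /bal; clear; lia.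
  by apply: (num_on_ge_pos e3 hs U); rewrite //= dB dB' dy.
have [xb xb'] : h x b = true /\ h x b' = true.
  have [s [s' [_ [xs xs' _ ss' _]]]] := degree2_nbrs e3 hs dx.
  by case: (only3 _ (old_red3 dx ox xs)) (only3 _ (old_red3 dx ox xs')) => E [] E'; subst s s'.
have leaf c W : (c = b /\ W = w) \/ (c = b' /\ W = w') -> exists p, h p c = true /\ degree h p = 1.
  move=> cc; have [hWc dc xc] : [/\ h W c = true, degree h c = 3 & h x c = true].
    by case: cc => -[-> ->].
  have cW : e c W = true by rewrite es; apply: he.
  have [y1 [y2 [y12 [ry1 ry2] cy1 cy2 _]]] := other_nbrs e3 cW.
  have pick y : y <> x -> W <> y -> e c y = true -> h y c = true /\ degree h y = 1.
    move=> yx ry cy; have hcy := degree3_red e3 hs dc cy.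
    have hyc : h y c = true by rewrite hy.
    split=> //; case: (red_degree e3 hs hcy) => // dy.
      case: yx; apply: only2 => //; split=> E; subst y.
      - by case: (v_nbr cy) => E; subst c; clash.
      - by case: (w_nbr cy) => E; case: cc => -[? ?]; subst; clash.
      - by case: (w_nbr' cy) => E; case: cc => -[? ?]; subst; clash.
    have eb : e b' b = false by rewrite es.
    by case: (only3 y dy) cc => E [] [? ?]; subst; rewrite ?ei ?eb ?ebb' in cy.
  have [E|/eqP y1x] := eqVneq y1 x; last by exists y1; apply: pick.
  by exists y2; apply: pick => // E2; apply: y12; rewrite E E2.
have [p [pb dp]] := leaf b w (or_introl (conj erefl erefl)).
have [p' [pb' dp']] := leaf b' w' (or_intror (conj erefl erefl)).
have pp' : p <> p' by move=> E; subst p'; apply: bb'; apply: (degree1_red e3 hs dp pb pb').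
have Ux : uniq [:: b; b'] by neqs.
have n3 : 2 <= num_on A h 3 by apply: (num_on_ge_pos e3 hs Ux); rewrite //= dB dB'.
have Up : uniq [:: p; p'] by neqs.
have n1 : 2 <= num_on A h 1 by apply: (num_on_ge_pos e3 hs Up); rewrite //= dp dp'.
(* Balance also admits three vertices of degree 0; the even order excludes this. *)
have hn : num_on A h 0 = 2 /\ num_on A h 1 = 2 /\ num_on A h 2 = 4 /\ num_on A h 3 = 2.
  move: hb n1 n2 n3 num2_ge4' (num_on_total e3 hs) even_card; rewrite /bal; clear => *.
  by repeat split; lia.
have [hn0 [hn1 [hn2 hn3]]] := hn.
have only1 q : degree h q = 1 -> q = p \/ q = p'.
  move=> dq; have [->|/eqP qp] := eqVneq q p; first by left.
  have [->|/eqP qp'] := eqVneq q p'; first by right.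
  have U : uniq [:: p; p'; q] by neqs.
  suff : 3 <= num_on A h 1 by rewrite hn1.
  by apply: (num_on_ge_pos e3 hs U); rewrite //= dp dp' dq.
have only0 q q' : degree h q = 0 -> degree h q' = 0 -> q \in A -> q' \in A -> q <> z -> q' <> z -> q = q'.
  move=> dq dq' qA q'A qz q'z; apply/eqP; apply: contraT => /eqP qq'.
  have U : uniq [:: z; q; q'] by neqs.
  suff : 3 <= num_on A h 0 by rewrite hn0.
  apply: (num_on_ge U); last by rewrite /= dz dq dq'.
  by move=> y; rewrite !inE => /or3P[] /eqP-> //; apply: (cubic_mem e3 ezv).
case epp' : (e p p').
  have bpp' : h p p' = false.
    apply/negP => hpp'; move: dB; rewrite -(degree1_red e3 hs dp hpp' pb) dp'; by [].
  (* This repair does not aim at the counts of [hb]: it leads to 3, 2, 3, 2. *)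
  apply: unsolved; play e3 hs hn [:: p; p'; v; w; w'] [:: 1; 1; 2; 2; 2]
    [:: (0, 1, true); (2, 3, false); (2, 4, false)].
have toX q q' : degree h q = 1 -> q = p /\ q' = p' \/ q = p' /\ q' = p -> e x q = true.
  move=> dq qq; have eqq' : e q q' = false by case: qq => -[-> ->]; rewrite // es.
  have [c [y1 [y2 [_ [qy1 by1] [qy2 by2] y12 _]]]] := degree1_nbrs e3 hs dq.
  have blue y : e q y = true -> h q y = false -> degree h y = 0 /\ y <> z \/ y = x.
    move=> qy bqy; have yq : e y q = true by rewrite es.
    case: (blue_degree e3 hs qy bqy) => dy; [left|exfalso|right].
    - by split=> // E; subst y; case: (z_nbr qy) => E; subst q; clash.
    - case: (only1 y dy) => E; subst y; case: qq => -[E1 E2]; subst q q'; rewrite ?ei in qy; clash.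
    - apply: only2 => //; split=> E; subst y.
      + by case: (v_nbr qy) => E; subst q; clash.
      + by case: (w_nbr qy) => E; subst q; clash.
      + by case: (w_nbr' qy) => E; subst q; clash.
  case: (blue _ qy1 by1) => [[d1 z1]|E]; last by subst y1; rewrite es.
  case: (blue _ qy2 by2) => [[d2 z2]|E]; last by subst y2; rewrite es.
  case: y12; apply: only0 => //; [move: qy1|move: qy2]; rewrite es; exact: (cubic_mem e3).
have xp := toX p p' dp (or_introl (conj erefl erefl)).
have xp' := toX p' p dp' (or_intror (conj erefl erefl)).
by apply: (@cubic_four_nbrs _ _ _ e3 x b b' p p'); [neqs|sat; assumption..].
Qed.

(** With at least two old vertices of degree 2, all of them have the same red neighbours [s], [s'].
    These are [b] and [b'], as otherwise degree 3 spreads around [b] or [b'] until balance demands a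
    fourth neighbour of [s]. The neighbours of [b] and [b'] are then all known, and every degree of
    the blue neighbour of [x] allows a repair. *)
Lemma suppressed_diamond : False.
Proof.
have dB := db; have dB' := db'.
have [n2|n2] := leqP (num_on A h 2) 4; first exact: small_diamond.
have [x [dx ox _]] := old_new (s := [::]) num2_ge4'.
have [x' [dx' ox']] := old_new (s := [:: x]) n2; rewrite inE => /eqP x'x.
have [s [s' [_ [xs xs' _ ss' _]]]] := degree2_nbrs e3 hs dx.
have xx' := nesym x'x.
have ds := old_red3 dx ox xs; have ds' := old_red3 dx ox xs'.
have same y r : degree h y = 2 -> old y -> h y r = true -> r = s \/ r = s'.
  move=> dy oy yr; have [E|/eqP xy] := eqVneq x y; last exact: (same_red_nbrs dx ox xs xs' ss' dy oy xy yr).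
  subst y; case: (degree2_red e3 hs dx yr xs xs') => // E; by [left|right].
have both y : degree h y = 2 -> old y -> h y s = true /\ h y s' = true.
  move=> dy oy; have [r [r' [_ [yr yr' _ rr' _]]]] := degree2_nbrs e3 hs dy.
  by case: (same _ _ dy oy yr) (same _ _ dy oy yr') => E [] E'; subst r r'.
have [x's x's'] := both _ dx' ox'.
have [xv xw xw'] := ox; have [x'v x'w x'w'] := ox'.
have nbr3 t y : degree h t = 3 -> t <> s -> t <> s' -> e t y = true -> old y -> degree h y = 3.
  move=> dt ts ts' ty oy; exact: (saturated_nbr dt ts ts' ss' xx' dx ox xs xs' dx' ox' x's' ty oy).
have third_old : 4 <= num_on A h 3 -> exists y, [/\ degree h y = 2, old y, y <> x & y <> x'].
  move=> n3; have [|y [dy oy]] := @old_new [:: x; x'].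
    by change (5 < num_on A h 2); move: hb n3; rewrite /bal; clear; lia.
  by rewrite !inE negb_or => /andP[/eqP yx /eqP yx']; exists y.
have old3 y : degree h y = 3 -> old y by move=> dy; split=> E; subst y; clash.
have nbr_old t y : degree h t = 3 -> t <> b -> t <> b' -> e t y = true -> old y.
  move=> dt tb tb' ty; split=> E; subst y.
  - by case: (v_nbr ty) => E; subst t; clash.
  - by case: (w_nbr ty) => E; subst t; clash.
  - by case: (w_nbr' ty) => E; subst t; clash.
(* Stated for both mirror images, so that it serves [b] and [b'] alike. *)
have core c W c' W' : (c = b /\ W = w /\ c' = b' /\ W' = w') \/ (c = b' /\ W = w' /\ c' = b /\ W' = w) ->
    c = s \/ c = s'.
  move=> cc; have [->|/eqP cs] := eqVneq c s; first by left.
  have [->|/eqP cs'] := eqVneq c s'; first by right.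
  have [[dc dc'] [hWc hWc'] [cW' c'W] [ecc' ncc']] : [/\ degree h c = 3 /\ degree h c' = 3,
      h W c = true /\ h W' c' = true, e c W' = false /\ e c' W = false & e c c' = false /\ c <> c'].
    have bw' : e b w' = false.
      by apply/negP => bw; case: (w_nbr' bw) => E; subst b; clash.
    have b'w : e b' w = false.
      by apply/negP => bw; case: (w_nbr bw) => E; subst b'; clash.
    by case: cc => -[-> [-> [-> ->]]]; do !split=> //; [rewrite es|exact: nesym].
  have cW : e c W = true by rewrite es; apply: he.
  have oy y : e c y = true -> W <> y -> old y.
    move=> cy Wy; split=> E; subst y.
    - by case: (v_nbr cy) => E; subst c; clash.
    - by case: cc => -[? [? [? ?]]]; subst; clash.
    - by case: cc => -[? [? [? ?]]]; subst; clash.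
  have [y1 [y2 [y12 [wy1 wy2] cy1 cy2 _]]] := other_nbrs e3 cW.
  have dy1 := nbr3 c y1 dc cs cs' cy1 (oy _ cy1 wy1).
  have dy2 := nbr3 c y2 dc cs cs' cy2 (oy _ cy2 wy2).
  have U : uniq [:: c; y1; y2; c'] by neqs.
  have n3 : 4 <= num_on A h 3.
    by apply: (num_on_ge_pos e3 hs U); rewrite //= dc dy1 dy2 dc'.
  have [x2 [dx2 ox2 x2x x2x']] := third_old n3; have [x2s x2s'] := both _ dx2 ox2.
  have full r y : r = s \/ r = s' -> e r y = true -> [\/ y = x, y = x' | y = x2].
    move=> rs ry; have [->|/eqP yx] := eqVneq y x; first by constructor 1.
    have [->|/eqP yx'] := eqVneq y x'; first by constructor 2.
    have [->|/eqP yx2] := eqVneq y x2; first by constructor 3.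
    case: rs => E; subst r.
      by case: (@cubic_four_nbrs _ _ _ e3 s x x' x2 y); [neqs|sat; assumption..].
    by case: (@cubic_four_nbrs _ _ _ e3 s' x x' x2 y); [neqs|sat; assumption..].
  have not_s r y : r = s \/ r = s' -> e r y = true -> degree h y <> 3.
    by move=> rs ry; case: (full r y rs ry) => ->; rewrite ?dx ?dx' ?dx2.
  have ne r y : r = s \/ r = s' -> e c y = true -> y <> r.
    by move=> rs cy E; subst y; rewrite es in cy; apply: (not_s _ _ rs cy).
  have c's r : r = s \/ r = s' -> c' <> r.
    move=> rs E; subst c'; have rW' : e r W' = true by rewrite es; apply: he.
    case: ox2 => x2v x2w x2w'.
    by case: (full _ _ rs rW') => E; case: cc => -[? [? [? ?]]]; subst; clash.
  have y1s := ne s y1 (or_introl erefl) cy1; have y1s' := ne s' y1 (or_intror erefl) cy1.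
  have y2s := ne s y2 (or_introl erefl) cy2; have y2s' := ne s' y2 (or_intror erefl) cy2.
  have c's1 := c's s (or_introl erefl); have c's2 := c's s' (or_intror erefl).
  (* Six vertices of degree 3 require a fourth old vertex of degree 2, but [s] has only the
     neighbours [x], [x'], [x2]. *)
  have U6 : uniq [:: c; y1; y2; c'; s; s'] by neqs.
  have n6 : 6 <= num_on A h 3.
    by apply: (num_on_ge_pos e3 hs U6); rewrite //= dc dy1 dy2 dc' ds ds'.
  have [|x4 [dx4 ox4]] := @old_new [:: x; x'; x2].
    by change (6 < num_on A h 2); move: hb n6; rewrite /bal; clear; lia.
  rewrite !inE !negb_or => /and3P[/eqP x4x /eqP x4x' /eqP x4x2].
  have [x4s _] := both _ dx4 ox4; have sx4 : e s x4 = true by rewrite es; apply: he.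
  by case: (full s x4 (or_introl erefl) sx4).
have bs := core b w b' w' (or_introl (conj erefl (conj erefl (conj erefl erefl)))).
have bs' := core b' w' b w (or_intror (conj erefl (conj erefl (conj erefl erefl)))).
have bothb y : degree h y = 2 -> old y -> h y b = true /\ h y b' = true.
  move=> dy oy; have [ys ys'] := both y dy oy.
  by split; [case: bs => ->|case: bs' => ->].
have [xb xb'] := bothb x dx ox; have [x'b x'b'] := bothb x' dx' ox'.
have b_nbr y : e b y = true -> [\/ y = w, y = x | y = x'].
  move=> ry; have [->|/eqP yx] := eqVneq y w; first by constructor 1.
  have [->|/eqP yx'] := eqVneq y x; first by constructor 2.
  have [->|/eqP yx2] := eqVneq y x'; first by constructor 3.
  by case: (@cubic_four_nbrs _ _ _ e3 b w x x' y); [neqs|sat; assumption..].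
have b_nbr' y : e b' y = true -> [\/ y = w', y = x | y = x'].
  move=> ry; have [->|/eqP yx] := eqVneq y w'; first by constructor 1.
  have [->|/eqP yx'] := eqVneq y x; first by constructor 2.
  have [->|/eqP yx2] := eqVneq y x'; first by constructor 3.
  by case: (@cubic_four_nbrs _ _ _ e3 b' w' x x' y); [neqs|sat; assumption..].
have n3 : num_on A h 3 <= 3.
  rewrite leqNgt; apply/negP => /third_old[y [dy oy yx yx']]; have [yb _] := bothb y dy oy.
  have ey : e b y = true by rewrite es; apply: he.
  by case: (b_nbr y ey) => E; first by case: oy.
have only2 y : degree h y = 2 -> old y -> y = x \/ y = x'.
  move=> dy oy; have [yb _] := bothb y dy oy.
  have ey : e b y = true by rewrite es; apply: he.
  by case: (b_nbr y ey) => E; [case: oy|left|right].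
have only3 t : degree h t = 3 -> t = b \/ t = b'.
  move=> dt; have [->|/eqP tb] := eqVneq t b; first by left.
  have [->|/eqP tb'] := eqVneq t b'; first by right.
  have tA : t \in A by apply: contraT => /(degree_out e3 hs); rewrite dt.
  have [y1 [y2 [y3 [U _ _ _ E]]]] := cubic_nbrs e3 tA.
  have ts : t <> s /\ t <> s'.
    by case: (bs) (bs') => E1 [] E2; try (by case: bb'; rewrite E1 E2); rewrite -E1 -E2.
  have d3 y : y \in [:: y1; y2; y3] -> degree h y = 3.
    move=> yi; have ty : e t y = true by rewrite E.
    by case: ts => ts ts'; apply: (nbr3 t y dt ts ts' ty); apply: (nbr_old t).
  have U4 : uniq [:: t; y1; y2; y3].
    by rewrite cons_uniq U andbT -E ei.
  suff : 4 <= num_on A h 3 by rewrite leqNgt ltnS n3.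
  by apply: (num_on_ge_pos e3 hs U4); rewrite //= dt !d3 // !inE eqxx ?orbT.
have pair1 p q : h p q = true -> degree h p = 1 -> degree h q = 1.
  move=> pq dp; have qp : e q p = true by rewrite es; apply: he.
  case: (red_degree e3 hs pq) => // dq; first by case: (diamond_no_red12 pq dp dq).
  case: (only3 q dq) => E; subst q.
    by case: (b_nbr p qp) => E; subst p; clash.
  by case: (b_nbr' p qp) => E; subst p; clash.
have [_ [_ [k [_ _ [xk bk] _ _]]]] := degree2_nbrs e3 hs dx.
have ezb := hzb; case: (blue_degree e3 hs xk bk) => dk.
- have kz : z <> k by move=> E; subst k; case: (z_nbr xk).
  have [p [_ _ dp]] : exists x, [/\ x \in A, x \notin [::] & degree h x = 1].
    by apply: num_on_new; move: hb (num_on_total e3 hs) large; rewrite /bal /=; clear; lia.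
  have [q [_ [_ [pq _ _ _ _]]]] := degree1_nbrs e3 hs dp; have dq := pair1 _ _ pq dp.
  apply: unsolved; play e3 hs hb [:: z; v; x; k; p; q; w; b] [:: 0; 2; 2; 0; 1; 1; 2; 3]
    [:: (0, 1, true); (2, 3, true); (4, 5, false); (6, 7, false)].
- have [q [_ [_ [kq _ _ _ _]]]] := degree1_nbrs e3 hs dk; have dq := pair1 _ _ kq dk.
  (* The listed vertices end with degrees 3, 3, 2, 3, 0, 1, 2, 1, 1, 2: [k] passes from [q] to [x],
     and [b] loses both [x] and [w]. *)
  apply: unsolved; play e3 hs hb [:: z; v; w; w'; q; k; x; x'; b; b'] [:: 0; 2; 2; 2; 1; 1; 2; 2; 3; 3]
    [:: (0, 1, true); (0, 2, true); (0, 3, true); (4, 5, false); (5, 6, true); (6, 8, false);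
        (7, 9, false); (8, 2, false)].
- have ok : old k.
    have kx : e k x = true by rewrite es.
    split=> E; subst k.
    + by case: (v_nbr xk) => E; subst x; clash.
    + by case: (w_nbr xk) => E; subst x; clash.
    + by case: (w_nbr' xk) => E; subst x; clash.
  exact: (diamond_no_blue22 dx dk ox ok xk bk).
Qed.

End SuppressedDiamond.

(** * Exchanging the colours, and parity of the counts *)

Definition others (V : finType) (e h : rel V) : rel V := fun x y => e x y && ~~ h x y.

Section Complement.
Variables (V : finType) (A : {set V}) (e h : rel V).
Hypotheses (e3 : cubic_on A e) (hs : sub_rel e h).

Lemma others_sub : sub_rel e (others e h).
Proof.
case: e3 hs => es _ _ _ [hy _]; split=> [x y|x y /andP[]//].
by rewrite /others es hy.
Qed.

Lemma degree_others x : x \in A -> degree (others e h) x = 3 - degree h x.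
Proof.
case: e3 hs => _ _ _ d3 [_ he] /d3 <-.
rewrite /degree -(cardsID [set y | h x y] [set y | e x y]).
have -> : [set y | e x y] :&: [set y | h x y] = [set y | h x y].
  by apply/setP=> y; rewrite !inE; case hxy: (h x y); rewrite ?andbF // (he _ _ hxy).
rewrite addKn; apply: eq_card => y; rewrite !inE /others; exact: andbC.
Qed.

Lemma num_on_others k : k <= 3 -> num_on A (others e h) k = num_on A h (3 - k).
Proof.
move=> k3; apply: eq_card => x; rewrite !inE; case xA: (x \in A) => //=.
rewrite degree_others //; have := degree_le3 e3 hs xA.
by move: k3; case: (degree h x) k => [|[|[|[|?]]]] [|[|[|[|?]]]].
Qed.

(** The exchange reverses the sequence of the four counts, and balance is symmetric in them. *)
Lemma balanced_others : balanced_on A h -> balanced_on A (others e h).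
Proof. by rewrite /balanced_on !num_on_others // !subSS !subn0 /bal => *; do !split; lia. Qed.

End Complement.

(** Each edge is counted once upwards and once downwards in the order of [enum_rank]. *)
Lemma handshake (V : finType) (r : rel V) : symmetric r -> irreflexive r ->
  ~~ odd (\sum_x degree r x).
Proof.
move=> rs ri; pose lt (x y : V) := enum_rank x < enum_rank y.
have E : \sum_x degree r x = \sum_x \sum_(y | lt x y) r x y + \sum_x \sum_(y | lt y x) r x y.
  rewrite -big_split /=; apply: eq_bigr => x _.
  have -> : degree r x = \sum_y r x y.
    by rewrite /degree -sum1_card big_mkcond /=; apply: eq_bigr => y _; rewrite inE; case: (r x y).
  rewrite (bigID (lt x)) /=; congr (_ + _); rewrite [LHS]big_mkcond [RHS]big_mkcond /=.
  apply: eq_bigr => y _; rewrite /lt -leqNgt leq_eqVlt; case: ltnP => //= _; rewrite ?orbT //.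
  by case: eqP => //= /ord_inj/enum_rank_inj ->; rewrite ri.
have F : \sum_x \sum_(y | lt y x) r x y = \sum_x \sum_(y | lt x y) r x y.
  rewrite (exchange_big_dep predT) //=; apply: eq_bigr => x _; apply: eq_bigr => y _.
  by rewrite rs.
by rewrite E F addnn odd_double.
Qed.

Section Parity.
Variables (V : finType) (A : {set V}) (e h : rel V).
Hypotheses (e3 : cubic_on A e) (hs : sub_rel e h).

Lemma sum_degree : \sum_x degree h x = num_on A h 1 + 2 * num_on A h 2 + 3 * num_on A h 3.
Proof.
have -> : \sum_x degree h x = \sum_(x in A) degree h x.
  rewrite [RHS]big_mkcond /=; apply: eq_bigr => x _; case xA: (x \in A) => //.
  by apply: (degree_out e3 hs); rewrite xA.
have E (f : nat -> nat) : \sum_(x in A) f (degree h x) =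
    f 0 * num_on A h 0 + f 1 * num_on A h 1 + f 2 * num_on A h 2 + f 3 * num_on A h 3.
  rewrite (partition_big (fun x => inord (degree h x) : 'I_4) predT) //=.
  have E (k : 'I_4) : \sum_(i in A | inord (degree h i) == k) f (degree h i) = f k * num_on A h k.
    rewrite /num_on mulnC -sum_nat_const; apply: eq_big => x.
      rewrite inE; case xA: (x \in A) => //=; rewrite -val_eqE /= inordK //.
      by have := degree_le3 e3 hs xA.
    by case/andP=> xA /eqP <-; rewrite inordK //; have := degree_le3 e3 hs xA.
  by rewrite !big_ord_recl big_ord0 !E addn0 !addnA.
by rewrite (E id) mul0n mul1n.
Qed.

Lemma even_odd_degrees : ~~ odd (num_on A h 1 + num_on A h 3).
Proof.
have ri : irreflexive h.
  by move=> x; apply/negP => /(proj2 hs); case: e3 => _ ->.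
have := handshake (proj1 hs) ri; rewrite sum_degree; clear; lia.
Qed.

End Parity.

Lemma cubic_even (V : finType) (A : {set V}) (e : rel V) : cubic_on A e -> ~~ odd #|A|.
Proof.
move=> e3; have ss : sub_rel e e by split=> //; case: e3.
have := even_odd_degrees e3 ss; have := num_on_total e3 ss.
have d k : k < 3 -> num_on A e k = 0.
  move=> k3; apply: eq_card0 => x; rewrite !inE; case xA: (x \in A) => //=.
  by case: e3 => _ _ _ -> //; case: k k3 => [|[|[]]].
by rewrite (d 0) // (d 1) // (d 2) // => <-.
Qed.

(** The parities force [b = d] and [a = c]; the two new vertices go to whichever pair of classes is
    not the larger. *)
Lemma bal_step a b c d : bal a b c d -> ~~ odd (a + b + c + d) -> ~~ odd (b + d) ->
  bal a.+1 b c.+1 d \/ bal a b.+1 c d.+1.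
Proof.
move=> B o1 o2; have [E1 E2] : b = d /\ a = c by move: B o1 o2; rewrite /bal; clear; lia.
subst c d; case: (leqP a b) => ab; [left|right]; move: B ab; rewrite /bal; clear => *; do !split; lia.
Qed.

(** * Unordered pairs, and degrees as sums *)

Definition is_pair (V : finType) (p q x y : V) : bool := (x == p) && (y == q) || (x == q) && (y == p).

Section Pairs.
Variable V : finType.
Implicit Types p q x y : V.

Lemma is_pairC p q x y : is_pair p q x y = is_pair p q y x.
Proof. by rewrite /is_pair orbC; congr (_ || _); apply: andbC. Qed.

Lemma is_pairP p q x y : is_pair p q x y -> x = p /\ y = q \/ x = q /\ y = p.
Proof. by case/orP=> /andP[/eqP-> /eqP->]; [left|right]. Qed.

Lemma degree_sum (r : rel V) x : degree r x = \sum_y r x y.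
Proof.
by rewrite /degree -sum1_card big_mkcond /=; apply: eq_bigr => y _; rewrite inE; case: (r x y).
Qed.

Lemma sum_pick p (k : bool) : \sum_y ((y == p) && k) = k.
Proof. by rewrite (bigD1 p) //= eqxx big1 ?addn0 //= => y /negbTE->. Qed.

Lemma sum_pair p q x (k : bool) : p <> q ->
  \sum_y (is_pair p q x y && k) = ((x == p) || (x == q)) && k.
Proof.
move=> /eqP pq; have [->|xp] := eqVneq x p.
  by rewrite -[RHS](sum_pick q); apply: eq_bigr => y _; rewrite /is_pair eqxx (negbTE pq) /= orbF.
have [->|xq] := eqVneq x q.
  rewrite -[RHS](sum_pick p); apply: eq_bigr => y _.
  by rewrite /is_pair eqxx (eq_sym q) (negbTE pq).
by rewrite big1 // => y _; rewrite /is_pair (negbTE xp) (negbTE xq).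
Qed.

End Pairs.

(** * Suppressing an edge *)

Section SuppressEdge.
Variables (V : finType) (A : {set V}) (e : rel V) (u v a b c d : V).
Hypotheses (e3 : cubic_on A e).
Hypotheses (euv : e u v = true) (eua : e u a = true) (eub : e u b = true).
Hypotheses (evc : e v c = true) (evd : e v d = true).
Hypotheses (av : a <> v) (bv : b <> v) (cu : c <> u) (du : d <> u).
Hypotheses (ab : a <> b) (cd : c <> d) (ac : a <> c) (ad : a <> d) (bc : b <> c).
Hypotheses (eab : e a b = false) (ecd : e c d = false).

Let es : symmetric e. Proof. by case: e3. Qed.
Let ei : irreflexive e. Proof. by case: e3. Qed.
Let uv : u <> v. Proof. by move=> E; move: euv; rewrite E ei. Qed.

Definition edge_rest : {set V} := A :\ u :\ v.

(** The hypotheses admit [b = d]: the new edges may share an end. They are distinct and were not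
    edges of [e], so the graph remains simple and cubic. *)
Definition suppress_edge : rel V := fun x y =>
  [|| [&& x \in edge_rest, y \in edge_rest & e x y], is_pair a b x y | is_pair c d x y].

Definition restore_edge (r : rel V) : rel V := fun x y =>
  [|| [&& x \in edge_rest, y \in edge_rest, e x y & r x y],
      r a b && (is_pair u a x y || is_pair u b x y)
    | r c d && (is_pair v c x y || is_pair v d x y)].

Lemma edge_restP x : (x \in edge_rest) = [&& x != v, x != u & x \in A].
Proof. by rewrite !inE. Qed.

Let rest_nbr t s : e t s = true -> t = u \/ t = v -> s <> u -> s <> v -> s \in edge_rest.
Proof.
move=> ts _ su sv; rewrite edge_restP; apply/and3P; split; [exact/eqP..|].
by rewrite es in ts; apply: (cubic_mem e3 ts).
Qed.

Let au : a <> u. Proof. by move=> E; move: eua; rewrite E ei. Qed.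
Let bu : b <> u. Proof. by move=> E; move: eub; rewrite E ei. Qed.
Let cv : c <> v. Proof. by move=> E; move: evc; rewrite E ei. Qed.
Let dv : d <> v. Proof. by move=> E; move: evd; rewrite E ei. Qed.
Let ra : a \in edge_rest. Proof. exact: (rest_nbr eua (or_introl erefl)). Qed.
Let rb : b \in edge_rest. Proof. exact: (rest_nbr eub (or_introl erefl)). Qed.
Let rc : c \in edge_rest. Proof. exact: (rest_nbr evc (or_intror erefl)). Qed.
Let rd : d \in edge_rest. Proof. exact: (rest_nbr evd (or_intror erefl)). Qed.

Lemma suppress_edge_sym : symmetric suppress_edge.
Proof.
move=> x y; rewrite /suppress_edge (is_pairC a) (is_pairC c) es.
by case: (x \in _); case: (y \in _).
Qed.

Lemma suppress_edge_mem x y : suppress_edge x y -> x \in edge_rest.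
Proof. by case/or3P=> [/and3P[]//|/is_pairP[] []|/is_pairP[] []] -> //. Qed.

Lemma suppress_edge_irr : irreflexive suppress_edge.
Proof.
move=> x; apply/negP => /or3P[/and3P[_ _]|/is_pairP[] [E1 E2]|/is_pairP[] [E1 E2]].
- by rewrite ei.
- by apply: ab; rewrite -E1 -E2.
- by apply: ab; rewrite -E1 -E2.
- by apply: cd; rewrite -E1 -E2.
- by apply: cd; rewrite -E1 -E2.
Qed.

Section Restore.
Variable r : rel V.
Hypothesis hr : sub_rel suppress_edge r.

Lemma restore_edge_sym : symmetric (restore_edge r).
Proof.
move=> x y; rewrite /restore_edge es (proj1 hr) ![is_pair _ _ x y]is_pairC.
by case: (x \in _); case: (y \in _).
Qed.

Lemma restore_edge_sub : sub_rel e (restore_edge r).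
Proof.
split=> [|x y]; first exact: restore_edge_sym.
case/or3P=> [/and4P[]//|/andP[_ /orP[]]|/andP[_ /orP[]]] /is_pairP[] [-> ->] //; by rewrite es.
Qed.

(** At an end of a new edge, the neighbour across it is exchanged for [u] or [v] without a change of
    colour. *)
Lemma restore_edge_degree x : x \in edge_rest -> degree (restore_edge r) x = degree r x.
Proof.
move=> xr; have := xr; rewrite edge_restP => /and3P[xv xu _].
(* The edges common to both graphs; by [eab] and [ecd] the new edges are not among them. *)
pose core y := [&& y \in edge_rest, e x y & r x y].
rewrite !degree_sum.
have E1 y : restore_edge r x y = core y + ((y == u) && (((x == a) || (x == b)) && r a b))
                                        + ((y == v) && (((x == c) || (x == d)) && r c d)) :> nat.
  rewrite /restore_edge /is_pair (negbTE xu) (negbTE xv) xr /= -/(core y) -!andb_orl.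
  have [->|yu] := eqVneq y u.
    rewrite /core edge_restP eqxx andbF /= (introF eqP uv) !andbF orbF addn0 andbT andbC.
    by [].
  have [->|yv] := eqVneq y v.
    by rewrite /core edge_restP eqxx /= !andbF !andbT /= andbC.
  by rewrite !andbF !orbF !addn0.
have E2 y : r x y = core y + (is_pair a b x y && r a b) + (is_pair c d x y && r c d) :> nat.
  have [p1|p1] := boolP (is_pair a b x y).
    have [-> ->] : is_pair c d x y = false /\ core y = false.
      case: (is_pairP p1) => -[xE yE]; rewrite /core xE yE /is_pair.
        by rewrite eab (introF eqP ac) (introF eqP ad) !andbF.
      by rewrite es eab (introF eqP bc) (introF eqP ac) !andbF.
    by case: (is_pairP p1) => -[-> ->]; rewrite ?addn0 // (proj1 hr).
  have [p2|p2] := boolP (is_pair c d x y).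
    have -> : core y = false.
      by case: (is_pairP p2) => -[xE yE]; rewrite /core xE yE 1?ecd 1?(es d) 1?ecd !andbF.
    by case: (is_pairP p2) => -[-> ->]; rewrite ?addn0 // (proj1 hr).
  rewrite /= !addn0 /core; case rxy: (r x y); rewrite ?andbF //.
  by have := proj2 hr _ _ rxy; rewrite /suppress_edge (negbTE p1) (negbTE p2) !orbF => /and3P[_ -> ->].
rewrite (eq_bigr _ (fun y _ => E1 y)) [RHS](eq_bigr _ (fun y _ => E2 y)) !big_split /=.
by rewrite !sum_pick !sum_pair.
Qed.

Lemma restore_edge_degree_u : degree (restore_edge r) u = 2 * r a b.
Proof.
rewrite degree_sum; have E y : restore_edge r u y = ((y == a) && r a b) + ((y == b) && r a b) :> nat.
  rewrite /restore_edge /is_pair edge_restP eqxx /= andbF /=.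
  rewrite !(introF eqP uv) !(eq_sym u) !(introF eqP au) !(introF eqP bu) (introF eqP cu) (introF eqP du) /=.
  rewrite !orbF andbF orbF.
  by have [->|_] := eqVneq y a; rewrite ?(introF eqP ab) /= ?addn0 andbC.
by rewrite (eq_bigr _ (fun y _ => E y)) big_split /= !sum_pick addnn -mul2n.
Qed.

Lemma restore_edge_degree_v : degree (restore_edge r) v = 2 * r c d.
Proof.
rewrite degree_sum; have E y : restore_edge r v y = ((y == c) && r c d) + ((y == d) && r c d) :> nat.
  rewrite /restore_edge /is_pair edge_restP eqxx /=.
  rewrite !(eq_sym v) !(introF eqP uv) !(introF eqP av) !(introF eqP bv) (introF eqP cv) (introF eqP dv) /=.
  rewrite !orbF andbF /=.
  by have [->|_] := eqVneq y c; rewrite ?(introF eqP cd) /= ?addn0 andbC.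
by rewrite (eq_bigr _ (fun y _ => E y)) big_split /= !sum_pick addnn -mul2n.
Qed.

Lemma restore_edge_uv : restore_edge r u v = false.
Proof.
apply/negP => /or3P[/and4P[]|/andP[_ /orP[]]|/andP[_ /orP[]]].
- by rewrite edge_restP eqxx andbF.
- by case/is_pairP=> -[E1 E2]; [case: av|case: au].
- by case/is_pairP=> -[E1 E2]; [case: bv|case: bu].
- by case/is_pairP=> -[E1 E2]; [case: uv|case: cu].
- by case/is_pairP=> -[E1 E2]; [case: uv|case: du].
Qed.

End Restore.

(** Restoring the all-red colouring of the smaller graph gives every edge of [e] except [u v], so
    [restore_edge_degree] transfers the degrees of [e]. *)
Lemma cubic_suppress_edge : cubic_on edge_rest suppress_edge.
Proof.
split; [exact: suppress_edge_sym|exact: suppress_edge_irr|exact: suppress_edge_mem|].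
move=> x xr; have ss : sub_rel suppress_edge suppress_edge by split; [exact: suppress_edge_sym|].
rewrite -(restore_edge_degree ss xr).
have := xr; rewrite edge_restP => /and3P[xv xu xA].
have [xv' xu'] : x <> v /\ x <> u by split; apply/eqP.
case: (e3) => _ _ _ /(_ x xA) <-; apply: eq_degree => y.
have sab : suppress_edge a b by rewrite /suppress_edge /is_pair !eqxx !orbT.
have scd : suppress_edge c d by rewrite /suppress_edge /is_pair !eqxx !orbT.
rewrite /restore_edge sab scd xr /= /is_pair (negbTE xu) (negbTE xv) /= -!andb_orl.
have [->|yu] := eqVneq y u.
  rewrite edge_restP eqxx andbF /= (introF eqP uv) !andbF orbF andbT.
  apply/idP/idP; first by case/orP=> /eqP->; rewrite es.
  rewrite es => ux; have ux' : e u x = true := ux.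
  by apply: contraT; rewrite negb_or => /andP[/eqP xa /eqP xb];
     case: (@cubic_four_nbrs _ _ _ e3 u v a b x); [neqs|sat; assumption..].
have [->|yv] := eqVneq y v.
  rewrite edge_restP eqxx /= !andbF /= andbT.
  apply/idP/idP; first by case/orP=> /eqP->; rewrite es.
  rewrite es => vx; have vx' : e v x = true := vx.
  by apply: contraT; rewrite negb_or => /andP[/eqP xc /eqP xd];
     case: (@cubic_four_nbrs _ _ _ e3 v u c d x); [neqs|sat; assumption..].
rewrite !andbF !orbF; case exy: (e x y); rewrite ?andbF //= edge_restP yu yv /=.
have yA : y \in A by apply: (cubic_mem e3 (y := x)); rewrite es.
by rewrite yA /suppress_edge xr edge_restP yu yv yA exy.
Qed.

Lemma solve_suppress_edge : 8 <= #|A| -> solvable edge_rest suppress_edge -> solvable A e.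
Proof.
move=> large [r0 hr0 bal0]; have cs := cubic_suppress_edge.
have [r [hr balr rab]] : exists r, [/\ sub_rel suppress_edge r, balanced_on edge_rest r & r a b = true].
  case rab: (r0 a b); first by exists r0.
  exists (others suppress_edge r0); split; [exact: (others_sub cs hr0)|exact: balanced_others|].
  by rewrite /others rab /suppress_edge /is_pair !eqxx !orbT.
have hs := restore_edge_sub hr; set h := restore_edge r in hs *.
have U : uniq [:: u; v] by rewrite /= inE (introF eqP uv).
have S : {subset [:: u; v] <= A}.
  by move=> x; rewrite !inE => /orP[] /eqP->; [exact: (cubic_mem e3 eua)|exact: (cubic_mem e3 evc)].
have N k : num_on A h k = num_on edge_rest r k + (degree h u == k) + (degree h v == k).
  rewrite (num_on_split h k U S) /= addn0 addnA; congr (_ + _ + _).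
  apply: eq_card => x; rewrite [in RHS]inE edge_restP !inE negb_or.
  case xA: (x \in A); rewrite ?andbF //= andbT.
  have [->|xv] := eqVneq x v; rewrite ?andbF //.
  have [->|xu] := eqVneq x u; rewrite ?andbF //= andbT.
  by rewrite /h restore_edge_degree // edge_restP xv xu.
have dhu : degree h u = 2 by rewrite /h restore_edge_degree_u rab.
have dhv := restore_edge_degree_v r.
have huv := restore_edge_uv r; rewrite -/h in dhv huv.
have balstep := bal_step balr.
rewrite (num_on_total cs hr) in balstep.
have {balstep} := balstep (cubic_even cs) (even_odd_degrees cs hr).
have [//|unsolved] := solvable_em A e.
case rcd: (r c d); rewrite rcd in dhv.
  have hua : h u a = true by rewrite /h /restore_edge rab /is_pair !eqxx /= orbT.
  have hub : h u b = true by rewrite /h /restore_edge rab /is_pair !eqxx /= !orbT.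
  have hvc : h v c = true by rewrite /h /restore_edge rcd /is_pair !eqxx /= !orbT.
  have hvd : h v d = true by rewrite /h /restore_edge rcd /is_pair !eqxx /= !orbT.
  have N' k : num_on A h k = num_on edge_rest r k + (2 == k) + (2 == k) by rewrite N dhu dhv.
  (* [T] names the two degrees that would keep the balance, while [u] and [v] both have degree 2. *)
  case=> T; exfalso.
    apply: (@lose_one_two V A e h u v a b c d) => //.
    by move: T; rewrite !N' /= !addn0 !addn1 /=.
  apply: (@gain_one_three V A e h u v a b c d) => //.
  by move: T; rewrite !N' /= !addn0 !addn1.
(* With [c d] blue, [u] and [v] have degrees 2 and 0, one of the two admissible pairs; making [u v]
   red gives the other, 3 and 1. *)
have N' k : num_on A h k = num_on edge_rest r k + (2 == k) + (0 == k) by rewrite N dhu dhv.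
case=> T.
  exists h => //; move: T; rewrite /balanced_on !N' /= !addn0 !addn1.
  by [].
case: unsolved; have T' : bal (num_on A h 0).-1 (num_on A h 1).+1 (num_on A h 2).-1 (num_on A h 3).+1.
  by move: T; rewrite !N' /= !addn0 !addn1.
have n0 : 0 < num_on A h 0 by rewrite N' addn1.
play e3 hs T' [:: u; v] [:: 2; 0] [:: (0, 1, true)].
Qed.

End SuppressEdge.

(** * Suppressing a diamond *)

Section SuppressDiamond.
Variables (V : finType) (A : {set V}) (e : rel V) (z v w w' b b' : V).
Hypotheses (e3 : cubic_on A e).
Hypotheses (ezv : e z v = true) (ezw : e z w = true) (ezw' : e z w' = true).
Hypotheses (evw : e v w = true) (evw' : e v w' = true).
Hypotheses (ewb : e w b = true) (ewb' : e w' b' = true).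
Hypotheses (ww' : w <> w') (bb' : b <> b').
Hypotheses (bz : b <> z) (bv : b <> v) (bz' : b' <> z) (bv' : b' <> v).
Hypotheses (eww' : e w w' = false) (ebb' : e b b' = false).

Let es : symmetric e. Proof. by case: e3. Qed.
Let ei : irreflexive e. Proof. by case: e3. Qed.

Definition diamond_rest : {set V} := A :\: [set z; v; w; w'].

Definition suppress_diamond : rel V := fun x y =>
  [&& x \in diamond_rest, y \in diamond_rest & e x y] || is_pair b b' x y.

Definition restore_diamond (r : rel V) : rel V := fun x y =>
  [|| [&& x \in diamond_rest, y \in diamond_rest, e x y & r x y],
      is_pair v w x y, is_pair v w' x y, is_pair w b x y | is_pair w' b' x y].

Lemma diamond_restP x :
  reflect ([/\ x <> z, x <> v, x <> w & x <> w'] /\ x \in A) (x \in diamond_rest).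
Proof.
rewrite !inE !negb_or; apply: (iffP andP) => [[/andP[/andP[/andP[/eqP ? /eqP ?] /eqP ?] /eqP ?] ?]|] //.
by case=> -[/eqP-> /eqP-> /eqP-> /eqP->].
Qed.

Let neq x y : e x y = true -> x <> y. Proof. by move=> xy E; move: xy; rewrite E ei. Qed.
Let zv := neq ezv. Let zw := neq ezw. Let zw' := neq ezw'.
Let vw := neq evw. Let vw' := neq evw'. Let wb := neq ewb. Let wb' := neq ewb'.
Let wb2 : w' <> b. Proof. by move=> E; move: ewb; rewrite -E eww'. Qed.
Let wb2' : w <> b'. Proof. by move=> E; move: ewb'; rewrite -E es eww'. Qed.

Let rb : b \in diamond_rest.
Proof.
apply/diamond_restP; split; last by move: ewb; rewrite es; apply: (cubic_mem e3).
by split=> //; apply: nesym.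
Qed.

Let rb' : b' \in diamond_rest.
Proof.
apply/diamond_restP; split; last by move: ewb'; rewrite es; apply: (cubic_mem e3).
by split=> //; apply: nesym.
Qed.

Lemma suppress_diamond_sym : symmetric suppress_diamond.
Proof.
move=> x y; rewrite /suppress_diamond (is_pairC b) es.
by case: (x \in _); case: (y \in _).
Qed.

Lemma suppress_diamond_mem x y : suppress_diamond x y -> x \in diamond_rest.
Proof. by case/orP=> [/and3P[]//|/is_pairP[] []] -> //. Qed.

Lemma suppress_diamond_irr : irreflexive suppress_diamond.
Proof.
move=> x; apply/negP => /orP[/and3P[_ _]|/is_pairP[] [E1 E2]]; first by rewrite ei.
  by apply: bb'; rewrite -E1 -E2.
by apply: bb'; rewrite -E1 -E2.
Qed.

Section Restore.
Variable r : rel V.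
Hypotheses (hr : sub_rel suppress_diamond r) (rbb' : r b b' = true).

Lemma restore_diamond_sub : sub_rel e (restore_diamond r).
Proof.
split=> [x y|x y].
  rewrite /restore_diamond es (proj1 hr) ![is_pair _ _ x y]is_pairC.
  by case: (x \in _); case: (y \in _).
by case/or4P=> [/and4P[]//|/is_pairP[] [-> ->]|/is_pairP[] [-> ->]|/orP[]/is_pairP[] [-> ->]] //;
   rewrite es.
Qed.

Lemma restore_diamond_degree x : x \in diamond_rest -> degree (restore_diamond r) x = degree r x.
Proof.
move=> xr; have [[/eqP xz /eqP xv /eqP xw /eqP xw'] _] := diamond_restP _ xr.
pose core y := [&& y \in diamond_rest, e x y & r x y].
rewrite !degree_sum.
have E1 y : restore_diamond r x y = core y + ((y == w) && (x == b)) + ((y == w') && (x == b')) :> nat.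
  rewrite /restore_diamond /is_pair (negbTE xv) (negbTE xw) (negbTE xw') xr /= -/(core y).
  have [->|yw] := eqVneq y w.
    have -> : core w = false by apply/negP => /andP[/diamond_restP[[]]].
    by rewrite (introF eqP ww') /= ?andbF ?andbT ?orbF ?addn0.
  have [->|yw'] := eqVneq y w'.
    have -> : core w' = false by apply/negP => /andP[/diamond_restP[[]]].
    by rewrite !andbF !andbT /=.
  by rewrite !andbF !orbF !addn0.
have E2 y : r x y = core y + (is_pair b b' x y && true) :> nat.
  rewrite andbT; have [p1|p1] := boolP (is_pair b b' x y).
    have -> : core y = false.
      by case: (is_pairP p1) => -[xE yE]; rewrite /core xE yE 1?ebb' 1?(es b') 1?ebb' !andbF.
    by case: (is_pairP p1) => -[-> ->]; rewrite ?rbb' // (proj1 hr) rbb'.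
  rewrite /= !addn0 /core; case rxy: (r x y); rewrite ?andbF //.
  by have := proj2 hr _ _ rxy; rewrite /suppress_diamond (negbTE p1) !orbF => /and3P[_ -> ->].
rewrite (eq_bigr _ (fun y _ => E1 y)) [RHS](eq_bigr _ (fun y _ => E2 y)) !big_split /=.
rewrite !sum_pick sum_pair // andbT -addnA; congr (_ + _).
by have [->|] := eqVneq x b; rewrite ?(introF eqP bb').
Qed.

Lemma restore_diamond_z : degree (restore_diamond r) z = 0.
Proof.
apply: eq_card0 => y; rewrite inE; apply/negP.
case/or4P=> [/and4P[/diamond_restP[[]]//]|/is_pairP[] [E1 E2]|/is_pairP[] [E1 E2]|/orP[]/is_pairP[] [E1 E2]];
  by [case: zv|case: zw|case: zw'|case: bz|case: bz'].
Qed.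

Lemma degree_pair x p q : p <> q -> (forall y, restore_diamond r x y -> y = p \/ y = q) ->
  restore_diamond r x p -> restore_diamond r x q -> degree (restore_diamond r) x = 2.
Proof.
move=> /eqP pq H xp xq; rewrite /degree -[2]/(1.+1) -[RHS](_ : #|[set p; q]| = 2); last by rewrite cards2 pq.
apply: eq_card => y; rewrite !inE; apply/idP/idP => [/H[] ->|/orP[] /eqP->] //; by rewrite eqxx ?orbT.
Qed.

Lemma restore_diamond_v : degree (restore_diamond r) v = 2.
Proof.
apply: (degree_pair ww'); try by rewrite /restore_diamond /is_pair !eqxx ?orbT.
move=> y /or4P[/and4P[/diamond_restP[[]]//]|/is_pairP[] [E1 E2]|/is_pairP[] [E1 E2]|/orP[]/is_pairP[] [E1 E2]];
  by [left|right|case: vw|case: vw'|case: bv|case: bv'].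
Qed.

Lemma restore_diamond_w : degree (restore_diamond r) w = 2.
Proof.
apply: (degree_pair bv); try by rewrite /restore_diamond /is_pair !eqxx ?orbT.
move=> y /or4P[/and4P[/diamond_restP[[]]//]|/is_pairP[] [E1 E2]|/is_pairP[] [E1 E2]|/orP[]/is_pairP[] [E1 E2]];
  by [left|right|case: vw|case: ww'|case: wb|case: wb2'].
Qed.

Lemma restore_diamond_w' : degree (restore_diamond r) w' = 2.
Proof.
apply: (degree_pair bv'); try by rewrite /restore_diamond /is_pair !eqxx ?orbT.
move=> y /or4P[/and4P[/diamond_restP[[]]//]|/is_pairP[] [E1 E2]|/is_pairP[] [E1 E2]|/orP[]/is_pairP[] [E1 E2]];
  by [left|right|case: vw'|case: ww'|case: wb2|case: wb'].
Qed.

End Restore.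

(** As for edges: restoring the all-red colouring gives exactly the edges of [e] at the remaining
    vertices. *)
Lemma cubic_suppress_diamond : cubic_on diamond_rest suppress_diamond.
Proof.
split; [exact: suppress_diamond_sym|exact: suppress_diamond_irr|exact: suppress_diamond_mem|].
move=> x xr; have ss : sub_rel suppress_diamond suppress_diamond by split; [exact: suppress_diamond_sym|].
have sb : suppress_diamond b b' by rewrite /suppress_diamond /is_pair !eqxx !orbT.
rewrite -(restore_diamond_degree ss sb xr).
have [[xz xv xw xw'] xA] := diamond_restP _ xr.
case: (e3) => _ _ _ /(_ x xA) <-; apply: eq_degree => y.
apply/idP/idP => [|xy]; first exact: (proj2 (restore_diamond_sub ss)).
have yx : e y x = true by rewrite es.
have [E|/eqP yz] := eqVneq y z.
  by subst y; case: (@cubic_four_nbrs _ _ _ e3 z v w w' x); [neqs|sat; assumption..].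
have [E|/eqP yv] := eqVneq y v.
  by subst y; case: (@cubic_four_nbrs _ _ _ e3 v z w w' x); [neqs|sat; assumption..].
have [E|/eqP yw] := eqVneq y w.
  subst y; have [->|/eqP xb] := eqVneq x b.
    by rewrite /restore_diamond /is_pair !eqxx !orbT.
  by case: (@cubic_four_nbrs _ _ _ e3 w z v b x); [neqs|sat; assumption..].
have [E|/eqP yw'] := eqVneq y w'.
  subst y; have [->|/eqP xb] := eqVneq x b'.
    by rewrite /restore_diamond /is_pair !eqxx !orbT.
  by case: (@cubic_four_nbrs _ _ _ e3 w' z v b' x); [neqs|sat; assumption..].
have yr : y \in diamond_rest by apply/diamond_restP; split; last exact: (cubic_mem e3 yx).
by rewrite /restore_diamond /suppress_diamond xr yr xy.
Qed.

Lemma solve_suppress_diamond : 8 <= #|A| -> solvable diamond_rest suppress_diamond -> solvable A e.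
Proof.
move=> large [r0 hr0 bal0]; have cs := cubic_suppress_diamond.
have [r [hr balr rb2]] : exists r, [/\ sub_rel suppress_diamond r, balanced_on diamond_rest r & r b b' = true].
  case rab: (r0 b b'); first by exists r0.
  exists (others suppress_diamond r0); split; [exact: (others_sub cs hr0)|exact: balanced_others|].
  by rewrite /others rab /suppress_diamond /is_pair !eqxx !orbT.
have hs := restore_diamond_sub hr; set h := restore_diamond r in hs *.
have U : uniq [:: z; v; w; w'] by neqs.
have S : {subset [:: z; v; w; w'] <= A}.
  by move=> x; rewrite !inE => /or4P[] /eqP->;
     [exact: (cubic_mem e3 ezv)|exact: (cubic_mem e3 evw)|exact: (cubic_mem e3 ewb)|exact: (cubic_mem e3 ewb')].
have dz : degree h z = 0 := restore_diamond_z r.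
have dv : degree h v = 2 := restore_diamond_v r.
have dw : degree h w = 2 := restore_diamond_w r.
have dw' : degree h w' = 2 := restore_diamond_w' r.
have N k : num_on A h k = num_on diamond_rest r k + ((0 == k) + 3 * (2 == k)).
  rewrite (num_on_split h k U S) /= dz dv dw dw' addn0; congr (_ + _); last by case: k => [|[|[|]]].
  apply: eq_card => x; rewrite [in RHS]inE [in LHS]inE !inE !negb_or andbC.
  have [->|xz] := eqVneq x z; rewrite ?andbF //.
  have [->|xv] := eqVneq x v; rewrite ?andbF //.
  have [->|xw] := eqVneq x w; rewrite ?andbF //.
  have [->|xw'] := eqVneq x w'; rewrite ?andbF //=.
  case xA: (x \in A); rewrite ?andbF //= andbT.
  have xr : x \in diamond_rest by apply/diamond_restP; split=> //; split; apply/eqP.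
  by rewrite /h restore_diamond_degree // ?andbT.
have hvw : h v w = true by rewrite /h /restore_diamond /is_pair !eqxx !orbT.
have hvw' : h v w' = true by rewrite /h /restore_diamond /is_pair !eqxx !orbT.
have hwb : h w b = true by rewrite /h /restore_diamond /is_pair !eqxx !orbT.
have hwb' : h w' b' = true by rewrite /h /restore_diamond /is_pair !eqxx !orbT.
have [//|unsolved] := solvable_em A e; exfalso.
apply: (@suppressed_diamond V A e h z v w w' b b') => //; last exact: (cubic_even e3).
(* Four new vertices of degrees 0, 1, 2, 3 would keep the balance. The diamond contributes 0, 2, 2,
   2, so two vertices of degree 2 are to be replaced by one of degree 1 and one of degree 3. *)
by move: balr; rewrite /balanced_on !N /= !addn0 !addn1 addn3 /=.
Qed.

End SuppressDiamond.

(** * Explicit colourings *)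

Section Explicit.
Variables (V : finType) (A : {set V}) (e : rel V).
Hypothesis e3 : cubic_on A e.

Let es : symmetric e. Proof. by case: e3. Qed.
Let ei : irreflexive e. Proof. by case: e3. Qed.

Definition no_edge : rel V := fun _ _ => false.

Lemma no_edge_sub : sub_rel e no_edge. Proof. by []. Qed.

Lemma degree_no_edge x : degree no_edge x = 0.
Proof. by apply: eq_card0 => y; rewrite inE. Qed.

(** Vertices outside [s] keep degree 0; the equation for [n0] adds them to the listed ones of degree
    0 without a subtraction. *)
Lemma solve_explicit x0 (s : seq V) (L : move) (m : seq nat) : uniq s ->
  wf_move (size s) L && covers (size s) L -> allowed e no_edge s x0 L ->
  map (fun k => count_mem k (new_degrees L (nseq (size s) 0))) (iota 0 4) = m ->
  (forall n0, n0 + size s = #|A| + nth 0 m 0 -> bal n0 (nth 0 m 1) (nth 0 m 2) (nth 0 m 3)) ->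
  solvable A e.
Proof.
move=> us wL aL <- /= hb.
apply: (solve_by_move e3 us no_edge_sub (ds := nseq (size s) 0) _ wL aL) => [|f hf].
  by elim: {us wL aL hb} s => //= x s ->; rewrite degree_no_edge.
have N k : num_on A no_edge k = if k is 0 then #|A| else 0.
  case: k => [|k]; first by apply: eq_card => x; rewrite !inE degree_no_edge andbT.
  by apply: eq_card0 => x; rewrite !inE degree_no_edge andbF.
have C k : count_mem k (nseq (size s) 0) = (k == 0) * size s.
  by rewrite count_nseq /= eq_sym.
have := hf 0; have := hf 1; have := hf 2; have := hf 3; rewrite !N !C /= !addn0 !add0n mul1n.
by move=> -> -> -> /hb.
Qed.

Ltac explicit cA s L m :=
  match s with ?x0 :: _ =>
  apply: (@solve_explicit x0 s L m);
  [ assumption | by []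
  | rewrite /=; repeat (split; [first [assumption | by rewrite es] | reflexivity | idtac]); exact I
  | by vm_compute
  | let n0 := fresh "n0" in move=> n0; rewrite cA /bal /=; clear; intros; repeat split; lia ] end.

(** A triangle with a pendant edge: counts 2, 1, 2, 1. *)
Lemma solve6 x y z p : #|A| = 6 -> uniq [:: x; y; z; p] ->
  e x y = true -> e y z = true -> e x z = true -> e x p = true -> solvable A e.
Proof.
move=> cA U xy yz xz xp; explicit cA [:: x; y; z; p] [:: (0,1,true); (1,2,true); (0,2,true); (0,3,true)] [:: 0; 1; 2; 1].
Qed.

(** A 4-cycle with pendant edges at two opposite vertices: counts 2, 2, 2, 2. *)
Lemma solve8 x y z w p q : #|A| = 8 -> uniq [:: x; y; z; w; p; q] ->
  e x y = true -> e y z = true -> e z w = true -> e w x = true -> e x p = true -> e z q = true ->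
  solvable A e.
Proof.
move=> cA U *; explicit cA [:: x; y; z; w; p; q]
  [:: (0,1,true); (1,2,true); (2,3,true); (3,0,true); (0,4,true); (2,5,true)] [:: 0; 2; 2; 2].
Qed.

(** The same with one pendant edge prolonged: counts 3, 2, 3, 2. *)
Lemma solve10 x y z w p q r : #|A| = 10 -> uniq [:: x; y; z; w; p; q; r] ->
  e x y = true -> e y z = true -> e z w = true -> e w x = true -> e x p = true -> e z q = true ->
  e p r = true -> solvable A e.
Proof.
move=> cA U *; explicit cA [:: x; y; z; w; p; q; r]
  [:: (0,1,true); (1,2,true); (2,3,true); (3,0,true); (0,4,true); (2,5,true); (4,6,true)] [:: 0; 2; 3; 2].
Qed.

Definition K4 (s : seq V) : Prop :=
  [/\ size s = 4, uniq s & {in s &, forall y z, y <> z -> e y z = true}].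

Lemma K4_list s : K4 s -> exists x a b c, [/\ s = [:: x; a; b; c], uniq [:: x; a; b; c],
  [/\ e x a = true, e x b = true & e x c = true] & [/\ e a b = true, e a c = true & e b c = true]].
Proof.
case: s => [|x [|a [|b [|c [|? ?]]]]] [] // _ U E; exists x, a, b, c.
move: (U); rewrite [X in is_true X -> _]/= !inE !negb_or andbT.
move=> /and3P[/and3P[/eqP ? /eqP ? /eqP ?] /andP[/eqP ? /eqP ?] /eqP ?].
by split; [|exact: U|split|split]; try apply: E; rewrite ?inE ?eqxx ?orbT.
Qed.

Lemma K4_sub s : K4 s -> {subset s <= A}.
Proof.
move/K4_list=> [x [a [b [c [-> _ [xa xb xc] _]]]]] y; rewrite !inE => /or4P[] /eqP->.
- exact: (cubic_mem e3 xa).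
- by move: xa; rewrite es; apply: (cubic_mem e3).
- by move: xb; rewrite es; apply: (cubic_mem e3).
- by move: xc; rewrite es; apply: (cubic_mem e3).
Qed.

(** The other three vertices of [s] already exhaust the degree of [y]. *)
Lemma K4_closed s y t : K4 s -> y \in s -> e y t = true -> t \in s.
Proof.
move=> Ks ys yt; have [s4 us E] := Ks; apply: contraT => ts.
have yt' : y <> t by move=> H; move: ts; rewrite -H ys.
have U : uniq (t :: rem y s) by rewrite /= rem_uniq // andbT mem_rem_uniq // inE negb_and ts orbT.
have S : size (rem y s) = 3 by rewrite size_rem // s4.
have I p : p \in rem y s -> e y p = true.
  by rewrite mem_rem_uniq // inE => /andP[/eqP py ps]; apply: E => // /esym.
case: (rem y s) U S I => [|p [|q [|r []]]] // U _ I.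
by case: (cubic_four_nbrs e3 U yt); apply: I; rewrite !inE eqxx ?orbT.
Qed.

Lemma K4_disjoint s s' x : K4 s -> K4 s' -> x \in s' -> x \notin s -> uniq (s ++ s').
Proof.
move=> Ks Ks' xs' xs; have [_ us _] := Ks; have [_ us' E'] := Ks'.
rewrite cat_uniq us us' andbT /=; apply/hasPn => y ys'; apply: contra xs => ys.
have [->//|/eqP xy] := eqVneq x y.
by apply: (K4_closed Ks ys); apply: E' => // /esym.
Qed.

(** A K_4 and two paths, on three and on four vertices: counts 3, 4, 3, 4. *)
Lemma solve14 s p0 p1 p2 q0 q1 q2 q3 : #|A| = 14 -> K4 s ->
  uniq (s ++ [:: p0; p1; p2; q0; q1; q2; q3]) ->
  e p0 p1 = true -> e p1 p2 = true -> e q0 q1 = true -> e q1 q2 = true -> e q2 q3 = true ->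
  solvable A e.
Proof.
move=> cA /K4_list[x [a [b [c [-> _ [? ? ?] [? ? ?]]]]]] U *; move: U; rewrite cat_cons !cat_cons cat0s => U.
explicit cA [:: x; a; b; c; p0; p1; p2; q0; q1; q2; q3]
  [:: (0,1,true); (0,2,true); (0,3,true); (1,2,true); (1,3,true); (2,3,true);
      (4,5,true); (5,6,true); (7,8,true); (8,9,true); (9,10,true)] [:: 0; 4; 3; 4].
Qed.

(** Two copies of K_4 minus an edge, a claw, and a path on three vertices: five vertices of each
    degree. The last vertex of [v] stays isolated and is dropped from the list. *)
Lemma solve20 s t u v : #|A| = 20 -> K4 s -> K4 t -> K4 u -> K4 v -> uniq (s ++ t ++ u ++ v) ->
  solvable A e.
Proof.
move=> cA /K4_list[x [a [b [c [-> _ [? ? ?] [? ? ?]]]]]].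
move=> /K4_list[x1 [a1 [b1 [c1 [-> _ [? ? ?] [? ? ?]]]]]].
move=> /K4_list[x2 [a2 [b2 [c2 [-> _ [? ? ?] [? ? ?]]]]]].
move=> /K4_list[x3 [a3 [b3 [c3 [-> _ [? ? ?] [? ? ?]]]]]].
move=> /(take_uniq 15) U.
explicit cA [:: x; a; b; c; x1; a1; b1; c1; x2; a2; b2; c2; x3; a3; b3]
  [:: (0,1,true); (0,2,true); (0,3,true); (1,2,true); (1,3,true);
      (4,5,true); (4,6,true); (4,7,true); (5,6,true); (5,7,true);
      (8,9,true); (8,10,true); (8,11,true); (12,13,true); (12,14,true)] [:: 0; 5; 5; 5].
Qed.

Lemma solve_two_K4 s t h : K4 s -> K4 t -> uniq (s ++ t) -> sub_rel e h ->
  {in s ++ t, forall x, degree h x = 0} -> balanced_on (A :\: [set x in s ++ t]) h -> solvable A e.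
Proof.
move=> Ks Kt U hs d0 B.
have S : {subset s ++ t <= A}.
  by move=> x; rewrite mem_cat => /orP[]; [exact: K4_sub Ks x|exact: K4_sub Kt x].
have N k : num_on A h k = num_on (A :\: [set x in s ++ t]) h k + (k == 0) * 8.
  rewrite (num_on_split h k U S); congr (_ + _).
    apply: eq_card => x; rewrite [LHS]inE [RHS]inE [in RHS]inE [in RHS]inE.
    by case: (x \in A); case: (_ == k); case: (_ \notin _).
  have [s4 _ _] := Ks; have [t4 _ _] := Kt.
  have -> : map (degree h) (s ++ t) = nseq 8 0.
    apply: (@eq_from_nth _ 0) => [|i]; first by rewrite size_map size_cat s4 t4.
    rewrite size_map => li; case/K4_list: Ks => x _; rewrite (nth_map x) // d0 ?mem_nth // nth_nseq.
    by case: ifP.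
  by rewrite count_nseq /= eq_sym.
have B' : bal (num_on A h 0 - 8) (num_on A h 1) (num_on A h 2) (num_on A h 3).
  by rewrite !N addnK !addn0.
(* This makes the truncated subtraction in [B'] exact. *)
have N8 : 8 <= num_on A h 0 by rewrite N leq_addl.
clear N B.
case/K4_list: Ks U d0 => x [a [b [c [-> _ [? ? ?] [? ? ?]]]]].
case/K4_list: Kt => x1 [a1 [b1 [c1 [-> _ [? ? ?] [? ? ?]]]]].
rewrite !cat_cons !cat0s => U d0.
have H0 p q : p \in [:: x; a; b; c; x1; a1; b1; c1] -> h p q = false by move=> /d0/degree0_blue.
have {}U := take_uniq 6 U.
apply: (@solve_by_move _ _ _ e3 x [:: x; a; b; c; x1; a1] (nseq 6 0)
  [:: (0,1,true); (0,2,true); (0,3,true); (1,2,true); (1,3,true); (4,5,true)] h U hs) => //.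
- by rewrite /= !d0 // !inE eqxx /= ?orbT.
- by rewrite /=; repeat (split; [assumption | by apply: H0; rewrite !inE eqxx /= ?orbT |]).
move=> f hf; move: B' N8 (hf 0) (hf 1) (hf 2) (hf 3).
rewrite /bal /=; clear; intros; repeat split; lia.
Qed.

End Explicit.

(** * Existence of a suppressible edge or diamond *)

Section Existence.
Variables (V : finType) (A : {set V}) (e : rel V).
Hypothesis e3 : cubic_on A e.

Let es : symmetric e. Proof. by case: e3. Qed.
Let ei : irreflexive e. Proof. by case: e3. Qed.

Lemma third_nbr x y z : e x y = true -> e x z = true -> y <> z ->
  exists w, [/\ w <> y, w <> z & e x w = true].
Proof.
move=> xy xz yz; have [p [q [pq [yp yq] xp xq H]]] := other_nbrs e3 xy.
case: (H z xz) => E; first by case: yz.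
  by exists q; split=> // [/esym//|]; rewrite E => /esym.
by exists p; split=> // [/esym//|]; rewrite E.
Qed.

Ltac four x y z w t := case: (@cubic_four_nbrs _ _ _ e3 x y z w t); [neqs|sat; assumption..].
Tactic Notation "non" constr(x) constr(y) constr(z) constr(w) constr(t) ident(H) :=
  let E := fresh in have H : e x t = false by [case E: (e x t) => //; exfalso; four x y z w t].

Hypothesis no_good_edge : forall u v a b c d,
  e u v = true -> e u a = true -> e u b = true -> e v c = true -> e v d = true ->
  a <> v -> b <> v -> c <> u -> d <> u -> a <> b -> c <> d -> a <> c -> a <> d -> b <> c ->
  e a b = false -> e c d = false -> False.

Hypothesis no_good_diamond : forall z v w w' b b',
  e z v = true -> e z w = true -> e z w' = true -> e v w = true -> e v w' = true ->
  e w b = true -> e w' b' = true -> w <> w' -> b <> b' ->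
  b <> z -> b <> v -> b' <> z -> b' <> v -> e w w' = false -> e b b' = false -> False.

(** As [no_good_edge] tolerates one common vertex in the position [b = d], only the coincidence of
    both pairs can block the edge. *)
Lemma forced_square u v a b c d :
  e u v = true -> e u a = true -> e u b = true -> e v c = true -> e v d = true ->
  a <> v -> b <> v -> c <> u -> d <> u -> a <> b -> c <> d -> e a b = false -> e c d = false ->
  a = c /\ b = d \/ a = d /\ b = c.
Proof.
move=> uv ua ub vc vd av bv cu du ab cd eab ecd.
have eba : e b a = false by rewrite es.
have edc : e d c = false by rewrite es.
have ba : b <> a by move/esym.
have dc : d <> c by move/esym.
have G := @no_good_edge u v.
have [ac|/eqP ac] := eqVneq a c.
  have [bd|/eqP bd] := eqVneq b d; first by left.
  by exfalso; subst c; apply: (G b a d a).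
have [ad|/eqP ad] := eqVneq a d.
  have [bc|/eqP bc] := eqVneq b c; first by right.
  by exfalso; subst d; apply: (G b a c a).
exfalso; have [bc|/eqP bc] := eqVneq b c; last exact: (G a b c d).
by subst c; apply: (G a b d b).
Qed.

Section Triangleless.
Variable t : V.
Hypothesis tA : t \in A.
Hypothesis T : forall x y, e t x = true -> e t y = true -> e x y = true -> False.

Let T' x y : e t x = true -> e x y = true -> e t y = false.
Proof. by move=> tx xy; case E: (e t y) => //; case: (T tx E xy). Qed.

(** No neighbour of [t] is adjacent to [v], so the edge [t v] can be blocked only if [c] and [d] are
    adjacent. The edge [v c] is then blocked only if the third neighbour [c'] of [c] is adjacent to
    [d]. *)
Lemma nbr_diamond v : e t v = true -> exists c d c',
  [/\ [/\ e v c = true, e v d = true & e c d = true], e c c' = true, e d c' = true,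
      [/\ c <> t, d <> t & c <> d] & [/\ c' <> v, c' <> c, c' <> d & c' <> t]].
Proof.
move=> tv; have vt : e v t = true by rewrite es.
have [a [b [ab [va vb] ta tb _]]] := other_nbrs e3 tv.
have [c [d [cd [tc td] vc vd _]]] := other_nbrs e3 vt.
have tc0 := T' tv vc; have td0 := T' tv vd.
have eab : e a b = false by case E: (e a b) => //; case: (T ta tb E).
have ecd : e c d = true.
  case E: (e c d) => //.
  case: (forced_square tv ta tb vc vd _ _ _ _ ab cd eab E); try by apply: nesym.
    by case=> E1 _; move: tc0; rewrite -E1 ta.
  by case=> E1 _; move: td0; rewrite -E1 ta.
have cv : e c v = true by rewrite es.
have vd' : v <> d by move=> E; move: vd; rewrite E ei.
have [c' [cv' cd' cc']] := third_nbr cv ecd vd'.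
have ct : c' <> t by move=> E; move: tc0; rewrite -E es cc'.
have dc' : e d c' = true.
  case E: (e d c') => //.
  case: (@forced_square v c t d d c') => //; try by apply: nesym.
  - by case=> /td.
  - by case=> /esym/ct.
exists c, d, c'; split=> //; split=> //; try by apply: nesym.
by move=> E; move: cc'; rewrite E ei.
Qed.

(** The diamond has the outer neighbours [t] and [b]. If they were different, they would be
    adjacent, as the diamond cannot be suppressed; then [nbr_diamond] at [b] gives [b] or [c'] a
    fourth neighbour. *)
Lemma nbr_closed_diamond v : e t v = true -> exists c d c',
  [/\ [/\ e v c = true, e v d = true & e c d = true], e c c' = true /\ e d c' = true,
      [/\ c <> t, d <> t & c <> d], [/\ c' <> v, c' <> c & c' <> d] & e t c' = true].
Proof.
move=> tv; have [c [d [c' [[vc vd cd] cc' dc' [ct dt cnd] [c'v c'c c'd c't]]]]] := nbr_diamond tv.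
exists c, d, c'; split=> //.
have c1 : e c' c = true by rewrite es.
have c2 : e c' d = true by rewrite es.
have [b [bc bd c'b]] := third_nbr c1 c2 cnd.
have tc0 := T' tv vc; have td0 := T' tv vd.
non v t c d c' vc'.
have [E|/eqP tb] := eqVneq t b; first by rewrite E es.
exfalso; case tb0: (e t b); last first.
  apply: (@no_good_diamond c d v c' t b) => //; first [by apply: nesym | by rewrite es].
have [c3 [d3 [_ [[bc3 bd3 cd3] _ _ [c3t d3t c3d3] _]]]] := nbr_diamond tb0.
have bv : b <> v by move=> E; move: vc'; rewrite -E es c'b.
non c v d c' b cb.
non d v c c' b db.
have [E|/eqP n3] := eqVneq c3 c'.
  subst c3; four c' c d b d3.
have [E|/eqP n4] := eqVneq d3 c'.
  subst d3; four c' c d b c3.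
four b t c3 d3 c'.
Qed.

(** The closed diamonds would pair off the neighbours of [t], but there are three. *)
Lemma triangleless_absurd : False.
Proof.
have [v [_ [_ [_ tv _ _ _]]]] := cubic_nbrs e3 tA.
have {}tv : e t v = true := tv.
have [c [d [c' [[vc vd cd] [cc' dc'] [ct dt cnd] [c'v c'c c'd] tc']]]] := nbr_closed_diamond tv.
have [s [sv sc ts]] := third_nbr tv tc' (nesym c'v).
have [c2 [d2 [s' [[sc2 sd2 cd2] [cs2 ds2] [c2t d2t cnd2] [s's _ _] ts']]]] := nbr_closed_diamond ts.
have tc0 := T' tv vc; have td0 := T' tv vd.
have [E|/eqP s'v] := eqVneq s' v.
  subst s'; have [E|/eqP n1] := eqVneq c2 c.
    subst c2; four c v d c' s.
  have [E|/eqP n2] := eqVneq c2 d.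
    subst c2; four d v c c' s.
  four v t c d c2.
have [E|/eqP s'c] := eqVneq s' c'.
  subst s'; have [E|/eqP n1] := eqVneq c2 c.
    subst c2; four c v d c' s.
  have [E|/eqP n2] := eqVneq c2 d.
    subst c2; four d v c c' s.
  four c' t c d c2.
four t v c' s s'.
Qed.

End Triangleless.

Hypothesis triangles : forall t, t \in A ->
  (forall x y, e t x = true -> e t y = true -> e x y = true -> False) -> False.

(** If the outer neighbours [b], [b'] coincide, that vertex lies in no triangle; if they are
    adjacent, [forced_square] fails at the edge [b b']; otherwise the diamond can be suppressed. *)
Lemma diamond_absurd z v w w' : e z v = true -> e z w = true -> e z w' = true ->
  e v w = true -> e v w' = true -> w <> w' -> e w w' = false -> False.
Proof.
move=> zv zw zw' vw vw' ww' eww'.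
have wz : e w z = true by rewrite es.
have wv : e w v = true by rewrite es.
have wz' : e w' z = true by rewrite es.
have wv' : e w' v = true by rewrite es.
have znv : z <> v by move=> E; move: zv; rewrite E ei.
have [b [bz bv wb]] := third_nbr wz wv znv.
have [b' [bz' bv' wb']] := third_nbr wz' wv' znv.
have bw : e b w = true by rewrite es.
have bw' : e b' w' = true by rewrite es.
have wnb : b <> w' by move=> E; move: eww'; rewrite -E wb.
have wnb' : b' <> w by move=> E; move: eww'; rewrite -E es wb'.
non z v w w' b zb. non v z w w' b vb. non z v w w' b' zb'. non v z w w' b' vb'.
have [E|/eqP bb'] := eqVneq b b'.
  subst b'; have [s [sw sw' bs]] := third_nbr bw bw' ww'.
  non w z v b s ws. non w' z v b s ws'.
  apply: (triangles (cubic_mem e3 bw)) => x y bx by_ xy.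
  have N p : e b p = true -> [\/ p = w, p = w' | p = s].
    move=> bp; have [->|/eqP p1] := eqVneq p w; first exact: Or31.
    have [->|/eqP p2] := eqVneq p w'; first exact: Or32.
    have [->|/eqP p3] := eqVneq p s; first exact: Or33.
    four b w w' s p.
  move: xy; case: (N x bx) => ->; case: (N y by_) => ->;
    rewrite ?ei ?eww' ?ws ?ws' ?(es w') ?eww' ?(es s) ?ws ?ws' //.
case ebb': (e b b'); last exact: (@no_good_diamond z v w w' b b').
have [s [sw sb bs]] := third_nbr bw ebb' (nesym wnb').
have eb'b : e b' b = true by rewrite es.
have [s' [sw' sb' bs']] := third_nbr bw' eb'b (nesym wnb).
non w z v b s ws. non w' z v b' s' ws'. non w z v b b' wb0.
case: (@forced_square b b' w s w' s') => //; try by apply: nesym.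
  by case.
by case=> E _; subst s'; move: wb0; rewrite es bs'.
Qed.

(** If [y] is adjacent to neither third neighbour, of [t] or of [x], then [forced_square] at the
    edge [t x] makes these equal. In every case two triangles share an edge, which gives a diamond
    or a K_4. *)
Lemma triangle_absurd t : t \in A -> (forall s, K4 e s -> t \in s -> False) -> False.
Proof.
move=> tA nK; apply: (triangles tA) => x y tx ty xy.
have xt : e x t = true by rewrite es.
have yt : e y t = true by rewrite es.
have yx : e y x = true by rewrite es.
have txn : t <> x by move=> E; move: tx; rewrite E ei.
have tyn : t <> y by move=> E; move: ty; rewrite E ei.
have xyn : x <> y by move=> E; move: xy; rewrite E ei.
have [t' [tx' ty' tt']] := third_nbr tx ty xyn.
have [x' [xt' xy' xx']] := third_nbr xt xy tyn.
have K p : p <> t -> p <> x -> p <> y -> e t p = true -> e x p = true -> e y p = true -> False.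
  move=> pt px py tp xp yp; apply: (nK [:: t; x; y; p]); last by rewrite inE eqxx.
  split=> //; first by neqs.
  by move=> r s; rewrite !inE => /or4P[] /eqP-> /or4P[] /eqP-> //; rewrite es.
have t't : t' <> t by move=> E; move: tt'; rewrite E ei.
have x'x : x' <> x by move=> E; move: xx'; rewrite E ei.
case yt0: (e y t'); last first.
  case yx0: (e y x'); last first.
    have t'y0 : e t' y = false by rewrite es.
    have x'y0 : e x' y = false by rewrite es.
    case: (@forced_square t x t' y x' y) => //; try by apply: nesym.
    - case=> E _; subst x'; apply: (@diamond_absurd t x y t') => //; by apply: nesym.
    - by case=> E.
  case tx0: (e t x'); first exact: (K x').
  by apply: (@diamond_absurd x y t x') => //; apply: nesym.
case xt0: (e x t'); first exact: (K t').
by apply: (@diamond_absurd t y x t') => //; apply: nesym.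
Qed.

End Existence.

(** * Induction *)

(* The third case says that the graph is 3K_4, since its components are then K_4's; in the
   second case a triangle-free cubic graph on six vertices is K_{3,3}. *)
Definition exceptional (V : finType) (A : {set V}) (e : rel V) : Prop :=
  [\/ #|A| = 4,
      #|A| = 6 /\ (forall x y z, e x y = true -> e y z = true -> e x z = true -> False) |
      #|A| = 12 /\ forall x, x \in A -> exists2 s, K4 e s & x \in s].

Lemma seq_fresh (T : eqType) (s l : seq T) : uniq s -> size l < size s ->
  exists2 x, x \in s & x \notin l.
Proof.
move=> us ls; apply/allPn; apply: contraL ls => /allP sl; rewrite -leqNgt.
exact: uniq_leq_size.
Qed.

Lemma set_fresh (T : finType) (A : {set T}) (l : seq T) : size l < #|A| ->
  exists2 x, x \in A & x \notin l.
Proof.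
by rewrite cardE => /(seq_fresh (enum_uniq _)) [x]; rewrite mem_enum; exists x.
Qed.

Lemma K4_mono (V : finType) (f e : rel V) s : K4 f s ->
  {in s, forall y z, f y z = true -> e y z = true} -> K4 e s.
Proof.
by case=> s4 us E fe; split=> // y z ys zs yz; apply: fe => //; apply: E.
Qed.

(** * Small cubic graphs *)

Section CubicFacts.
Variables (V : finType) (A : {set V}) (e : rel V).
Hypothesis e3 : cubic_on A e.

Lemma cubic_card_ge4 x : x \in A -> 4 <= #|A|.
Proof.
move=> xA; have [es ei _ _] := e3.
have [a [b [c [U xa xb xc _]]]] := cubic_nbrs e3 xA.
have U' : uniq [:: x; a; b; c].
  rewrite cons_uniq; apply/andP; split; last exact: U.
  rewrite !inE !negb_or.
  by apply/and3P; split; apply/eqP => E; [move: xa|move: xb|move: xc]; rewrite -E ei.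
rewrite -[4]/(size [:: x; a; b; c]) cardE; apply: uniq_leq_size => // y.
rewrite mem_enum !inE => /or4P[] /eqP-> //; [move: xa|move: xb|move: xc];
  rewrite es => H; exact: (cubic_mem e3 H).
Qed.

Lemma card4_K4 : #|A| = 4 -> K4 e (enum A).
Proof.
move=> A4; have [es ei _ _] := e3.
split; [by rewrite -cardE|exact: enum_uniq|move=> y z].
rewrite !mem_enum => yA zA yz.
have [a [b [c [U ya yb yc E]]]] := cubic_nbrs e3 yA.
rewrite E; apply: contraT => zN; have : 5 <= 4; last by [].
have U' : uniq [:: z; y; a; b; c].
  rewrite cons_uniq; apply/andP; split; last first.
    by rewrite cons_uniq; apply/andP; split; [rewrite -E ei|exact: U].
  by rewrite in_cons negb_or zN andbT; apply/eqP => /esym.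
rewrite -{2}A4 -[5]/(size [:: z; y; a; b; c]) cardE; apply: uniq_leq_size => // t.
rewrite mem_enum in_cons in_cons => /or3P[/eqP->|/eqP->|] //; rewrite -E es => ty.
exact: (cubic_mem e3 ty).
Qed.

(** Of the two neighbours of [b] other than [x], one is not [a]. *)
Lemma cubic_path x : x \in A -> exists q0 q1 q2 q3,
  [/\ uniq [:: q0; q1; q2; q3], e q0 q1 = true, e q1 q2 = true & e q2 q3 = true].
Proof.
move=> xA; have [es ei _ _] := e3.
have [a [b [c [U xa xb _ _]]]] := cubic_nbrs e3 xA.
have ax : e a x = true by rewrite es.
have bx : e b x = true by rewrite es.
have ab : a <> b by move: U; rewrite /= !inE negb_or => /andP[/andP[/eqP]].
have [y [z [yz [xy xz by_ bz _]]]] := other_nbrs e3 bx.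
have xa' : a <> x by move=> E; move: ax; rewrite E ei.
have xb' : b <> x by move=> E; move: bx; rewrite E ei.
have [E|/eqP ay] := eqVneq a y.
  exists a, x, b, z; split=> //; rewrite -E in yz *.
  have zb : b <> z by move=> H; move: bz; rewrite H ei.
  by neqs.
exists a, x, b, y; split=> //.
have yb : b <> y by move=> H; move: by_; rewrite H ei.
by neqs.
Qed.

(** The six named vertices exhaust [A]. Neither [b] nor [r] is adjacent to any of [b], [q], [r], so
    their two neighbours besides [a] are [p] and [p']. *)
Lemma triangle_free6 a b q r p p' : #|A| = 6 ->
  (forall x y z, e x y = true -> e y z = true -> e x z = true -> False) ->
  b <> q -> b <> r -> q <> r -> e a b = true -> e a q = true -> e a r = true ->
  p <> p' -> a <> p -> a <> p' -> e q p = true -> e q p' = true ->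
  [/\ uniq [:: a; b; q; r; p; p'], e r p = true & e b p = true].
Proof.
move=> A6 T bq br qr ab aq ar pp' ap ap' qp qp'; have [es ei _ _] := e3.
have T' x y z : e x y = true -> e y z = true -> e x z = false.
  by move=> xy yz; case E: (e x z) => //; case: (T x y z).
have qa : e q a = true by rewrite es.
have ra : e r a = true by rewrite es.
have ba : e b a = true by rewrite es.
have bq0 := T' _ _ _ ba aq; have br0 := T' _ _ _ ba ar; have qr0 := T' _ _ _ qa ar.
have U : uniq [:: a; b; q; r; p; p'] by neqs.
have sub : {subset [:: a; b; q; r; p; p'] <= enum A}.
  move=> y; rewrite mem_enum !inE => /or4P[/eqP->|/eqP->|/eqP->|/or3P[/eqP->|/eqP->|/eqP->]].
  - exact: (cubic_mem e3 ab).
  - exact: (cubic_mem e3 ba).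
  - exact: (cubic_mem e3 qa).
  - exact: (cubic_mem e3 ra).
  - by move: qp; rewrite es; apply: (cubic_mem e3).
  - by move: qp'; rewrite es; apply: (cubic_mem e3).
have [|_ E] := uniq_min_size U sub; first by rewrite -cardE A6.
have R x : e x a = true -> e x b = false -> e x q = false -> e x r = false -> e x p = true.
  move=> xa xb xq xr.
  have [y1 [y2 [y12 [ay1 ay2] xy1 xy2 _]]] := other_nbrs e3 xa.
  have M y : e x y = true -> a <> y -> y = p \/ y = p'.
    move=> xy ay; have yx : e y x = true by rewrite es.
    have := E y; rewrite mem_enum (cubic_mem e3 yx) !inE.
    case/or4P=> [/eqP F|/eqP F|/eqP F|/or3P[/eqP F|/eqP F|/eqP F]];
      [by case: ay|by rewrite F xb in xy|by rewrite F xq in xy|by rewrite F xr in xy|by left|by right].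
  case: (M y1 xy1 ay1) => E1; first by rewrite -E1.
  case: (M y2 xy2 ay2) => E2; first by rewrite -E2.
  by case: y12; rewrite E1 E2.
by split=> //; apply: R => //; rewrite es.
Qed.

End CubicFacts.

(** * The induction step, including exceptional smaller graphs *)

Section Step.
Variables (V : finType) (A : {set V}) (e : rel V).
Hypothesis e3 : cubic_on A e.
Hypothesis IH : forall (B : {set V}) (f : rel V), #|B| < #|A| -> cubic_on B f ->
  ~ exceptional B f -> solvable B f.
Hypothesis unsolved : ~ solvable A e.
Hypothesis ordinary : ~ exceptional A e.

Let es : symmetric e. Proof. by case: e3. Qed.
Let ei : irreflexive e. Proof. by case: e3. Qed.

(** If 4 vertices remain, the graph is the excluded 3K_4; if 6 or 12 remain in an exceptional graph,
    explicit colourings on 14 or 20 vertices apply. *)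
Lemma two_K4_absurd s t : K4 e s -> K4 e t -> uniq (s ++ t) -> False.
Proof.
move=> Ks Kt U; have [s4 us _] := Ks; have [t4 ut _] := Kt.
pose B := A :\: [set x in s ++ t]; pose f : rel V := fun x y => (x \in B) && e x y.
have BP x : (x \in B) = (x \notin s ++ t) && (x \in A) by rewrite !inE.
have S : {subset s ++ t <= A}.
  by move=> x; rewrite mem_cat => /orP[]; [exact: (K4_sub e3 Ks)|exact: (K4_sub e3 Kt)].
have fe x y : f x y = true -> e x y = true by case/andP.
have out x y : x \in B -> e x y = true -> y \in B.
  rewrite !BP => /andP[xs _] xy; have yx : e y x = true by rewrite es.
  rewrite (cubic_mem e3 yx) andbT; apply: contra xs; rewrite !mem_cat => /orP[] ys.
    by rewrite (K4_closed e3 Ks ys yx).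
  by rewrite (K4_closed e3 Kt ys yx) orbT.
have f3 : cubic_on B f.
  split=> [x y|x|x y /andP[]|x xB] //; last first.
  - have <- : degree e x = 3 by case: e3 => _ _ _; apply; move: xB; rewrite BP => /andP[].
    by apply: eq_degree => y; rewrite /f xB.
  - by rewrite /f ei andbF.
  rewrite /f (es y); case xy: (e x y); rewrite ?andbF // !andbT; apply/idP/idP => H.
    exact: (out _ _ H xy).
  by apply: (out _ _ H); rewrite es.
have cA : #|A| = #|B| + 8.
  rewrite -(cardsID [set x in s ++ t] A) addnC; congr (_ + _).
  rewrite -[8]/(4 + 4) -{1}s4 -t4 -size_cat -(card_uniqP U); apply: eq_card => x.
  rewrite !inE; case xs: (x \in s ++ t); rewrite ?andbF // andbT.
  exact: (S _ xs).
have notB x : x \in B -> x \notin s ++ t by rewrite BP => /andP[].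
apply: unsolved.
have [h hf hb] : solvable B f.
  apply: IH => //; first by rewrite cA; lia.
  case=> [B4|[B6 _]|[B12 HB]].
  - apply: ordinary; apply: Or33; split=> [|x xA]; first by rewrite cA B4.
    case xst: (x \in s ++ t).
      by move: xst; rewrite mem_cat => /orP[]; [exists s|exists t].
    exists (enum B); last by rewrite mem_enum BP xst.
    by apply: (K4_mono (card4_K4 f3 B4)) => y _ z; apply: fe.
  - have [x xB] : exists2 x, x \in B & x \notin [::] by apply: set_fresh; rewrite B6.
    move=> _; have [q0 [q1 [q2 [q3 [Uq q01 q12 q23]]]]] := cubic_path f3 xB.
    apply: unsolved; have [y [a [b [c [E _ [ya _ _] [ab _ _]]]]]] := K4_list Kt.
    apply: (@solve14 _ _ _ e3 s y a b q0 q1 q2 q3); rewrite ?cA ?B6 //; try exact: fe.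
    rewrite -[_ ++ _]/(s ++ [:: y; a; b] ++ [:: q0; q1; q2; q3]) catA cat_uniq Uq andbT.
    have sub : subseq (s ++ [:: y; a; b]) (s ++ t).
      by rewrite E; apply: cat_subseq; [exact: subseq_refl|exact: (prefix_subseq [:: y; a; b] [:: c])].
    rewrite (subseq_uniq sub U) andTb; apply/hasPn => q Q; apply/negP => /(mem_subseq sub).
    apply/negP; apply: notB.
    have {}Q : [|| q == q0, q == q1, q == q2 | q == q3] by move: Q; rewrite !inE.
    case/or4P: Q => /eqP->.
    + by case/andP: q01.
    + by case/andP: q12.
    + by case/andP: q23.
    + by apply: (out q2); [case/andP: q23|exact: fe].
  - have [x xB _] : exists2 x, x \in B & x \notin [::] by apply: set_fresh; rewrite B12.
    have [u Ku xu] := HB x xB; have [u4 uu _] := Ku.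
    have [y yB yu] : exists2 y, y \in B & y \notin u by apply: set_fresh; rewrite B12 u4.
    have [v Kv yv] := HB y yB.
    have Keu : K4 e u by apply: (K4_mono Ku) => p _ q; apply: fe.
    have Kev : K4 e v by apply: (K4_mono Kv) => p _ q; apply: fe.
    apply: unsolved; apply: (@solve20 _ _ _ e3 s t u v) => //; first by rewrite cA B12.
    rewrite catA cat_uniq U (K4_disjoint f3 Ku Kv yv yu) andbT /=.
    apply/hasPn => p; rewrite mem_cat => /orP[]; [move/(K4_sub f3 Ku)|move/(K4_sub f3 Kv)]; exact: notB.
have hsub : sub_rel e h by case: hf => hs hf; split=> // x y /hf/fe.
apply: (solve_two_K4 e3 Ks Kt U hsub) => // x xst.
apply: eq_card0 => y; rewrite inE; apply/negP => /(proj2 hf)/andP[/notB].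
by rewrite xst.
Qed.

(** When all new edges of a reduced 3K_4 lie in the copy [s], the other two copies are already
    present in [e]. *)
Lemma other_K4s_absurd (B : {set V}) (f : rel V) s : cubic_on B f -> #|B| = 12 ->
  (forall x, x \in B -> exists2 s, K4 f s & x \in s) -> K4 f s ->
  (forall y z, y \notin s -> z \notin s -> f y z = true -> e y z = true) -> False.
Proof.
move=> f3 B12 H Ks fe; have [s4 us _] := Ks.
have [x xB xs] : exists2 x, x \in B & x \notin s by apply: set_fresh; rewrite B12 s4.
have [t Kt xt] := H x xB; have [t4 ut _] := Kt.
have [y yB] : exists2 y, y \in B & y \notin s ++ t by apply: set_fresh; rewrite B12 size_cat s4 t4.
rewrite mem_cat negb_or => /andP[ys yt]; have [r Kr yr] := H y yB.
have K u p : K4 f u -> p \in u -> p \notin s -> K4 e u.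
  move=> Ku pu ps; have [u4 uu E] := Ku; split=> // q q' qu qu' qq'.
  have U := K4_disjoint f3 Ks Ku pu ps; move: U; rewrite cat_uniq => /and3P[_ /hasPn N _].
  by apply: fe; [exact: N|exact: N|exact: E].
exact: (two_K4_absurd (K t x Kt xt xs) (K r y Kr yr ys) (K4_disjoint f3 Kt Kr yr yt)).
Qed.

Hypothesis large : 8 <= #|A|.

Lemma good_edge_absurd u v a b c d :
  e u v = true -> e u a = true -> e u b = true -> e v c = true -> e v d = true ->
  a <> v -> b <> v -> c <> u -> d <> u -> a <> b -> c <> d -> a <> c -> a <> d -> b <> c ->
  e a b = false -> e c d = false -> False.
Proof.
move=> uv ua ub vc vd av bv cu du ab cd ac ad bc eab ecd; apply: unsolved.
set B := edge_rest A u v; set f := suppress_edge A e u v a b c d.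
have f3 : cubic_on B f by apply: cubic_suppress_edge.
have uvn : u <> v by move=> E; move: uv; rewrite E ei.
have BP x : (x \in B) = [&& x != v, x != u & x \in A] by apply: edge_restP.
have cA : #|A| = #|B|.+2.
  have uA := cubic_mem e3 uv; have vA : v \in A by apply: (cubic_mem e3 vc).
  by rewrite (cardsD1 u) uA (cardsD1 v) !inE vA eq_sym (introF eqP uvn) /= !add1n.
have fE x y : f x y = true -> is_pair a b x y || is_pair c d x y \/ e x y = true.
  by case/or3P=> [/and3P[_ _]|->|->]; [right|left|left; rewrite orbT].
have fab : f a b = true by rewrite /f /suppress_edge /is_pair !eqxx !orbT.
have fcd : f c d = true by rewrite /f /suppress_edge /is_pair !eqxx !orbT.
have fs : symmetric f by case: f3.
have fi : irreflexive f by case: f3.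
suff S : solvable B f by move: S; apply: solve_suppress_edge.
clearbody B f; apply: IH => //; first by rewrite cA.
case=> [B4|[B6 T]|[B12 H]]; first by move: large; rewrite cA B4.
- have [q [r [qr [bq br] aq ar _]]] := other_nbrs f3 fab.
  have qa : f q a = true by rewrite fs.
  have [p1 [p2 [p12 [ap1 ap2] qp1 qp2 _]]] := other_nbrs f3 qa.
  have p12' : f p1 p2 = false.
    by case E: (f p1 p2) => //; case: (T p1 q p2) => //; rewrite fs.
  (* The reduced graph is K_{3,3} and [p] is on the side of [a]. As [c] and [d] are adjacent, they
     are not both on that side, so [p] can avoid them. All edges at [p], and those at [a] other than
     [a b], then belong to [e]; they give the cycle [a q p r] with pendant edges [a u] and [p b]. *)
  have [p [qp ap pc pd]] : exists p, [/\ f q p = true, a <> p, p <> c & p <> d].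
    have [E1|/eqP n1] := eqVneq p1 c.
      have [E2|/eqP n2] := eqVneq p2 d; first by move: p12'; rewrite E1 E2 fcd.
      by exists p2; split=> // E; apply: p12; rewrite E1 E.
    have [E1|/eqP n2] := eqVneq p1 d; last by exists p1.
    have [E2|/eqP n3] := eqVneq p2 c; first by move: p12'; rewrite E1 E2 fs fcd.
    by exists p2; split=> // E; apply: p12; rewrite E1 E.
  have [p' [qp' ap' pp']] : exists p', [/\ f q p' = true, a <> p' & p <> p'].
    by have [->|/eqP n1] := eqVneq p p1; [exists p2|exists p1].
  have [U rp bp] := triangle_free6 f3 B6 T bq br qr fab aq ar pp' ap ap' qp qp'.
  have pb : p <> b by move=> E; move: bp; rewrite E fi.
  have fe x y : x = a \/ x = p -> y <> b \/ x = p -> f x y = true -> e x y = true.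
    move=> X Y /fE[]// /orP[]/is_pairP[][E1 E2]; subst x y.
    - by case: Y => // E; case: ap.
    - by case: X => E; [case: ab|case: pb].
    - by case: X => E; [case: ac|case: pc].
    - by case: X => E; [case: ad|case: pd].
  have aq' : e a q = true by apply: fe => //; left=> // /esym.
  have ar' : e a r = true by apply: fe => //; left=> // /esym.
  have pq' : e p q = true by apply: fe; [right|right|rewrite fs].
  have pr' : e p r = true by apply: fe; [right|right|rewrite fs].
  have pb' : e p b = true by apply: fe; [right|right|rewrite fs].
  have nu x : x \in B -> x <> u by rewrite BP => /and3P[_ /eqP].
  have U' : uniq [:: a; q; p; r; u; b].
    have nua := nu a (cubic_mem f3 fab); have nuq := nu q (cubic_mem f3 qa).
    have nub : b <> u by apply: nu; move: fab; rewrite fs; apply: (cubic_mem f3).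
    have nup : p <> u by apply: nu; move: qp; rewrite fs; apply: (cubic_mem f3).
    have nur : r <> u by apply: nu; move: ar; rewrite fs; apply: (cubic_mem f3).
    by clear eab ecd pb' pq' pr' aq' ar'; neqs.
  apply: unsolved; apply: (@solve8 _ _ _ e3 a q p r u b) => //; rewrite ?cA ?B6 // es //.
have [s Ks sa] := H a (cubic_mem f3 fab); have [s4 us Es] := Ks.
have sb := K4_closed f3 Ks sa fab.
case cs: (c \in s).
  have ds := K4_closed f3 Ks cs fcd.
  apply: (other_K4s_absurd f3 B12 H Ks) => y z ys zs /fE[]// /orP[]/is_pairP[][E1 E2]; subst y z;
    by rewrite ?sa ?sb ?cs ?ds in ys zs.
have [s' Ks' s'c] := H c (cubic_mem f3 fcd); have [s'4 us' Es'] := Ks'.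
have s'd := K4_closed f3 Ks' s'c fcd.
have U1 := K4_disjoint f3 Ks Ks' s'c (negbT cs).
have [x xB] : exists2 x, x \in B & x \notin s ++ s' by apply: set_fresh; rewrite B12 size_cat s4 s'4.
rewrite mem_cat negb_or => /andP[xs xs'].
have [t Kt xt] := H x xB.
have U2 := K4_disjoint f3 Ks Kt xt xs; have U3 := K4_disjoint f3 Ks' Kt xt xs'.
move: U1 U2 U3; rewrite !cat_uniq us us' /= => /andP[/hasPn N1 _] /andP[/hasPn N2 ut] /andP[/hasPn N3 _].
have Ket : K4 e t.
  apply: (K4_mono Kt) => y yt z /fE[]// /orP[]/is_pairP[][E1 E2]; subst y z.
  - by move: (N2 _ yt); rewrite /= sa.
  - by move: (N2 _ yt); rewrite /= sb.
  - by move: (N3 _ yt); rewrite /= s'c.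
  - by move: (N3 _ yt); rewrite /= s'd.
have [p ps] : exists2 p, p \in s & p \notin [:: a; b] by apply: seq_fresh; rewrite ?s4.
rewrite !inE negb_or => /andP[/eqP pa /eqP pb].
have [r rs'] : exists2 r, r \in s' & r \notin [:: c; d] by apply: seq_fresh; rewrite ?s'4.
rewrite !inE negb_or => /andP[/eqP rc /eqP rd].
have sp (l1 l2 : seq V) : uniq l2 -> (forall y, y \in l2 -> y \notin l1) -> uniq l1 -> uniq (l1 ++ l2).
  by move=> u2 H1 u1; rewrite cat_uniq u1 u2 andbT; apply/hasPn.
have fap : f a p = true by apply: Es => // /esym.
have fbp : f b p = true by apply: Es => // /esym.
have fcr : f c r = true by apply: Es' => // /esym.
have fdr : f d r = true by apply: Es' => // /esym.
have NP y z : z \in s -> z <> a -> z <> b -> f y z = true -> e y z = true.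
  move=> zs za zb /fE[]// /orP[]/is_pairP[][E1 E2]; subst y z => //.
    by move: (N1 _ s'd); rewrite /= zs.
  by move: (N1 _ s'c); rewrite /= zs.
have NR y z : z \in s' -> z <> c -> z <> d -> f y z = true -> e y z = true.
  move=> zs zc zd /fE[]// /orP[]/is_pairP[][E1 E2]; subst y z => //.
    by move: (N1 _ zs); rewrite /= sb.
  by move: (N1 _ zs); rewrite /= sa.
(* The paths [a p b] in [s] and [c r d t'] in [s'] avoid the new edges; the third copy [t] is
   intact. *)
have [t' ts'] : exists2 t', t' \in s' & t' \notin [:: c; d; r] by apply: seq_fresh; rewrite ?s'4.
rewrite !inE !negb_or => /and3P[/eqP tc /eqP td /eqP tr].
have fdt : f d t' = true by apply: Es' => // /esym.
apply: unsolved; apply: (@solve14 _ _ _ e3 t a p b c r d t') => //; rewrite ?cA ?B12 //.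
- have La y : y \in [:: a; p; b] -> y \in s by rewrite !inE => /or3P[] /eqP->.
  have Lc y : y \in [:: c; r; d; t'] -> y \in s' by rewrite !inE => /or4P[] /eqP->.
  rewrite -[[:: a, p, b & _]]/([:: a; p; b] ++ [:: c; r; d; t']) catA.
  apply: (sp _ _) => //.
  + have rt : r <> t' by move/esym.
    by rewrite /= !inE !negb_or !andbT; repeat (apply/andP; split); apply/eqP => // /esym.
  + move=> y /Lc ys'; rewrite mem_cat negb_or; apply/andP; split.
      by apply/negP => /N3; rewrite /= ys'.
    by apply/negP => /La; apply/negP; apply: N1.
  + apply: (sp _ _) => //.
      by rewrite /= !inE !negb_or !andbT; repeat (apply/andP; split); apply/eqP => // /esym.
    by move=> y /La ys; apply/negP => /N2; rewrite /= ys.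
- exact: NP.
- by rewrite es; apply: NP.
- exact: NR.
- by rewrite es; apply: NR.
- exact: NR.
Qed.

(** Exceptional reductions to 4 or 6 vertices come from 8 or 10, where the cycle [w z w' v] and
    edges leaving it are coloured explicitly. In a reduced 3K_4 the single new edge affects one copy
    only. *)
Lemma good_diamond_absurd z v w w' b b' :
  e z v = true -> e z w = true -> e z w' = true -> e v w = true -> e v w' = true ->
  e w b = true -> e w' b' = true -> w <> w' -> b <> b' ->
  b <> z -> b <> v -> b' <> z -> b' <> v -> e w w' = false -> e b b' = false -> False.
Proof.
move=> zv zw zw' vw vw' wb wb' ww' bb' bz bv bz' bv' eww' ebb'; apply: unsolved.
have bw : e b w = true by rewrite es.
have bw' : e b' w' = true by rewrite es.
have wnb : b <> w' by move=> E; move: eww'; rewrite -E wb.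
have wnb' : b' <> w by move=> E; move: eww'; rewrite -E es wb'.
have zb : e z b = false.
  case E: (e z b) => //; case: (@cubic_four_nbrs _ _ _ e3 z v w w' b); [neqs|sat; assumption..].
have vb : e v b = false.
  case E: (e v b) => //; case: (@cubic_four_nbrs _ _ _ e3 v z w w' b); [neqs|sat; assumption..].
have wb0 : e w' b = false.
  case E: (e w' b) => //; case: (@cubic_four_nbrs _ _ _ e3 w' z v b' b); [neqs|sat; assumption..].
have [A8|/eqP n8] := eqVneq #|A| 8.
  by apply: (@solve8 _ _ _ e3 w z w' v b b') => //; first [by neqs | by rewrite es].
have [A10|/eqP n10] := eqVneq #|A| 10.
  have [r [_ [_ [rw _] br _ _]]] := other_nbrs e3 bw.
  by apply: (@solve10 _ _ _ e3 w z w' v b b' r) => //; first [by neqs | by rewrite es].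
set B := diamond_rest A z v w w'; set f := suppress_diamond A e z v w w' b b'.
have f3 : cubic_on B f by apply: cubic_suppress_diamond.
have fbb : f b b' = true by rewrite /f /suppress_diamond /is_pair !eqxx !orbT.
have fE x y : f x y = true -> is_pair b b' x y \/ e x y = true.
  by case/orP=> [/and3P[_ _]|->]; [right|left].
have cA : #|A| = #|B| + 4.
  have U : uniq [:: z; v; w; w'] by neqs.
  rewrite -(cardsID [set z; v; w; w'] A) addnC; congr (_ + _).
  rewrite -[4]/(size [:: z; v; w; w']) -(card_uniqP U); apply: eq_card => x.
  rewrite !inE -!orbA; case X: [|| _, _, _ | _]; rewrite ?andbF // andbT.
  by case/or4P: X => /eqP->;
     [exact: (cubic_mem e3 zv)|exact: (cubic_mem e3 vw)|exact: (cubic_mem e3 wb)|exact: (cubic_mem e3 wb')].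
suff S : solvable B f by move: S; apply: solve_suppress_diamond.
clearbody B f; apply: IH => //; first by rewrite cA -[X in X < _]addn0 ltn_add2l.
case=> [B4|[B6 _]|[B12 H]]; [by rewrite cA B4 in n8|by rewrite cA B6 in n10|].
have [s Ks sb] := H b (cubic_mem f3 fbb); have sb' := K4_closed f3 Ks sb fbb.
apply: (other_K4s_absurd f3 B12 H Ks) => x y xs ys /fE[]// /is_pairP[][E1 E2]; subst x y;
  by rewrite ?sb ?sb' in xs ys.
Qed.

End Step.

Theorem solvable_of_ordinary (V : finType) (A : {set V}) (e : rel V) :
  cubic_on A e -> ~ exceptional A e -> solvable A e.
Proof.
have [n] := ubnP #|A|; elim: n A e => // n IHn A e ltA e3 ordinary.
have IH (B : {set V}) (f : rel V) : #|B| < #|A| -> cubic_on B f -> ~ exceptional B f -> solvable B f.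
  by move=> ltB; apply: IHn; apply: (leq_trans ltB).
have [//|unsolved] := solvable_em A e; exfalso.
have [A0|/card_gt0P[x0 xA]] := posnP #|A|.
  apply: unsolved; exists (@no_edge V); first exact: no_edge_sub.
  have N k : num_on A (@no_edge V) k = 0.
    by apply/eqP; rewrite -leqn0 -A0; apply/subset_leq_card/subsetP => x; rewrite inE => /andP[].
  by rewrite /balanced_on !N.
have := cubic_card_ge4 e3 xA; have := cubic_even e3.
have [es ei _ _] := e3.
have A4 : #|A| <> 4 by move=> E; apply: ordinary; apply: Or31.
have A6 : #|A| <> 6.
  move=> E; apply: ordinary; apply: Or32; split=> // x y z xy yz xz; apply: unsolved.
  have yzn : y <> z by move=> H; move: yz; rewrite H ei.
  have [p [py pz xp]] := third_nbr e3 xy xz yzn.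
  by apply: (@solve6 _ _ _ e3 x y z p) => //; neqs.
move=> ev ge4; have large : 8 <= #|A|.
  by case: #|A| A4 A6 ev ge4 => [|[|[|[|[|[|[|[|]]]]]]]].
have edge := good_edge_absurd e3 IH unsolved ordinary large.
have diamond := good_diamond_absurd e3 IH unsolved ordinary large.
(* A double negation is enough, since the goal is [False]. *)
have K t : t \in A -> ~ ~ exists2 s, K4 e s & t \in s.
  move=> tA nK; apply: (triangle_absurd e3 edge diamond _ tA) => [u uA|s Ks ts]; last by apply: nK; exists s.
  exact: (triangleless_absurd e3 edge diamond uA).
apply: (K _ xA) => -[s Ks xs]; have [s4 _ _] := Ks.
have [y yA ys] : exists2 y, y \in A & y \notin s by apply: set_fresh; rewrite s4 (leq_trans _ large).
apply: (K _ yA) => -[t Kt yt].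
exact: (two_K4_absurd e3 IH unsolved ordinary Ks Kt (K4_disjoint e3 Ks Kt yt ys)).
Qed.

(** * Recognising the three excluded graphs *)

Section Isomorphisms.
Variables (V : finType) (e : rel V).
Hypothesis e3 : cubic_on [set: V] e.

Let es : symmetric e. Proof. by case: e3. Qed.
Let ei : irreflexive e. Proof. by case: e3. Qed.

Lemma isomorphic_of_inj (W : finType) (f : rel W) (psi : W -> V) :
  injective psi -> #|V| <= #|W| -> (forall i j, e (psi i) (psi j) = f i j) -> isomorphic e f.
Proof.
move=> inj card H; have [phi K1 K2] := inj_card_bij inj card.
exists phi; first by exists psi.
by move=> x y; rewrite -H !K2.
Qed.

Lemma K4_isomorphic : #|V| = 4 -> isomorphic e (complete_graph 4).
Proof.
move=> V4; have K : K4 e (enum [set: V]) by apply: (card4_K4 e3); rewrite cardsT.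
have [s4 U E] := K; have [x0 _] : exists2 x, x \in [set: V] & x \notin [::].
  by apply: set_fresh; rewrite cardsT V4.
move=> _; pose psi (i : 'I_4) := nth x0 (enum [set: V]) i.
have inj : injective psi.
  by move=> i j /eqP; rewrite nth_uniq ?s4 // => /eqP/val_inj.
apply: (isomorphic_of_inj inj) => [|i j]; first by rewrite V4 card_ord.
rewrite /complete_graph; have [->|/eqP ij] := eqVneq i j; first exact: ei.
by apply: E; rewrite ?mem_nth ?s4 // => /inj.
Qed.

Lemma K33_isomorphic : #|V| = 6 ->
  (forall x y z, e x y = true -> e y z = true -> e x z = true -> False) ->
  isomorphic e (complete_bipartite 3 3).
Proof.
move=> V6 T; have A6 : #|[set: V]| = 6 by rewrite cardsT.
have [x xA _] : exists2 x, x \in [set: V] & x \notin [::] by apply: set_fresh; rewrite A6.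
have [a [b [c [U xa xb xc _]]]] := cubic_nbrs e3 xA.
have [ab ac bc] : [/\ a <> b, a <> c & b <> c].
  by move: U; rewrite /= !inE negb_or andbT => /andP[/andP[/eqP ? /eqP ?] /eqP ?].
have xa' : e x a = true := xa. have xb' : e x b = true := xb. have xc' : e x c = true := xc.
have ax : e a x = true by rewrite es.
have [y [z [yz [xy xz] ay az _]]] := other_nbrs e3 ax.
have [U1 cy by_] := triangle_free6 e3 A6 T (nesym ab) bc ac xb xa xc yz xy xz ay az.
(* The same lemma with [y] and [z] exchanged yields the edges at [z]. *)
have [_ cz bz] := triangle_free6 e3 A6 T (nesym ab) bc ac xb xa xc (nesym yz) xz xy az ay.
pose psi (i : 'I_3 + 'I_3) :=
  match i with inl i => nth x [:: x; y; z] i | inr j => nth x [:: a; b; c] j end.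
have edge (i j : 'I_3) : e (psi (inl i)) (psi (inr j)) = true.
  by case: i j => [[|[|[|]]] // ?] [[|[|[|]]] // ?]; rewrite /psi /= // es.
have edge' (i j : 'I_3) : e (psi (inr i)) (psi (inl j)) = true by rewrite es edge.
have left0 (i j : 'I_3) : e (psi (inl i)) (psi (inl j)) = false.
  case E: (e _ _) => //; case: (T (psi (inr ord0)) (psi (inl i)) (psi (inl j))) => //.
have right0 (i j : 'I_3) : e (psi (inr i)) (psi (inr j)) = false.
  case E: (e _ _) => //; case: (T (psi (inl ord0)) (psi (inr i)) (psi (inr j))) => //.
have Ul : uniq [:: x; y; z] by neqs.
have inj : injective psi.
  move=> [i|i] [j|j].
  - by move/eqP; rewrite /psi nth_uniq // => /eqP/val_inj->.
  - by move=> H; move: (edge i j); rewrite H ei.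
  - by move=> H; move: (edge' i j); rewrite H ei.
  - by move/eqP; rewrite /psi nth_uniq // => /eqP/val_inj->.
apply: (isomorphic_of_inj inj) => [|[i|i] [j|j]]; rewrite ?left0 ?right0 ?edge ?edge' //.
by rewrite V6 card_sum card_ord.
Qed.

Lemma copies_K4_isomorphic : #|V| = 12 ->
  (forall x, x \in [set: V] -> exists2 s, K4 e s & x \in s) ->
  isomorphic e (copies 3 (complete_graph 4)).
Proof.
move=> V12 H; have A12 : #|[set: V]| = 12 by rewrite cardsT.
have [x xA _] : exists2 x, x \in [set: V] & x \notin [::] by apply: set_fresh; rewrite A12.
have [s Ks xs] := H x xA; have [s4 _ _] := Ks.
have [y yA ys] : exists2 y, y \in [set: V] & y \notin s by apply: set_fresh; rewrite A12 s4.
have [t Kt yt] := H y yA; have [t4 _ _] := Kt.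
have [z zA] : exists2 z, z \in [set: V] & z \notin s ++ t.
  by apply: set_fresh; rewrite A12 size_cat s4 t4.
rewrite mem_cat negb_or => /andP[zs zt]; have [u Ku zu] := H z zA.
pose S (i : 'I_3) := nth [::] [:: s; t; u] i.
have KS i : K4 e (S i) by case: i => [[|[|[|]]] // ?].
have D (i j : 'I_3) p : p \in S i -> p \in S j -> i = j.
  have N l1 l2 q : K4 e l1 -> K4 e l2 -> q \in l2 -> q \notin l1 -> p \in l1 -> p \in l2 -> False.
    move=> K1 K2 q2 q1 p1 p2; have := K4_disjoint e3 K1 K2 q2 q1.
    by rewrite cat_uniq => /and3P[_ /hasPn/(_ _ p2)]; rewrite /= p1.
  case: i j => [[|[|[|]]] // ?] [[|[|[|]]] // ?]; rewrite /S /= => pi pj; try exact: val_inj.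
  - by case: (N s t y).
  - by case: (N s u z).
  - by case: (N s t y).
  - by case: (N t u z).
  - by case: (N s u z).
  - by case: (N t u z).
pose psi (p : 'I_3 * 'I_4) := nth x (S p.1) p.2.
have M p : psi p \in S p.1 by case: (KS p.1) => s4' _ _; rewrite mem_nth // s4'.
have inj : injective psi.
  move=> [i k] [j l] E; have ij : i = j by apply: (D i j (psi (i, k))); rewrite ?(M (i, k)) // E (M (j, l)).
  by subst j; case: (KS i) => s4' U _; move/eqP: E; rewrite /psi /= nth_uniq ?s4' // => /eqP/val_inj ->.
apply: (isomorphic_of_inj inj) => [|[i k] [j l]]; first by rewrite V12 card_prod !card_ord.
rewrite /copies /complete_graph /=; have [ij|/eqP ij] := eqVneq i j => /=; last first.
  apply/negP => E; apply: ij; apply: (D i j (psi (j, l)) _ (M (j, l))).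
  exact: (K4_closed e3 (KS i) (M (i, k))).
subst j; have [->|/eqP kl] := eqVneq k l; first exact: ei.
have [_ _ E] := KS i; apply: E; [exact: (M (i, k))|exact: (M (i, l))|].
by move=> /inj[].
Qed.

End Isomorphisms.

Theorem theorem1p4 (V : finType) (e : rel V) (n : nat)
    (simple_e : simple_graph e) (cubic_e : cubic e) (card_V : #|V| = n)
    (not_K4 : ~ isomorphic e (complete_graph 4))
    (not_K33 : ~ isomorphic e (complete_bipartite 3 3))
    (not_3K4 : ~ isomorphic e (copies 3 (complete_graph 4))) :
  exists2 h : rel V, spanning_subgraph h e &
    forall k : nat, k <= 3 ->
      num_deg h k = n %/ 4 \/ num_deg h k = ceil_div n 4.
Proof.
case: simple_e => es ei.
have e3 : cubic_on [set: V] e by split=> // x y _; rewrite inE.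
have [|h hs hb] := solvable_of_ordinary e3.
  by case=> [|[]|[]]; rewrite cardsT => V_n;
     [case: not_K4|move=> ?; case: not_K33|move=> ?; case: not_3K4];
     [exact: K4_isomorphic|exact: K33_isomorphic|exact: copies_K4_isomorphic].
exists h.
  split; last exact: (proj2 hs).
  by split=> [|x]; [exact: (proj1 hs)|apply/negP => /(proj2 hs); rewrite ei].
have N k : num_on [set: V] h k = num_deg h k by apply: eq_card => x; rewrite !inE.
have := num_on_total e3 hs; move: hb; rewrite /balanced_on !N cardsT card_V /bal /ceil_div => hb tot.
move: hb tot; clear; move=> hb tot [|[|[|[|//]]]] _; lia.
Qed.
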